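(* Let $\psi\in C^0([0,1])$ satisfy $\psi(x)=\psi(1-x)$ for all $x\in(0,1)$, $\psi(0)=\psi(1)<0$, and $\psi(x_0)>0$ for some $x_0\in(0,1)$. Suppose that there exists a minimiser $u\in\mathcal M(\psi)$ of $W$, i.e. $W(u)=\inf_{v\in\mathcal M(\psi)}W(v)$. Then $u\in C^2([0,1])$, $u''$ is weakly differentiable and $u'''\in BV(0,1)$. On the complement of the coincidence set, $\mathcal N:=\{x\in(0,1)\mid u(x)>\psi(x)\}$, the minimiser is smooth, i.e. $u|_{\mathcal N}\in C^\infty(\mathcal N)$.
   Context: For $v\in H^2(0,1)$ the elastica functional is $$W(v)=\int_0^1\frac{v''(x)^2}{(1+v'(x)^2)^{5/2}}\,dx .$$ The admissible set is $$\mathcal M(\psi)=\{v\in H^2_0(0,1)\mid v(x)=v(1-x),\ v(x)\ge\psi(x)\ \text{for all }x\in(0,1)\},$$ where $H^2_0(0,1)$ is the set of $v\in H^2(0,1)$ with $v(0)=v(1)=0$ and $v'(0)=v'(1)=0$. $BV(0,1)$ denotes the functions of bounded variation on $(0,1)$. *)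

(* Defs.v *)
From HB Require Import structures.
From mathcomp Require Import all_boot all_order all_algebra.
From mathcomp Require Import all_classical all_reals all_analysis.
Set Implicit Arguments.
Unset Strict Implicit.
Unset Printing Implicit Defensive.
Import Order.TTheory GRing.Theory Num.Theory.
Import numFieldNormedType.Exports.
Local Open Scope classical_set_scope.
Local Open Scope ring_scope.

(* Functions on (0,1) or [0,1] are functions R -> R whose values elsewhere
   are irrelevant. *)

Definition oo01 (R : realType) : set R := `]0, 1[.
Definition cc01 (R : realType) : set R := `[0, 1].
Arguments oo01 {R}.
Arguments cc01 {R}.

(* On an open set A this is C^oo(A): in one variable, having derivatives of
   all orders implies that they are all continuous. *)
Definition smooth_on (R : realType) (A : set R) (f : R -> R) : Prop :=
  forall n x, A x -> derivable (derive1n n f) x 1.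

(* C^k([0,1]): the derivatives of order at most k on (0,1) extend continuously
   to [0,1]; the witness g is the extension of f'. *)
Fixpoint Ck01 (R : realType) (k : nat) (f : R -> R) : Prop :=
  {within cc01, continuous f} /\
  if k is k'.+1 then
    exists2 g : R -> R, (forall x, oo01 x -> is_derive x 1 f (g x)) & Ck01 k' g
  else True.

Definition test_function (R : realType) (phi : R -> R) : Prop :=
  smooth_on setT phi /\
  (let supp := closure [set x | phi x != 0] in compact supp /\ supp `<=` oo01).

Definition is_weak_derivative (R : realType) (f g : R -> R) : Prop :=
  [/\ locally_integrable oo01 f,
      locally_integrable oo01 g &
      forall phi, test_function phi ->
        \int[lebesgue_measure]_(x in oo01) (f x * derive1 phi x) =
        - \int[lebesgue_measure]_(x in oo01) (g x * phi x)].

Definition weakly_differentiable (R : realType) (f : R -> R) : Prop :=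
  exists g, is_weak_derivative f g.

(* A chosen weak derivative; it is unique up to a null subset of (0,1). *)
Definition weak_derivative (R : realType) (f : R -> R) : R -> R :=
  xget (fun=> 0) [set g | is_weak_derivative f g].

Definition L2 (R : realType) (f : R -> R) : Prop :=
  measurable_fun oo01 f /\
  (\int[lebesgue_measure]_(x in oo01) ((f x) ^+ 2)%:E < +oo)%E.

(* The Sobolev space H^k(0,1) *)
Fixpoint Hk (R : realType) (k : nat) (v : R -> R) : Prop :=
  L2 v /\
  if k is k'.+1 then weakly_differentiable v /\ Hk k' (weak_derivative v)
  else True.

(* An element of H^2_0(0,1) is given by its representative that is continuous
   on [0,1], so that its boundary values make sense pointwise; dv is the
   continuous representative of its derivative. *)
Definition H20 (R : realType) (v : R -> R) : Prop :=
  [/\ Hk 2 v,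
      {within cc01, continuous v},
      v 0 = 0 /\ v 1 = 0 &
      exists dv : R -> R,
        [/\ is_weak_derivative v dv,
            {within cc01, continuous dv},
            dv 0 = 0 & dv 1 = 0]].

Definition elastica (R : realType) (v : R -> R) : \bar R :=
  let dv := weak_derivative v in
  let ddv := weak_derivative dv in
  (\int[lebesgue_measure]_(x in oo01)
     ((ddv x) ^+ 2 / (1 + (dv x) ^+ 2) `^ (5%:R / 2%:R))%:E)%E.

Definition admissible (R : realType) (psi : R -> R) : set (R -> R) :=
  [set v | [/\ H20 v,
               forall x, oo01 x -> v x = v (1 - x) &
               forall x, oo01 x -> psi x <= v x]].

Definition is_minimiser (R : realType) (psi u : R -> R) : Prop :=
  admissible psi u /\
  elastica u = ereal_inf [set elastica v | v in admissible psi].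

(* BV(0,1) is a space of almost-everywhere classes: f belongs to it when some
   representative g has finite total variation on the open interval (0,1),
   i.e. uniformly bounded variation on the closed subintervals. *)
Definition BV01 (R : realType) (f : R -> R) : Prop :=
  exists2 g : R -> R,
    {ae lebesgue_measure, forall x, oo01 x -> f x = g x} &
    exists M : R, forall a b : R, 0 < a -> a <= b -> b < 1 ->
      (total_variation a b g <= M%:E)%E.

Definition noncoincidence (R : realType) (psi u : R -> R) : set R :=
  [set x | oo01 x /\ psi x < u x].

(* Main.v *)
(** Write w for u'', A = 2 w (1 + u'^2)^(-5/2) and B = 5 w^2 u' (1 + u'^2)^(-7/2).
    Comparing u with u + t phi for symmetrised C^2 perturbations phi gives
    int (A phi'' - B phi') >= 0 for phi >= 0, with equality when phi is
    supported where u > psi.  Taking for phi mollified hat functions and letting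
    the mollification scale tend to 0 at Lebesgue points, F = A + int B is seen to
    be convex on a set of full measure, and affine on it inside each interval of
    noncoincidence, in particular near 0 and 1.  Hence F is a.e. of the form
    k + int m with m bounded and nondecreasing, so that
    w = (F - int B) (1 + u'^2)^(5/2) / 2 is continuous with a derivative of bounded
    variation.  Where F is affine, u, u', F - int B and the powers of
    (1 + u'^2)^(1/2) generate a ring closed under differentiation, so u is smooth. *)
Require Import Defs.
From HB Require Import structures.
From mathcomp Require Import all_boot all_order all_algebra.
From mathcomp Require Import all_classical all_reals all_analysis.
From mathcomp Require Import measurable_realfun ring lra.
Set Implicit Arguments.
Unset Strict Implicit.
Unset Printing Implicit Defensive.
Import Order.TTheory GRing.Theory Num.Theory.
Import numFieldNormedType.Exports.
Local Open Scope classical_set_scope.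
Local Open Scope ring_scope.

(** The obstacle is that [w] is only square integrable, so A has no point values and F cannot be
    differentiated. This is why convexity is tested on triples of Lebesgue points: the second
    derivative of a mollified hat consists of three approximate Dirac masses, and the first
    variation tends to the three-point expression of F. Competitors must be symmetric about 1/2;
    since u' is odd and u'' even under x -> 1 - x, the first variations of phi and of its reflection
    agree, so that arbitrary phi can be tested. A convex function on (0,1) may have unbounded slopes
    at the ends; the inequality psi < 0 = u at 0 and 1 makes F affine nearby, which bounds all its
    slopes. The passage from slopes to primitives, and the product rule for functions whose
    derivatives have bounded variation, rest on one device in place of Stieltjes or absolute
    continuity arguments: if the increment of G over [x, y] is at most (y - x) (m(y) - m(x)), then
    subdivision shows that G is constant. *)

Section Derivatives.

(** * Pointwise derivative rules, and smoothness from families closed under differentiation *)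

Context {R : realType}.
Implicit Types (f g : R -> R) (x a b : R).

Lemma is_derive_sum2 f g x a b : is_derive x 1 f a -> is_derive x 1 g b ->
  is_derive x 1 (fun y => f y + g y) (a + b).
Proof. by move=> df dg; have := is_deriveD df dg. Qed.

Lemma is_derive_prod2 f g x a b : is_derive x 1 f a -> is_derive x 1 g b ->
  is_derive x 1 (fun y => f y * g y) (a * g x + f x * b).
Proof.
move=> df dg; apply: (is_derive_eq (is_deriveM df dg)).
by rewrite /GRing.scale /= addrC [g x * _]mulrC.
Qed.

Lemma is_derive_scal f x a (c : R) : is_derive x 1 f a ->
  is_derive x 1 (fun y => c * f y) (c * a).
Proof.
move=> df; apply: (is_derive_eq (is_derive_prod2 (is_derive_cst c x 1) df)).
by rewrite mul0r add0r.
Qed.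

Lemma is_derive_pow f x a n : is_derive x 1 f a ->
  is_derive x 1 (fun y => f y ^+ n) (n%:R * f x ^+ n.-1 * a).
Proof.
move=> df; elim: n => [|n IH].
  under eq_fun do rewrite expr0.
  by rewrite !mul0r; exact: is_derive_cst.
under eq_fun do rewrite exprS.
apply: (is_derive_eq (is_derive_prod2 df IH)).
case: n {IH} => [|n] /=; first by rewrite !expr0; ring.
by rewrite exprS -!natr1; ring.
Qed.

Lemma is_derive_inv f x a : f x != 0 -> is_derive x 1 f a ->
  is_derive x 1 (fun y => (f y)^-1) (- a * (f x)^-1 ^+ 2).
Proof.
move=> fx df; apply: (is_derive_eq (is_deriveV fx df)).
by rewrite /GRing.scale /= exprVn mulNr mulrC mulNr mulrC.
Qed.

Lemma is_derive_chain f g x a b : is_derive (g x) 1 f a -> is_derive x 1 g b ->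
  is_derive x 1 (fun y => f (g y)) (a * b).
Proof. exact: is_derive1_comp. Qed.

Lemma is_derive_affine x (c d : R) : is_derive x 1 (fun y => c * y + d) c.
Proof.
apply: (is_derive_eq (is_derive_sum2 (is_derive_scal c (is_derive_id x 1))
  (is_derive_cst d x 1))).
by rewrite mulr1 addr0.
Qed.

Lemma is_derive_cont f x a : is_derive x 1 f a -> {for x, continuous f}.
Proof. by case=> df _; apply/differentiable_continuous/derivable1_diffP. Qed.

Lemma is_derive_derive1 f x a : is_derive x 1 f a -> derive1 f x = a.
Proof. by move=> df; rewrite derive1E derive_val. Qed.

(** A quadratic error bound gives the derivative without any formula for [f]; this settles a point
    where two branches meet, such as 0 for [expinv]. *)
Lemma is_derive_quadratic f x a (C r : R) : 0 < r ->
  (forall y, `|y - x| < r -> `|f y - f x - a * (y - x)| <= C * (y - x) ^+ 2) ->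
  is_derive x 1 f a.
Proof.
move=> r0 H.
have C0 : 0 <= `|C| + 1 by rewrite addr_ge0.
have Hl : (fun h => h^-1 *: (f (h *: 1 + x) - f x)) @ 0^' --> a.
  apply/cvgrPdist_le => e e0.
  (* The radius keeps the increment within [r] and its product with |C| below [e]; the [+ 1] keeps
     the denominator positive when C = 0. *)
  have d0 : 0 < Num.min (r / 2) (e / (`|C| + 1)).
    by rewrite lt_min !divr_gt0 //= ltr_pwDr.
  exists (Num.min (r / 2) (e / (`|C| + 1))) => //= h.
  rewrite /ball_ /= sub0r normrN lt_min => /andP[hr he] hn0.
  have hpos : 0 < `|h| by rewrite normr_gt0.
  have := H (h *: 1 + x); rewrite /GRing.scale /= mulr1 addrK => /(_ _) Hh.
  have -> : a - h^-1 * (f (h + x) - f x) = - (h^-1 * (f (h + x) - f x - a * h)).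
    by field.
  rewrite normrN normrM normfV ler_pdivrMl //.
  apply: le_trans (Hh _) _; first lra.
  have -> : h ^+ 2 = `|h| * `|h| by rewrite -normrM -expr2 ger0_norm ?sqr_ge0.
  rewrite mulrA [C * _]mulrC -mulrA ler_pM2l //.
  move: he; rewrite ltr_pdivlMr ?ltr_pwDr // => he.
  have := ler_norm C; nra.
apply: DeriveDef; last exact: cvg_lim Hl.
by apply/cvg_ex; exists a.
Qed.

Lemma near_is_derive f g x a (A : set R) : open A -> A x ->
  (forall y, A y -> f y = g y) -> is_derive x 1 f a -> is_derive x 1 g a.
Proof.
move=> oA Ax fg; apply: near_eq_is_derive.
by apply: filterS (open_nbhs_nbhs (conj oA Ax)).
Qed.

(** By induction the n-th derivative agrees on [A] with a member of the family, so no formula for it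
    is written. Openness matters because [derive1n n f] is known on [A] only. *)
Lemma derivative_family_smooth (A : set R) (Fam : (R -> R) -> Prop) :
  open A ->
  (forall f, Fam f ->
    exists2 g, Fam g & forall x, A x -> is_derive x 1 f (g x)) ->
  forall f, Fam f -> smooth_on A f.
Proof.
move=> oA H f Ff n x Ax.
have [g Fg fg] : exists2 g, Fam g & forall x, A x -> derive1n n f x = g x.
  elim: n => [|n [g Fg fg]]; first by exists f.
  have [g' Fg' gg'] := H _ Fg; exists g' => // y Ay.
  rewrite derive1nS; apply: is_derive_derive1.
  by apply: (near_is_derive oA Ay _ (gg' y Ay)) => z /fg ->.
have [g' Fg' gg'] := H _ Fg.
have [//] : is_derive x 1 (derive1n n f) (g' x).
by apply: (near_is_derive oA Ax _ (gg' x Ax)) => z /fg ->.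
Qed.

(** By the Leibniz rule it is enough that the derivatives of the generators lie in the ring: all its
    elements are then smooth. This serves for the cut-off functions and again for the minimiser off
    the contact set. *)
Inductive gen_ring (G : (R -> R) -> Prop) : (R -> R) -> Prop :=
| gen_ring_base f of G f : gen_ring G f
| gen_ring_cst c : gen_ring G (fun=> c)
| gen_ring_add f g of gen_ring G f & gen_ring G g :
    gen_ring G (fun x => f x + g x)
| gen_ring_mul f g of gen_ring G f & gen_ring G g :
    gen_ring G (fun x => f x * g x).

Lemma gen_ring_smooth (A : set R) (G : (R -> R) -> Prop) : open A ->
  (forall f, G f ->
    exists2 g, gen_ring G g & forall x, A x -> is_derive x 1 f (g x)) ->
  forall f, gen_ring G f -> smooth_on A f.
Proof.
move=> oA H; apply: derivative_family_smooth => // f.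
elim=> [{}f /H //|c|f1 f2 G1 [g1 ? d1] G2 [g2 ? d2]|f1 f2 G1 [g1 ? d1] G2 [g2 ? d2]].
- by exists (fun=> 0) => [|x _]; [exact: gen_ring_cst|exact: is_derive_cst].
- exists (fun x => g1 x + g2 x); first exact: gen_ring_add.
  by move=> x Ax; apply: is_derive_sum2; [exact: d1|exact: d2].
- exists (fun x => g1 x * f2 x + f1 x * g2 x).
    by apply: gen_ring_add; exact: gen_ring_mul.
  by move=> x Ax; apply: is_derive_prod2; [exact: d1|exact: d2].
Qed.

Lemma gen_ring_opp G f : gen_ring G f -> gen_ring G (fun x => - f x).
Proof.
move=> Gf; have := gen_ring_mul (gen_ring_cst G (-1)) Gf.
by congr gen_ring; apply/funext => x; rewrite mulN1r.
Qed.

Lemma gen_ring_exp G f n : gen_ring G f -> gen_ring G (fun x => f x ^+ n).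
Proof.
move=> Gf; elim: n => [|n IH].
  by under eq_fun do rewrite expr0; exact: gen_ring_cst.
by under eq_fun do rewrite exprS; exact: gen_ring_mul.
Qed.

End Derivatives.

(** * A smooth step from 0 to 1 built from exp(-1/x), and its derivative as a mollifier *)

Section SmoothStep.
Context {R : realType}.
Implicit Types (x y : R) (n : nat).

(* The parameter [n] makes the family closed under differentiation. *)
Definition expinv n x : R :=
  if x <= 0 then 0 else expR (- x^-1) * x^-1 ^+ n.

Lemma expinv_ge0 n x : 0 <= expinv n x.
Proof.
rewrite /expinv; case: (leP x 0) => // x0.
by rewrite mulr_ge0 ?expR_ge0// exprn_ge0// invr_ge0 ltW.
Qed.

Lemma expinv_gt0 n x : 0 < x -> 0 < expinv n x.
Proof.
by move=> x0; rewrite /expinv leNgt x0/= mulr_gt0 ?expR_gt0// exprn_gt0// invr_gt0.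
Qed.

Lemma expinv_le0 n x : x <= 0 -> expinv n x = 0.
Proof. by rewrite /expinv => ->. Qed.

(** With y = 1/x it is the bound y^(n+2) / (n+2)! <= e^y from the exponential series. It yields the
    derivative 0 at the origin, where the two branches of [expinv] meet. *)
Lemma expinv_quadratic n x : expinv n x <= (n.+2)`!%:R * x ^+ 2.
Proof.
rewrite /expinv; case: (leP x 0) => x0; first by rewrite mulr_ge0// sqr_ge0.
set y := x^-1; have y0 : 0 < y by rewrite invr_gt0.
have xE : x = y^-1 by rewrite invrK.
have ey : y ^+ n.+2 / (n.+2)`!%:R <= expR y.
  by apply: le_trans (expR_ge1Dxn n.+1 (ltW y0)); rewrite lerDr.
have f0 : 0 < (n.+2)`!%:R :> R by rewrite ltr0n fact_gt0.
move: ey; rewrite ler_pdivrMr // => ey.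
have -> : x ^+ 2 = (y ^+ 2)^-1 by rewrite -exprVn -xE.
rewrite expRN ler_pdivlMr ?exprn_gt0 // -mulrA -exprD addn2.
by rewrite mulrC ler_pdivrMr ?expR_gt0// mulrC.
Qed.

Lemma is_derive_expinv n x :
  is_derive x 1 (expinv n) (expinv n.+2 x - n%:R * expinv n.+1 x).
Proof.
have [x0|x0|->] := ltgtP x 0.
- rewrite !expinv_le0 ?ltW// mulr0 subr0.
  apply: (@near_is_derive _ (fun=> 0) _ _ _ `]-oo, 0[%classic).
  + exact: interval_open.
  + by rewrite /= in_itv.
  + by move=> y; rewrite /= in_itv/= => /ltW/expinv_le0 ->.
- pose g (y : R) := expR (- y^-1) * y^-1 ^+ n.
  apply: (@near_is_derive _ g _ _ _ `]0, +oo[%classic).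
  + exact: interval_open.
  + by rewrite /= in_itv/= x0.
  + by move=> y; rewrite /= in_itv/= andbT /g /expinv => y0; rewrite leNgt y0.
  have xn0 : x != 0 by rewrite gt_eqF.
  have dV : is_derive x 1 (fun y : R => y^-1) (- 1 * x^-1 ^+ 2).
    exact: is_derive_inv (is_derive_id x 1).
  have dE : is_derive x 1 (fun y : R => expR (- y^-1)) (expR (- x^-1) * - (- 1 * x^-1 ^+ 2)).
    apply: is_derive_chain; exact: is_deriveN.
  have dX : is_derive x 1 (fun y : R => y^-1 ^+ n) (n%:R * x^-1 ^+ n.-1 * (- 1 * x^-1 ^+ 2)).
    exact: is_derive_pow.
  apply: (is_derive_eq (is_derive_prod2 dE dX)).
  rewrite /expinv leNgt x0/=; case: n {dX g} => [|n]; rewrite ?expr0 /=; rewrite !exprS; ring.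
- rewrite !expinv_le0 ?lexx // mulr0 subr0.
  apply: (@is_derive_quadratic _ _ _ _ (n.+2)`!%:R 1) => // y _.
  rewrite (@expinv_le0 n 0)// mul0r !subr0 ger0_norm ?expinv_ge0//.
  exact: expinv_quadratic.
Qed.

Let den x := (expinv 0 (1 + x) + expinv 0 (1 - x))^-1.
Let nd x : expinv 0 (1 + x) + expinv 0 (1 - x) != 0.
Proof.
rewrite gt_eqF//; case: (ltP 0 x) => x0.
  by rewrite ltr_pwDl ?expinv_ge0// expinv_gt0//; lra.
by rewrite ltr_wpDl ?expinv_ge0// expinv_gt0//; lra.
Qed.

(** The quotient e(1+x) / (e(1+x) + e(1-x)) with e = [expinv 0]; the denominator never vanishes, as
    1+x and 1-x are not both nonpositive. *)
Definition smooth_step x := expinv 0 (1 + x) * den x.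
(** The quotient rule for [smooth_step] after cancellation. Being the derivative of a step from 0 to
    1, it has integral 1 with no normalising constant. *)
Definition smooth_bump x :=
  (expinv 2 (1 + x) * expinv 0 (1 - x) + expinv 0 (1 + x) * expinv 2 (1 - x)) *
  den x ^+ 2.

Let dl n x : is_derive x 1 (fun y => expinv n (1 + y))
   (expinv n.+2 (1 + x) - n%:R * expinv n.+1 (1 + x)).
Proof.
have d1 : is_derive x 1 (fun y : R => 1 + y) 1.
  have := is_derive_affine x 1 1.
  by congr (is_derive _ _ _ _); apply/funext => y; rewrite mul1r addrC.
apply: (is_derive_eq (@is_derive_chain _ _ (fun y => 1 + y) _ _ _ (is_derive_expinv n (1 + x)) d1)).
by rewrite mulr1.
Qed.

Let dr n x : is_derive x 1 (fun y => expinv n (1 - y))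
   (- (expinv n.+2 (1 - x) - n%:R * expinv n.+1 (1 - x))).
Proof.
have d1 : is_derive x 1 (fun y : R => 1 - y) (-1).
  have := is_derive_affine x (-1) 1.
  by congr (is_derive _ _ _ _); apply/funext => y; rewrite mulN1r addrC.
apply: (is_derive_eq (@is_derive_chain _ _ (fun y => 1 - y) _ _ _ (is_derive_expinv n (1 - x)) d1)).
by rewrite mulrN1.
Qed.

Let dden x : is_derive x 1 den
  (- (expinv 2 (1 + x) - expinv 2 (1 - x)) * den x ^+ 2).
Proof.
apply: (is_derive_eq (@is_derive_inv _ (fun y => expinv 0 (1 + y) + expinv 0 (1 - y))
  _ _ (nd x) (is_derive_sum2 (dl 0 x) (dr 0 x)))).
by rewrite !mul0r !subr0.
Qed.

Lemma is_derive_smooth_step x : is_derive x 1 smooth_step (smooth_bump x).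
Proof.
apply: (is_derive_eq (is_derive_prod2 (dl 0 x) (dden x))).
rewrite mul0r subr0 /smooth_bump /den; field; exact: nd.
Qed.

(** A ring contains no quotients, so the reciprocal [den] is a generator of its own; its derivative
    is again polynomial in the generators. *)
Inductive step_gen : (R -> R) -> Prop :=
| step_genl n : step_gen (fun x => expinv n (1 + x))
| step_genr n : step_gen (fun x => expinv n (1 - x))
| step_gend : step_gen den.

Let bl n : gen_ring step_gen (fun x => expinv n (1 + x)).
Proof. exact/gen_ring_base/step_genl. Qed.
Let br n : gen_ring step_gen (fun x => expinv n (1 - x)).
Proof. exact/gen_ring_base/step_genr. Qed.
Let bd : gen_ring step_gen den.
Proof. exact/gen_ring_base/step_gend. Qed.

Let step_ring_smooth f : gen_ring step_gen f -> smooth_on setT f.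
Proof.
apply: gen_ring_smooth => [|{}f]; first exact: openT.
have cs n (g : R -> R) : gen_ring step_gen g -> gen_ring step_gen (fun x => n%:R * g x).
  exact/gen_ring_mul/gen_ring_cst.
case=> [n|n|].
- exists (fun x => expinv n.+2 (1 + x) - n%:R * expinv n.+1 (1 + x)) => [|x _].
    exact/gen_ring_add/gen_ring_opp/cs.
  exact: dl.
- exists (fun x => - (expinv n.+2 (1 - x) - n%:R * expinv n.+1 (1 - x))) => [|x _].
    exact/gen_ring_opp/gen_ring_add/gen_ring_opp/cs.
  exact: dr.
- exists (fun x => - (expinv 2 (1 + x) - expinv 2 (1 - x)) * den x ^+ 2) => [|x _].
    apply/gen_ring_mul/gen_ring_exp/bd/gen_ring_opp/gen_ring_add/gen_ring_opp; [exact: bl|exact: br].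
  exact: dden.
Qed.

Lemma smooth_step_smooth : smooth_on setT smooth_step.
Proof. by apply: step_ring_smooth; apply: gen_ring_mul. Qed.

Lemma smooth_bump_smooth : smooth_on setT smooth_bump.
Proof.
apply: step_ring_smooth; apply: gen_ring_mul; last exact: gen_ring_exp.
by apply: gen_ring_add; apply: gen_ring_mul.
Qed.

Lemma smooth_bump_ge0 x : 0 <= smooth_bump x.
Proof. by rewrite mulr_ge0 ?sqr_ge0// addr_ge0// mulr_ge0// expinv_ge0. Qed.

Lemma smooth_bump_out x : 1 <= `|x| -> smooth_bump x = 0.
Proof.
rewrite ler_normr /smooth_bump => /orP[x1|x1].
  by rewrite !(@expinv_le0 _ (1 - x)) ?mulr0 ?addr0 ?mul0r//; lra.
by rewrite !(@expinv_le0 _ (1 + x)) ?mulr0 ?mul0r ?addr0 ?mul0r//; lra.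
Qed.

Lemma smooth_step0 x : x <= -1 -> smooth_step x = 0.
Proof. by move=> x1; rewrite /smooth_step expinv_le0 ?mul0r//; lra. Qed.

Lemma smooth_step1 x : 1 <= x -> smooth_step x = 1.
Proof.
move=> x1; have := nd x; rewrite /smooth_step /den (@expinv_le0 _ (1 - x)); last lra.
by rewrite addr0 => /mulfV.
Qed.

Lemma smooth_step_itv x : 0 <= smooth_step x <= 1.
Proof.
have n0 : 0 < expinv 0 (1 + x) + expinv 0 (1 - x).
  by rewrite lt_neqAle eq_sym nd/= addr_ge0 ?expinv_ge0.
rewrite /smooth_step /den; apply/andP; split.
  by rewrite divr_ge0 ?expinv_ge0// ltW.
by rewrite ler_pdivrMr// mul1r lerDl expinv_ge0.
Qed.

Lemma smooth_step_continuous : continuous smooth_step.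
Proof. by move=> x; exact: is_derive_cont (is_derive_smooth_step x). Qed.

Lemma smooth_bump_continuous : continuous smooth_bump.
Proof.
move=> x; apply/differentiable_continuous/derivable1_diffP.
exact: (@smooth_bump_smooth 0 x).
Qed.

Lemma smooth_bump_bounded : exists2 C : R, 0 < C & forall x, smooth_bump x <= C.
Proof.
have [||c _ H] := @EVT_max R smooth_bump (-1) 1; first lra.
  exact/continuous_subspaceT/smooth_bump_continuous.
exists (smooth_bump c + 1); first by rewrite ltr_wpDl ?smooth_bump_ge0.
move=> x; case: (leP 1 `|x|) => x1.
  by rewrite smooth_bump_out// addr_ge0// smooth_bump_ge0.
rewrite (le_trans (H x _)) ?lerDl// in_itv/=.
by move: x1; rewrite ltr_norml => /andP[? ?]; lra.
Qed.

End SmoothStep.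

(** * Integrable functions on the unit interval and their primitives *)

Section UnitIntervalIntegrals.
Context {R : realType}.
Notation mu := (@lebesgue_measure R).
Implicit Types (f g : R -> R) (x y a h : R).

Lemma ae_imply (P Q : R -> Prop) : (forall x, P x -> Q x) ->
  {ae mu, forall x, P x} -> {ae mu, forall x, Q x}.
Proof. by move=> PQ; apply: filterS; first exact: (ae_filter_ringOfSetsType mu). Qed.

Lemma ae_and (P Q : R -> Prop) : {ae mu, forall x, P x} ->
  {ae mu, forall x, Q x} -> {ae mu, forall x, P x /\ Q x}.
Proof.
move=> p q; have F := ae_filter_ringOfSetsType mu.
exact: (@filterI _ _ F _ _ p q).
Qed.

Lemma ae_neq (c : R) : {ae mu, forall x, x <> c}.
Proof.
exists [set c]; split => //; first exact: lebesgue_measure_set1.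
by move=> t /=; apply: contra_notP => t0 /=.
Qed.

(** The closed interval suits primitives from 0 and continuity up to the ends; the end points are
    null, so integrals over [oo01] are the same. *)
Definition L1 f : Prop := mu.-integrable `[0, 1] (EFin \o f).
Definition prim f x := \int[mu]_(t in `[0, x]) f t.

Lemma L1_sub f (A : set R) : L1 f -> measurable A -> A `<=` `[0, 1] ->
  mu.-integrable A (EFin \o f).
Proof. by move=> f1 mA A01; apply: integrableS f1. Qed.

Lemma oo_sub_cc : (oo01 : set R) `<=` `[0, 1].
Proof. by move=> x; rewrite /oo01/= !in_itv/= => /andP[? ?]; rewrite !ltW. Qed.

Lemma measurable_oo01 : measurable (oo01 : set R).
Proof. exact: measurable_itv. Qed.

Lemma L1_oo f : L1 f -> mu.-integrable oo01 (EFin \o f).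
Proof.
by move=> f1; apply: L1_sub => //; [exact: measurable_itv|exact: oo_sub_cc].
Qed.

Lemma oo_L1 f : mu.-integrable oo01 (EFin \o f) -> L1 f.
Proof.
move=> /integrableP[mf fi]; apply/integrableP; split.
  exact/emeasurable_fun_itv_bndo_bndcP/emeasurable_fun_itv_obnd_cbndP.
by rewrite integral_itv_bndoo//; exact: measurableT_comp.
Qed.

Lemma Rintegral_oo01 f : L1 f -> \int[mu]_(x in oo01) f x = prim f 1.
Proof.
move=> f1; rewrite Rintegral_itv_obnd_cbnd; last exact: L1_oo.
rewrite Rintegral_itv_bndo_bndc//; apply: L1_sub f1 _ _ => //.
by apply: subset_itvl; rewrite bnd_simp.
Qed.

Lemma prim0 f : prim f 0 = 0.
Proof. by rewrite /prim set_itv1 Rintegral_set1. Qed.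

Lemma prim_diff f x y : L1 f -> 0 <= x -> x <= y -> y <= 1 ->
  prim f y - prim f x = \int[mu]_(t in `]x, y]) f t.
Proof.
move=> f1 x0 xy y1; apply: Rintegral_itvB; rewrite ?bnd_simp//.
by apply: L1_sub f1 _ _ => //; apply: subset_itvl; rewrite bnd_simp.
Qed.

Lemma L1_itv f x y : L1 f -> 0 <= x -> y <= 1 ->
  mu.-integrable `]x, y] (EFin \o f).
Proof.
move=> f1 x0 y1; apply: L1_sub f1 _ _ => //.
by apply: subset_itv; rewrite bnd_simp.
Qed.

Lemma le_prim f g x y : L1 f -> L1 g -> 0 <= x -> x <= y -> y <= 1 ->
  (forall t, x < t <= y -> f t <= g t) ->
  prim f y - prim f x <= prim g y - prim g x.
Proof.
move=> f1 g1 x0 xy y1 fg; rewrite !prim_diff//; apply: le_Rintegral => //; exact: L1_itv.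
Qed.

Lemma eq_prim f g x y : 0 <= x -> x <= y -> y <= 1 -> L1 f -> L1 g ->
  (forall t, x < t <= y -> f t = g t) ->
  prim f y - prim f x = prim g y - prim g x.
Proof.
move=> x0 xy y1 f1 g1 fg; rewrite !prim_diff//; apply: eq_Rintegral => t.
by rewrite inE/= in_itv/=; exact: fg.
Qed.

Lemma L1_norm f : L1 f -> L1 (fun x => `|f x|).
Proof. exact: integrable_norm. Qed.

Lemma normr_prim f x y : L1 f -> 0 <= x -> x <= y -> y <= 1 ->
  `|prim f y - prim f x| <= prim (fun t => `|f t|) y - prim (fun t => `|f t|) x.
Proof.
move=> f1 x0 xy y1; rewrite !prim_diff//; last exact: L1_norm.
by apply: le_normr_Rintegral => //; exact: L1_itv.
Qed.

Lemma L1D f g : L1 f -> L1 g -> L1 (fun x => f x + g x).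
Proof. by move=> f1 g1; apply: eq_integrable (integrableD _ f1 g1). Qed.

Lemma L1Z f c : L1 f -> L1 (fun x => c * f x).
Proof. by move=> f1; apply: eq_integrable (integrableZl _ c f1). Qed.

Lemma L1B f g : L1 f -> L1 g -> L1 (fun x => f x - g x).
Proof. by move=> f1 g1; apply: eq_integrable (integrableB _ f1 g1). Qed.

Lemma L1_cst c : L1 (fun=> c).
Proof.
apply: continuous_compact_integrable; first exact: segment_compact.
exact/continuous_subspaceT/cst_continuous.
Qed.

Lemma L1_continuous f : {within `[0, 1], continuous f} -> L1 f.
Proof.
by apply: continuous_compact_integrable; exact: segment_compact.
Qed.

Lemma L1_measurable f : L1 f -> measurable_fun (cc01 : set R) f.
Proof. by case/integrableP => /measurable_EFinP. Qed.

Lemma L1_bounded f (M : R) : measurable_fun (cc01 : set R) f ->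
  (forall x, 0 <= x <= 1 -> `|f x| <= M) -> L1 f.
Proof.
move=> mf fM; apply: le_integrable (L1_cst M) => //; first exact/measurable_EFinP.
move=> x /=; rewrite in_itv/= => x01; rewrite lee_fin (le_trans (fM x x01))//.
exact: ler_norm.
Qed.

Lemma L1M f g (M : R) : L1 f -> measurable_fun (cc01 : set R) g ->
  (forall x, 0 <= x <= 1 -> `|g x| <= M) -> L1 (fun x => f x * g x).
Proof.
move=> f1 mg gM; apply: le_integrable (L1Z M f1) => //.
  apply/measurable_EFinP; apply: measurable_funM => //; exact: L1_measurable.
move=> x /=; rewrite in_itv/= => x01; rewrite lee_fin !normrM mulrC.
by rewrite ler_wpM2r// (le_trans (gM x x01))// ler_norm.
Qed.

Lemma continuous_itv_bounded f : {within `[0, 1], continuous f} ->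
  exists M : R, forall x, 0 <= x <= 1 -> `|f x| <= M.
Proof.
move=> cf.
have cn : {within `[0, 1], continuous (fun x => `|f x|)}.
  by move=> x; apply: cvg_norm; exact: cf.
have [c _ H] := EVT_max ler01 cn; exists `|f c| => x x01.
by apply: H; rewrite in_itv.
Qed.

Lemma L1M_continuous f g : L1 f -> {within `[0, 1], continuous g} ->
  L1 (fun x => f x * g x).
Proof.
move=> f1 cg; have [M gM] := continuous_itv_bounded cg.
by apply: L1M f1 _ gM; apply: subspace_continuous_measurable_fun => //;
  exact: measurable_itv.
Qed.

Lemma primD f g x : L1 f -> L1 g -> 0 <= x <= 1 ->
  prim (fun t => f t + g t) x = prim f x + prim g x.
Proof.
by move=> f1 g1 /andP[x0 x1]; apply: RintegralD => //; apply: L1_sub => //;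
  apply: subset_itvl; rewrite bnd_simp.
Qed.

Lemma prim_cst c x : 0 <= x -> prim (fun=> c) x = c * x.
Proof.
move=> x0; rewrite /prim Rintegral_cst; last exact: measurable_itv.
rewrite /= lebesgue_measure_itv/= lte_fin.
by case: ltP => [_|x0']; rewrite /= ?subr0// (@le_anti _ _ x 0)// x0 x0'.
Qed.

(** The hypothesis concerns the open interval; 0 and 1 are discarded as null sets. *)
Lemma prim_ae f g x : L1 f -> L1 g -> 0 <= x <= 1 ->
  {ae mu, forall t, oo01 t -> f t = g t} -> prim f x = prim g x.
Proof.
move=> f1 g1 /andP[x0 x1] fg.
have s : `[0, x] `<=` (`[0, 1] : set R) by apply: subset_itvl; rewrite bnd_simp.
rewrite /prim /Rintegral; congr fine; apply: ae_eq_integral => //.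
- by apply: measurable_funS (measurable_int _ f1).
- by apply: measurable_funS (measurable_int _ g1).
apply: ae_imply (ae_and (ae_and (ae_neq 0) (ae_neq 1)) fg) => t [[t0 t1] H] /s /=.
rewrite in_itv/= => /andP[a b].
congr EFin; apply: H; rewrite /oo01 /= in_itv/= !lt_neqAle a b.
by rewrite eq_sym; do 2 (case: eqP => //).
Qed.

Lemma prim_continuous f : L1 f -> {within `[0, 1], continuous (prim f)}.
Proof. exact: parameterized_integral_continuous. Qed.

Lemma is_derive_prim f x : L1 f -> 0 < x < 1 -> {for x, continuous f} ->
  is_derive x 1 (prim f) (f x).
Proof.
move=> f1 /andP[x0 x1] cf.
have [d e] := @continuous_FTC1_closed R f 0 x 1 x1 f1 x0 cf.
by rewrite derive1E in e; exact: (DeriveDef d e).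
Qed.

(** Lebesgue differentiation is applied to the restriction of [f] to [0,1], which is locally
    integrable on the whole line; at points of (0,1) both functions have the same primitive. *)
Lemma is_derive_prim_ae f : L1 f ->
  {ae mu, forall x, 0 < x < 1 -> is_derive x 1 (prim f) (f x)}.
Proof.
move=> f1; have mcc : measurable (`[0, 1] : set R) by exact: measurable_itv.
apply: ae_imply (lebesgue_differentiation (integrable_locally_restrict mcc f1)).
move=> x lx /andP[x0 x1].
pose f' := f \_ `[0, 1].
have i' : mu.-integrable `[0, 1] (EFin \o f').
  apply: eq_integrable f1 => // t t01 /=; first by rewrite /f' patchE t01.
have [|d e] := @FTC1_lebesgue_pt R f' (BLeft 0) x 1 x1 i' _ lx.
  by rewrite (@lte_fin R).
have fE : f' x = f x by rewrite /f' patchE ifT// inE/= in_itv/= !ltW.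
have : is_derive x 1 (fun y => \int[mu]_(t in `[0, y]) f' t) (f x).
  by rewrite derive1E fE in e; exact: (DeriveDef d e).
apply: (@near_is_derive _ _ _ _ _ `]0, 1[%classic) => //.
  by rewrite /= in_itv/= x0.
move=> y; rewrite /= in_itv/= => /andP[y0 y1]; apply: eq_Rintegral => t.
rewrite inE/= in_itv/= => /andP[t0 ty].
by rewrite /f' patchE ifT// inE/= in_itv/= t0 (le_trans ty)// ltW.
Qed.

Lemma prim_FTC2 f (F : R -> R) x y : (forall t : R, is_derive t 1 F (f t)) ->
  continuous f -> 0 <= x -> x <= y -> y <= 1 ->
  prim f y - prim f x = F y - F x.
Proof.
move=> dF cf x0 xy y1.
have f1 : L1 f by apply/L1_continuous/continuous_subspaceT.
rewrite prim_diff//; move: xy; rewrite le_eqVlt => /predU1P[->|xy].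
  by rewrite set_itv_ge ?bnd_simp ?ltxx// Rintegral_set0 subrr.
rewrite Rintegral_itv_obnd_cbnd; last by apply: L1_itv.
have cF : continuous F by move=> t; exact: is_derive_cont (dF t).
rewrite /Rintegral (@continuous_FTC2 R f F)//.
- exact/continuous_subspaceT.
- split; last 2 first.
  + exact/cvg_at_right_filter/cF.
  + exact/cvg_at_left_filter/cF.
  by move=> t _; have [] := dF t.
- by move=> t _; exact: is_derive_derive1.
Qed.

End UnitIntervalIntegrals.

(** * Invariance of Lebesgue measure and of integrals under x -> 1 - x *)

Section Reflection.
Context {R : realType}.
Notation mu := (@lebesgue_measure R).
Implicit Types (f g : R -> R) (x y a h : R).

Lemma measurable_onem : measurable_fun [set: R] (fun x : R => 1 - x).
Proof. exact: measurable_funB. Qed.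

(** The preimage of ]a, b] is [1 - b, 1 - a[, of the same length, and half-open intervals determine
    the measure. *)
Lemma lebesgue_measure_onem (A : set R) : measurable A ->
  pushforward mu ((fun x => 1 - x) : _ -> measurableTypeR R) A = mu A.
Proof.
move=> mA; apply/esym/lebesgue_measure_unique => //=.
  exact: measurable_onem.
move=> _ _ [[a b]] _ <-.
rewrite /pushforward /=.
have -> : (fun x : R => 1 - x) @^-1` `]a, b] = `[1 - b, 1 - a[%classic.
  apply/seteqP; split => x /=; rewrite !in_itv/= => /andP[? ?]; apply/andP; split; lra.
by rewrite !lebesgue_measure_itv/= !lte_fin ltrD2l ltrN2; case: ifP => // _; congr EFin; ring.
Qed.

Lemma ae_onem (P : R -> Prop) : {ae mu, forall x, P x} ->
  {ae mu, forall x, P (1 - x)}.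
Proof.
move=> [N [mN N0 PN]].
exists ((fun x : R => 1 - x) @^-1` N); split.
- by rewrite -[X in measurable X]setTI; exact: measurable_onem.
- by rewrite -N0; exact: lebesgue_measure_onem.
- by move=> x nP; apply: PN.
Qed.

Lemma oo01_onem x : oo01 x -> oo01 (1 - x).
Proof. by rewrite /oo01/= !in_itv/= => /andP[? ?]; apply/andP; split; lra. Qed.

Lemma preimage_onem_oo01 : (fun x : R => 1 - x) @^-1` oo01 = oo01.
Proof.
apply/seteqP; split => x; first by move/oo01_onem; rewrite subKr.
exact: oo01_onem.
Qed.

Let restr_measurable f : L1 f -> measurable_fun [set: R] (EFin \o (f \_ oo01)).
Proof.
move=> /L1_oo /integrableP[/measurable_EFinP mf _]; apply/measurable_EFinP.
by apply/(measurable_restrictT _ _).1 => //; exact: measurable_itv.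
Qed.

Let restrE f x : oo01 x -> (f \_ oo01) x = f x.
Proof. by move=> x01; rewrite patchE ifT// inE. Qed.

(** Extending [f] by 0 outside (0,1) gives a function measurable on the line, to which the change of
    variables for a pushforward applies; (0,1) is its own preimage. *)
Lemma L1_onem f : L1 f -> L1 (fun x => f (1 - x)).
Proof.
move=> f1; apply: oo_L1; have mf' := restr_measurable f1.
have moo := @measurable_oo01 R.
have mm : measurable_fun [set: measurableTypeR R]
  ((fun x : R => 1 - x) : _ -> measurableTypeR R) by exact: measurable_onem.
pose muM : {measure set (measurableTypeR R) -> \bar R} := mu.
suff : mu.-integrable oo01 (EFin \o (fun x => (f \_ oo01) (1 - x))).
  by apply: eq_integrable => // x; rewrite inE => x01 /=; rewrite restrE//; exact: oo01_onem.
apply/integrableP; split.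
  apply: (@measurable_funS _ _ _ _ setT) => //.
  by apply: (measurableT_comp mf'); exact: measurable_onem.
have := @ge0_integral_pushforward _ _ _ _ _ _ mm muM oo01
  (fun x => `|(f \_ oo01) x|%:E) moo _ _.
rewrite preimage_onem_oo01 /comp /= => <-; last 2 first.
- by apply: measurable_funTS; exact: (measurableT_comp (@abse_measurable R setT) mf').
- by move=> x _; rewrite lee_fin.
rewrite (eq_measure_integral mu); last by move=> A mA _; exact: lebesgue_measure_onem.
have /integrableP[_] := L1_oo f1; rewrite [X in (X < _)%E -> _](_ : _ =
  (\int[mu]_(x in oo01) `|(f \_ oo01) x|%:E)%E)//.
by apply: eq_integral => x; rewrite inE => x01 /=; rewrite restrE.
Qed.

Lemma Rintegral_onem f : L1 f ->
  \int[mu]_(x in oo01) f (1 - x) = \int[mu]_(x in oo01) f x.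
Proof.
move=> f1; have mf' := restr_measurable f1.
have moo := @measurable_oo01 R; rewrite /Rintegral; congr fine.
have mm : measurable_fun [set: measurableTypeR R]
  ((fun x : R => 1 - x) : _ -> measurableTypeR R) by exact: measurable_onem.
pose muM : {measure set (measurableTypeR R) -> \bar R} := mu.
transitivity (\int[mu]_(x in oo01) ((f \_ oo01) (1 - x))%:E)%E.
  by apply: eq_integral => x; rewrite inE => x01; rewrite restrE//; exact: oo01_onem.
have := @integral_pushforward _ _ _ _ _ _ mm muM oo01 _ mf' _ moo.
rewrite preimage_onem_oo01 /comp /= => <-.
  rewrite (eq_measure_integral mu); last by move=> A mA _; exact: lebesgue_measure_onem.
  by apply: eq_integral => x; rewrite inE => x01; rewrite restrE.
have := L1_oo (L1_onem f1); apply: eq_integrable => // x; rewrite inE => x01 /=.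
by rewrite restrE//; exact: oo01_onem.
Qed.

End Reflection.

(** * A convex antiderivative of the smooth step *)

Section Ramp.
Context {R : realType}.
Notation mu := (@lebesgue_measure R).
Notation S := (@smooth_step R).
Implicit Types (x y : R).

(** Integration starts at -2, strictly left of -1, so that every x >= -1 is interior to the range of
    integration and the fundamental theorem gives the derivative there. *)
Definition ramp x : R := if x <= -1 then 0 else \int[mu]_(t in `[-2, x]) S t.

Let Sint u : mu.-integrable `[-2, u] (EFin \o S).
Proof.
apply: continuous_compact_integrable; first exact: segment_compact.
exact/continuous_subspaceT/smooth_step_continuous.
Qed.

Lemma ramp_le x : x <= -1 -> ramp x = 0. Proof. by rewrite /ramp => ->. Qed.

Let ramp_ge x : -2 < x -> ramp x = \int[mu]_(t in `[-2, x]) S t.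
Proof.
move=> x2; rewrite /ramp; case: leP => // x1.
by rewrite (@eq_Rintegral _ _ _ _ _ (fun=> 0)) ?Rintegral_cst ?mul0r//= => t;
  rewrite inE/= in_itv/= => /andP[_ tx]; rewrite smooth_step0//; lra.
Qed.

Lemma is_derive_ramp x : is_derive x 1 ramp (S x).
Proof.
case: (ltP x (-1)) => x1.
  rewrite smooth_step0 ?ltW//.
  apply: (@near_is_derive _ (fun=> 0) _ _ _ `]-oo, -1[%classic).
  - exact: interval_open.
  - by rewrite /= in_itv.
  - by move=> y; rewrite /= in_itv/= => /ltW/ramp_le ->.
have x2 : -2 < x by lra.
have [d e] := @continuous_FTC1_closed R S (-2) x (x + 1) ltac:(lra) (Sint _) x2
  (@smooth_step_continuous R x).
apply: (@near_is_derive _ (fun y => \int[mu]_(t in `[-2, y]) S t) _ _ _ `]-2, +oo[%classic).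
- exact: interval_open.
- by rewrite /= in_itv/= x2.
- by move=> y; rewrite /= in_itv/= andbT => /ramp_ge ->.
- by rewrite derive1E in e; exact: (DeriveDef d e).
Qed.

Lemma ramp_ge1 x : 1 <= x -> ramp x = ramp 1 + (x - 1).
Proof.
have cr : continuous (ramp : R -> R) by move=> y; exact: is_derive_cont (is_derive_ramp y).
move=> x1; have [||c + ] := @MVT_segment R ramp S 1 x x1.
- by move=> y _; exact: is_derive_ramp.
- exact/continuous_subspaceT.
by rewrite in_itv/= => /andP[c1 _] /eqP; rewrite smooth_step1// mul1r subr_eq addrC => /eqP.
Qed.

Lemma smooth_step_mono x y : x <= y -> S x <= S y.
Proof.
move=> xy; rewrite -subr_ge0.
have [||c _ ->] := @MVT_segment R S (@smooth_bump R) x y xy.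
- by move=> t _; exact: is_derive_smooth_step.
- exact/continuous_subspaceT/smooth_step_continuous.
by rewrite mulr_ge0 ?smooth_bump_ge0// subr_ge0.
Qed.

(** The derivative [smooth_step] is nondecreasing, so the mean slope on [x, y] is at most that on
    [y, z]. Denominators are cleared so that points may coincide. *)
Lemma ramp_convex (x y z : R) : x <= y -> y <= z ->
  (z - x) * ramp y <= (z - y) * ramp x + (y - x) * ramp z.
Proof.
have cr : continuous (ramp : R -> R) by move=> t; exact: is_derive_cont (is_derive_ramp t).
move=> xy yz.
have [||c cxy e1] := @MVT_segment R ramp S x y xy.
- by move=> t _; exact: is_derive_ramp.
- exact/continuous_subspaceT.
have [||d dyz e2] := @MVT_segment R ramp S y z yz.
- by move=> t _; exact: is_derive_ramp.
- exact/continuous_subspaceT.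
have cd : S c <= S d.
  apply: smooth_step_mono; move: cxy dyz; rewrite !in_itv/=; lra.
have H : 0 <= (S d - S c) * ((y - x) * (z - y)).
  by rewrite !mulr_ge0 ?subr_ge0.
nra.
Qed.

End Ramp.

(** * Mollification at scale h and its limits as h tends to 0 *)

Section Mollification.
Context {R : realType}.
Notation mu := (@lebesgue_measure R).
Implicit Types (f g : R -> R) (x y a h : R).

(** The powers of [h] are such that [ramp_h] has derivative [step_h], which has derivative [bump_h];
    the latter then has mass 1 on [-h, h]. *)
Definition bump_h h y : R := h^-1 * smooth_bump (y / h).
Definition step_h h y : R := smooth_step (y / h).
Definition ramp_h h y : R := h * ramp (y / h).

Lemma is_derive_scaled (F : R -> R) h a x d : is_derive ((x - a) / h) 1 F d ->
  is_derive x 1 (fun y => F ((y - a) / h)) (d * h^-1).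
Proof.
move=> dF; have e : is_derive x 1 (fun y : R => (y - a) / h) h^-1.
  have := is_derive_affine x h^-1 (- a / h).
  by congr (is_derive _ _ _ _); apply/funext => y; rewrite mulrBl mulrC mulNr.
exact: (@is_derive_chain _ F (fun y => (y - a) / h)).
Qed.

Lemma is_derive_step_h h a x :
  is_derive x 1 (fun y => step_h h (y - a)) (bump_h h (x - a)).
Proof.
apply: (is_derive_eq (is_derive_scaled (is_derive_smooth_step _))).
by rewrite mulrC.
Qed.

Lemma is_derive_ramp_h h a x : h != 0 ->
  is_derive x 1 (fun y => ramp_h h (y - a)) (step_h h (x - a)).
Proof.
move=> h0.
apply: (is_derive_eq (is_derive_scal h (is_derive_scaled (is_derive_ramp _)))).
by rewrite mulrCA mulfV// mulr1.
Qed.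

Lemma bump_h_continuous h a : continuous (fun x => bump_h h (x - a)).
Proof.
move=> x; apply: cvgM; first exact: cvg_cst.
apply: (@continuous_comp _ _ _ (fun y : R => (y - a) / h) (@smooth_bump R));
  last exact: smooth_bump_continuous.
by apply: cvgM; [apply: cvgB; [exact: cvg_id|exact: cvg_cst]|exact: cvg_cst].
Qed.

Lemma step_h_continuous h a : continuous (fun x => step_h h (x - a)).
Proof. by move=> x; exact: is_derive_cont (is_derive_step_h h a x). Qed.

Lemma bump_h_ge0 h x : 0 < h -> 0 <= bump_h h x.
Proof. by move=> h0; rewrite mulr_ge0 ?smooth_bump_ge0// invr_ge0 ltW. Qed.

Lemma bump_h_out h x : 0 < h -> h <= `|x| -> bump_h h x = 0.
Proof.
move=> h0 hx; rewrite /bump_h smooth_bump_out ?mulr0//.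
by rewrite normrM normfV (gtr0_norm h0) ler_pdivlMr// mul1r.
Qed.

Lemma step_h0 h x : 0 < h -> x <= - h -> step_h h x = 0.
Proof. by move=> h0 xh; rewrite /step_h smooth_step0// ler_pdivrMr// mulN1r. Qed.

Lemma step_h1 h x : 0 < h -> h <= x -> step_h h x = 1.
Proof. by move=> h0 xh; rewrite /step_h smooth_step1// ler_pdivlMr// mul1r. Qed.

Lemma step_h_itv h x : 0 <= step_h h x <= 1.
Proof. exact: smooth_step_itv. Qed.

Lemma L1_bump f h a : L1 f -> L1 (fun x => f x * bump_h h (x - a)).
Proof.
by move=> f1; apply: L1M_continuous => //; exact/continuous_subspaceT/bump_h_continuous.
Qed.

Lemma L1_step f h a : L1 f -> L1 (fun x => f x * step_h h (x - a)).
Proof.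
by move=> f1; apply: L1M_continuous => //; exact/continuous_subspaceT/step_h_continuous.
Qed.

Lemma Rintegral_bump h a : 0 < h -> h <= a -> a <= 1 - h ->
  \int[mu]_(x in oo01) bump_h h (x - a) = 1.
Proof.
move=> h0 ha ah; rewrite Rintegral_oo01; last first.
  exact/L1_continuous/continuous_subspaceT/bump_h_continuous.
have -> : prim (fun x => bump_h h (x - a)) 1 =
    prim (fun x => bump_h h (x - a)) 1 - prim (fun x => bump_h h (x - a)) 0.
  by rewrite prim0 subr0.
rewrite (@prim_FTC2 R _ (fun x => step_h h (x - a)) 0 1 (is_derive_step_h h a)
  (@bump_h_continuous h a))//.
by rewrite step_h1 ?step_h0 ?subr0//; lra.
Qed.

(** The kernel has mass 1 and is at most C/h on a ball of length 2h, so the error is at most C/h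
    times the integral of |f - f(a)| over the ball, that is 2C times its average. This reaches every
    Lebesgue point of a merely integrable [f]. *)
Lemma bump_davg f : L1 f -> exists2 C : R, 0 < C &
  forall a h, 0 < h -> h <= a -> a <= 1 - h ->
    `|\int[mu]_(x in oo01) (f x * bump_h h (x - a)) - f a| <=
    C * fine (davg (f \_ `[0, 1]) a h).
Proof.
move=> f1; have [C C0 HC] := @smooth_bump_bounded R; exists (2 * C); first lra.
move=> a h h0 ha ah.
have moo := @measurable_oo01 R.
have a01 : `[0, 1]%classic a by rewrite /= in_itv/=; lra.
have mb : measurable (ball a h) by exact: measurable_ball.
have bs : ball a h `<=` oo01.
  by move=> x; rewrite ball_itv/oo01/= !in_itv/= => /andP[? ?]; apply/andP; split; lra.
have kb : L1 (fun x => bump_h h (x - a)).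
  exact/L1_continuous/continuous_subspaceT/bump_h_continuous.
have fk := L1_bump h a f1.
have fa1 : L1 (fun x => f x - f a) by apply: L1B => //; exact: L1_cst.
have -> : \int[mu]_(x in oo01) (f x * bump_h h (x - a)) - f a =
          \int[mu]_(x in oo01) ((f x - f a) * bump_h h (x - a)).
  rewrite -[X in _ - X]mulr1 -(Rintegral_bump h0 ha ah) -RintegralZl//; last exact: L1_oo.
  rewrite -RintegralB//; [|exact: L1_oo|exact/L1_oo/L1Z].
  by apply: eq_Rintegral => x _; rewrite mulrBl.
apply: le_trans (le_normr_Rintegral _ _) _ => //; first exact/L1_oo/L1_bump.
have gi : mu.-integrable oo01 (EFin \o ((fun x => `|f x - f a|) \_ (ball a h))).
  rewrite -restrict_EFin; apply/integrable_restrict => //.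
  apply: integrableS (L1_oo (L1_norm fa1)) => //; exact: measurableI.
apply: (@le_trans _ _ (\int[mu]_(x in oo01) (C / h * ((fun x => `|f x - f a|) \_ (ball a h)) x))).
  apply: le_Rintegral => //.
  - exact/L1_oo/L1_norm/L1_bump.
  - apply: eq_integrable (integrableZl _ (C / h) gi) => //.
  move=> x _; rewrite patchE; case: ifPn => [_|].
    rewrite normrM [`|bump_h _ _|]ger0_norm ?bump_h_ge0// mulrC.
    rewrite ler_wpM2r// /bump_h mulrC ler_wpM2r// invr_ge0 ltW//.
  rewrite notin_setE /ball /= => /negP; rewrite -leNgt distrC => hx.
  by rewrite bump_h_out// mulr0 normr0 mulr0.
rewrite RintegralZl// -Rintegral_mkcondr setIidr//.
have -> : davg (f \_ `[0, 1]) a h =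
  ((2 * h)^-1 * \int[mu]_(x in ball a h) `|f x - f a|)%:E.
  rewrite /davg /iavg lebesgue_measure_ball ?ltW//.
  have -> : (\int[mu]_(y in ball a h) `|((center ((f \_ `[0, 1]) a) \o (f \_ `[0, 1])) y)%:E| =
     \int[mu]_(x in ball a h) (`|f x - f a|)%:E)%E.
    apply: eq_integral => x; rewrite inE => /bs/oo_sub_cc x01.
    by rewrite /= !patchE !ifT ?inE.
  rewrite EFinM -[X in (_ * X)%E](@fineK _ (\int[mu]_(x in ball a h) `|f x - f a|%:E)%E).
    by rewrite inver mulrn_eq0/= gt_eqF// mulr_natl.
  apply: integrable_fin_num => //.
  by apply: integrableS (L1_oo (L1_norm fa1)) => //.
rewrite /= mulrA; set I := Rintegral _ _ _.
rewrite [X in _ <= X](_ : _ = C / h * I)//.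
by field; rewrite gt_eqF.
Qed.

Lemma bump_cvg f a : L1 f -> 0 < a < 1 -> lebesgue_pt (f \_ `[0, 1]) a ->
  \int[mu]_(x in oo01) (f x * bump_h h (x - a)) @[h --> 0^'+] --> f a.
Proof.
move=> f1 /andP[a0 a1] /fine_cvgP[_ H]; have [C C0 HC] := bump_davg f1.
have HC0 : (fun h => C * fine (davg (f \_ `[0, 1]) a h)) @ 0^'+ --> 0.
  by rewrite -[X in _ --> X](mulr0 C); apply: cvgM => //; exact: cvg_cst.
apply/cvgrPdist_le => e e0; move/cvgrPdist_le : HC0 => /(_ e e0) HC0.
near=> h; rewrite distrC (le_trans (HC a h _ _ _))//.
- near: h; apply: nbhs_right_le; lra.
- have : h <= 1 - a by near: h; apply: nbhs_right_le; lra.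
  lra.
have : `|0 - C * fine (davg (f \_ `[0, 1]) a h)| <= e by near: h; exact: HC0.
by rewrite sub0r normrN; apply: le_trans; exact: ler_norm.
Unshelve. all: by end_near. Qed.

Lemma prim_near_cvg f a : L1 f -> 0 < a < 1 -> prim f y @[y --> a] --> prim f a.
Proof.
move=> f1 /andP[a0 a1].
have := prim_continuous f1; rewrite continuous_within_itvP ?ltr01// => -[H _ _].
by apply: H; rewrite in_itv/= a0.
Qed.

(** Away from ]a - h, a + h] the smooth step is the indicator of [a, 1], and the error in between is
    controlled by the primitive of |f|, which is continuous. Hence every interior [a] is allowed,
    Lebesgue point or not. *)
Lemma step_cvg f a : L1 f -> 0 < a < 1 ->
  \int[mu]_(x in oo01) (f x * step_h h (x - a)) @[h --> 0^'+] -->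
  prim f 1 - prim f a.
Proof.
move=> f1 a01; have /andP[a0 a1] := a01.
have n1 := L1_norm f1.
pose N := prim (fun x => `|f x|).
(* One copy of the integral of |f| over ]a - h, a + h] bounds the smoothed part ([e3]), the other
   the sharp cut at [a] ([e4]). *)
have key h : 0 < h -> h <= a -> a <= 1 - h ->
    `|\int[mu]_(x in oo01) (f x * step_h h (x - a)) - (prim f 1 - prim f a)| <=
    2 * (N (a + h) - N (a - h)).
  move=> h0 ha ah; have g1 := L1_step h a f1.
  have p1 : 0 <= a - h by lra. have p2 : a + h <= 1 by lra.
  have p3 : a - h <= a + h by lra. have p4 : a - h <= a by lra.
  have p5 : a <= a + h by lra. have p6 : 0 <= a + h by lra.
  have p7 : a - h <= 1 by lra. have a0' := ltW a0. have a1' := ltW a1.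
  rewrite Rintegral_oo01//; set g := fun x => _ in g1 *.
  have e1 : prim g 1 - prim g (a + h) = prim f 1 - prim f (a + h).
    apply: eq_prim => // t /andP[t1 _].
    by rewrite /g step_h1 ?mulr1// lerBrDl ltW.
  have e2 : prim g (a - h) - prim g 0 = prim (fun=> 0) (a - h) - prim (fun=> 0) 0.
    apply: eq_prim => //; first exact: L1_cst.
    by move=> t /andP[_ t2]; rewrite /g step_h0 ?mulr0//; lra.
  move: e2; rewrite !prim_cst// ?mul0r ?prim0 ?subr0// => e2.
  have e3 : `|prim g (a + h) - prim g (a - h)| <= N (a + h) - N (a - h).
    apply: le_trans (normr_prim g1 _ _ _) _ => //.
    apply: le_prim => //; first exact: L1_norm.
    move=> t _; have /andP[s0 s1] := step_h_itv h (t - a).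
    by rewrite /g normrM (ger0_norm s0) ler_piMr.
  have e4 : `|prim f (a + h) - prim f a| <= N (a + h) - N (a - h).
    apply: le_trans (normr_prim f1 _ _ _) _ => //.
    have : prim (fun=> 0) a - prim (fun=> 0) (a - h) <= N a - N (a - h).
      by apply: le_prim => //; exact: L1_cst.
    by rewrite !prim_cst ?mul0r// subrr subr_ge0 -/(N _) => H; exact: lerB.
  have -> : prim g 1 - (prim f 1 - prim f a) =
    (prim g (a + h) - prim g (a - h)) - (prim f (a + h) - prim f a).
    by rewrite e2 -[prim g 1](subrK (prim g (a + h))) e1; ring.
  by apply: le_trans (ler_normB _ _) _; rewrite mulr2n mulrDl mul1r lerD.
have Na : N x @[x --> a] --> N a by exact: prim_near_cvg.
have lim : (fun h => 2 * (N (a + h) - N (a - h))) @ 0^'+ --> 0.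
  have ap : (fun h : R => a + h) @ 0^'+ --> a.
    rewrite -[X in _ --> X]addr0; apply: cvgD; first exact: cvg_cst.
    exact/cvg_at_right_filter/cvg_id.
  have am : (fun h : R => a - h) @ 0^'+ --> a.
    rewrite -[X in _ --> X]subr0; apply: cvgB; first exact: cvg_cst.
    exact/cvg_at_right_filter/cvg_id.
  suff : (fun h => 2 * (N (a + h) - N (a - h))) @ 0^'+ --> 2 * (N a - N a).
    by rewrite subrr mulr0.
  apply: cvgM; first exact: cvg_cst.
  by apply: cvgB; [exact: cvg_comp ap Na|exact: cvg_comp am Na].
apply/cvgrPdist_le => e e0; move/cvgrPdist_le : lim => /(_ e e0) lim.
near=> h; rewrite distrC (le_trans (key h _ _ _))//.
- near: h; apply: nbhs_right_le; lra.
- have : h <= 1 - a by near: h; apply: nbhs_right_le; lra.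
  lra.
have : `|0 - 2 * (N (a + h) - N (a - h))| <= e by near: h; exact: lim.
by rewrite sub0r normrN; apply: le_trans; exact: ler_norm.
Unshelve. all: by end_near. Qed.

End Mollification.

(** * Test functions, in particular smoothed indicators of intervals *)

Section TestFunctions.
Context {R : realType}.
Notation mu := (@lebesgue_measure R).
Implicit Types (f g phi : R -> R) (x y a b h : R).

Lemma smooth_continuous phi : smooth_on setT phi -> continuous phi.
Proof.
move=> sp x; apply/differentiable_continuous/derivable1_diffP.
exact: (sp 0).
Qed.

Lemma smooth_derive1 phi : smooth_on setT phi -> smooth_on setT (derive1 phi).
Proof. by move=> sp n x _; have := sp n.+1 x I; rewrite derive1Sn. Qed.

Lemma smooth_is_derive phi x : smooth_on setT phi -> is_derive x 1 phi (derive1 phi x).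
Proof. by move=> sp; rewrite derive1E; apply: derivableP; exact: (sp 0). Qed.

Lemma smooth_scaled phi a h : smooth_on setT phi ->
  smooth_on setT (fun x => phi ((x - a) / h)).
Proof.
move=> sp; pose Fam (f : R -> R) := exists c n, f = fun x => c * derive1n n phi ((x - a) / h).
apply: (@derivative_family_smooth _ setT Fam openT); last first.
  by exists 1, 0%N; apply/funext => x; rewrite mul1r.
move=> _ [c [n ->]]; exists (fun x => c * h^-1 * derive1n n.+1 phi ((x - a) / h)).
  by exists (c * h^-1), n.+1.
move=> x _; have d : is_derive ((x - a) / h) 1 (derive1n n phi) (derive1n n.+1 phi ((x - a) / h)).
  by rewrite derive1nS derive1E; apply: derivableP; exact: sp.
apply: (is_derive_eq (is_derive_scal c (is_derive_scaled d))).
by rewrite mulrAC mulrA.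
Qed.

Lemma smooth_scaleB phi f (c : R) : smooth_on setT phi -> smooth_on setT f ->
  smooth_on setT (fun x => phi x - c * f x).
Proof.
move=> sp sf; pose Fam (g : R -> R) := exists n, g = fun x => derive1n n phi x - c * derive1n n f x.
apply: (@derivative_family_smooth _ setT Fam openT); last by exists 0%N.
move=> _ [n ->]; exists (fun x => derive1n n.+1 phi x - c * derive1n n.+1 f x).
  by exists n.+1.
move=> x _; have d g : smooth_on setT g -> is_derive x 1 (derive1n n g) (derive1n n.+1 g x).
  by move=> sg; rewrite derive1nS derive1E; apply: derivableP; exact: sg.
exact: (is_deriveB (d _ sp) (is_derive_scal c (d _ sf))).
Qed.

(** On the compact support x (1 - x) has a positive minimum, and on (0,1) this product is at most
    both x and 1 - x. *)
Lemma test_function_margin phi : test_function phi -> exists2 d : R, 0 < d &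
  forall x, phi x != 0 -> d <= x <= 1 - d.
Proof.
move=> [sp [cK KA]]; set K := closure _ in cK KA.
have sK x : phi x != 0 -> K x by move=> px; apply: subset_closure.
have [Ke|/set0P Kn] := eqVneq K set0.
  by exists 1 => // x /sK; rewrite Ke.
have cm : {within K, continuous (fun x : R => x * (1 - x))}.
  apply: continuous_subspaceT => x; apply: cvgM; first exact: cvg_id.
  by apply: cvgB; [exact: cvg_cst|exact: cvg_id].
have [c cKin Hc] := compact_EVT_min Kn cK cm.
have K01 x : K x -> 0 < x < 1 by move/KA; rewrite /oo01/= in_itv.
have /andP[c0 c1] := K01 _ (set_mem cKin).
exists (c * (1 - c)); first by rewrite mulr_gt0// subr_gt0.
move=> x /sK Kx; have := Hc x (mem_set Kx); have /andP[x0 x1] := K01 _ Kx.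
by move=> h; apply/andP; split; nra.
Qed.

Lemma test_function_support phi d : 0 < d -> smooth_on setT phi ->
  (forall x, phi x != 0 -> d <= x <= 1 - d) -> test_function phi.
Proof.
move=> d0 sp H; split => //=; set K := closure _.
have Ks : K `<=` `[d, 1 - d].
  rewrite /K; have cI : closed `[d, 1 - d]%classic by exact: interval_closed.
  rewrite ((closure_id _).1 cI).
  by apply: closureS => x /= /H; rewrite in_itv.
split; last first.
  by move=> x /Ks; rewrite /oo01/= !in_itv/= => /andP[? ?]; apply/andP; split; lra.
apply: subclosed_compact Ks; first exact: closed_closure.
exact: segment_compact.
Qed.

(** A smoothed indicator of [a, b], whose derivative is a mollifier at [a] minus one at [b]: tested
    against a weak derivative it gives the fundamental theorem in the limit. *)
Lemma test_step h a b : 0 < h -> h < a -> a <= b -> b < 1 - h ->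
  test_function (fun x => step_h h (x - a) - step_h h (x - b)).
Proof.
move=> h0 ha ab bh; apply: (@test_function_support _ (Num.min (a - h) (1 - h - b))).
- by rewrite lt_min; apply/andP; split; lra.
- have := @smooth_scaleB _ _ 1 (@smooth_scaled _ a h (@smooth_step_smooth R))
     (@smooth_scaled _ b h (@smooth_step_smooth R)).
  by under eq_fun do rewrite mul1r.
move=> x; apply: contraR; rewrite negb_and -!ltNge => /orP[].
  rewrite lt_min => /andP[? ?].
  by rewrite !step_h0 ?subrr//; lra.
rewrite ltrBlDr -ltrBlDl lt_min => /andP[? ?].
by rewrite !step_h1 ?subrr//; lra.
Qed.

Lemma step_bump_out h a b d x : 0 < h -> h < a - d -> h < 1 - d - b -> a <= b ->
  ~~ (d <= x <= 1 - d) ->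
  step_h h (x - a) - step_h h (x - b) = 0 /\ bump_h h (x - a) - bump_h h (x - b) = 0.
Proof.
move=> h0 hd hd' ab; rewrite negb_and -!ltNge => /orP[xd|xd].
  have [xa xb] : x - a <= - h /\ x - b <= - h by lra.
  have [xa' xb'] : h <= `|x - a| /\ h <= `|x - b|.
    by rewrite ![`|_|]ler0_norm; lra.
  by rewrite !step_h0 ?bump_h_out ?subrr.
have [xa xb] : h <= x - a /\ h <= x - b by lra.
have [xa' xb'] : h <= `|x - a| /\ h <= `|x - b|.
  by rewrite ![`|_|]ger0_norm; lra.
by rewrite !step_h1 ?bump_h_out ?subrr.
Qed.

Lemma derive1_step h a b x : derive1 (fun x => step_h h (x - a) - step_h h (x - b)) x =
  bump_h h (x - a) - bump_h h (x - b).
Proof.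
apply: is_derive_derive1; exact: (is_deriveB (is_derive_step_h h a x) (is_derive_step_h h b x)).
Qed.

End TestFunctions.

(** * Weak derivatives: fundamental theorem and uniqueness *)

Section WeakDerivatives.
Context {R : realType}.
Notation mu := (@lebesgue_measure R).
Implicit Types (f g phi p v w : R -> R) (x y a b h d : R).

Lemma within_cc_oo f x : {within `[0, 1], continuous f} -> 0 < x < 1 ->
  {for x, continuous f}.
Proof.
by move=> cf x01; move: cf; rewrite continuous_within_itvP ?ltr01// => -[H _ _]; apply: H; rewrite in_itv.
Qed.

Lemma L1_locally f : L1 f -> locally_integrable oo01 f.
Proof.
by move=> /L1_oo f1; apply: open_integrable_locally => //; exact: interval_open.
Qed.

(** A weak derivative is only locally integrable on (0,1); cutting it off to [d, 1 - d] makes the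
    results on [L1] available. *)
Lemma locally_L1 f d : locally_integrable oo01 f -> 0 < d ->
  L1 (f \_ `[d, 1 - d]).
Proof.
move=> [mf _ H] d0; pose K : set R := `[d, 1 - d]%classic.
have Ks : K `<=` oo01.
  by move=> x; rewrite /K/oo01/= !in_itv/= => /andP[? ?]; apply/andP; split; lra.
have mK : measurable K by exact: measurable_itv.
have iK : mu.-integrable K (EFin \o f).
  apply/integrableP; split; last by apply: H => //; exact: segment_compact.
  by apply/measurable_EFinP; apply: measurable_funS mf => //; exact: measurable_oo01.
rewrite /L1 -restrict_EFin; apply/integrable_restrict => //.
by rewrite setIidr//; exact: subset_trans Ks (@oo_sub_cc R).
Qed.

Let restr_lebesgue_pt f d a : locally_integrable oo01 f -> 0 < d -> d < a -> a < 1 - d ->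
  {for a, continuous f} -> lebesgue_pt ((f \_ `[d, 1 - d]) \_ `[0, 1]) a.
Proof.
move=> lf d0 da ad cf.
have Uo : open_nbhs a `]d, 1 - d[%classic.
  by split; [exact: interval_open|rewrite /= in_itv/= da].
have E x : `]d, 1 - d[%classic x -> f x = ((f \_ `[d, 1 - d]) \_ `[0, 1]) x.
  rewrite /= in_itv/= => /andP[? ?]; rewrite !patchE !ifT// inE/= in_itv/=; apply/andP; split; lra.
apply: (@continuous_lebesgue_pt _ _ _ `]d, 1 - d[%classic) => //.
- apply: (@eq_measurable_fun _ _ _ _ _ f) => [x /set_mem/E//|].
  case: lf => mf _ _; apply: measurable_funS mf => //; first exact: measurable_oo01.
  by move=> x; rewrite /oo01/= !in_itv/= => /andP[? ?]; apply/andP; split; lra.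
- rewrite /prop_for /continuous_at -E; last exact: Uo.2.
  apply: cvg_trans cf; apply: near_eq_cvg.
  by apply: filterS (open_nbhs_nbhs Uo) => x /E.
Qed.

(** Test with the smoothed indicator of [a, b]: the side of [f] tends to f(a) - f(b) by continuity
    at these two points, the side of [g] to minus its integral over ]a, b]. *)
Lemma weak_derivative_FTC f g a b : is_weak_derivative f g ->
  0 < a -> a < b -> b < 1 -> {for a, continuous f} -> {for b, continuous f} ->
  f b - f a = \int[mu]_(t in `]a, b]) g t.
Proof.
move=> [lf lg H] a0 ab b1 cfa cfb.
have [d d0 [da db]] : exists2 d : R, 0 < d & d < a /\ b < 1 - d.
  exists (Num.min a (1 - b) / 2); first by rewrite divr_gt0// lt_min; apply/andP; split; lra.
  have [ha hb] : Num.min a (1 - b) <= a /\ Num.min a (1 - b) <= 1 - b by rewrite !ge_min !lexx orbT.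
  by split; lra.
pose f' := f \_ `[d, 1 - d]; pose g' := g \_ `[d, 1 - d].
have f1 : L1 f' by exact: locally_L1.
have g1 : L1 g' by exact: locally_L1.
have inE' x : d <= x <= 1 - d -> f' x = f x /\ g' x = g x.
  by move=> xd; rewrite /f' /g' !patchE !ifT// inE/= in_itv.
have a01 : 0 < a < 1 by rewrite a0/=; lra.
have b01 : 0 < b < 1 by rewrite b1 andbT; lra.
have L : (fun h => \int[mu]_(x in oo01) (f' x * bump_h h (x - a)) -
    \int[mu]_(x in oo01) (f' x * bump_h h (x - b))) @ 0^'+ --> f' a - f' b.
  by apply: cvgB; apply: bump_cvg => //; apply: restr_lebesgue_pt => //; lra.
have RR : (fun h => \int[mu]_(x in oo01) (g' x * step_h h (x - b)) -
    \int[mu]_(x in oo01) (g' x * step_h h (x - a))) @ 0^'+ -->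
    (prim g' 1 - prim g' b) - (prim g' 1 - prim g' a).
  by apply: cvgB; exact: step_cvg.
have E : \forall h \near 0^'+, \int[mu]_(x in oo01) (f' x * bump_h h (x - a)) -
    \int[mu]_(x in oo01) (f' x * bump_h h (x - b)) =
    \int[mu]_(x in oo01) (g' x * step_h h (x - b)) -
    \int[mu]_(x in oo01) (g' x * step_h h (x - a)).
  near=> h.
  have h0 : 0 < h by near: h; exact: nbhs_right_gt.
  have hd : h < a - d by near: h; apply: nbhs_right_lt; lra.
  have hd' : h < 1 - d - b by near: h; apply: nbhs_right_lt; lra.
  have ha : h < a by apply: lt_trans hd _; rewrite ltrBlDr ltrDl.
  have hb : b < 1 - h by rewrite ltrBrDl -ltrBrDr (lt_trans hd')// ltrD2r ltrBlDr ltrDl.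
  have t := @test_step R h a b h0 ha (ltW ab) hb.
  rewrite -!RintegralB//; try exact: measurable_oo01; try exact/L1_oo/L1_bump; try exact/L1_oo/L1_step.
  have := H _ t; set phi := fun x => _ in t *.
  (* Inside [d, 1 - d] the cut-off functions are the original ones; outside, the test function and
     its derivative vanish. Neither integral sees the cut-off. *)
  have supp x : ~~ (d <= x <= 1 - d) -> phi x = 0 /\ derive1 phi x = 0.
    by move=> xd; rewrite /phi derive1_step; apply: step_bump_out xd => //; exact: ltW.
  rewrite (@eq_Rintegral _ _ _ mu oo01
    (fun x => f' x * bump_h h (x - a) - f' x * bump_h h (x - b))); last first.
    move=> x _; rewrite -mulrBr -derive1_step -/phi.
    case: (boolP (d <= x <= 1 - d)) => [/inE'[-> _]//|/supp[_ ->]].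
    by rewrite !mulr0.
  rewrite (@eq_Rintegral _ _ _ mu oo01 (fun x => g' x * phi x) (fun x => g x * phi x)); last first.
    move=> x _; case: (boolP (d <= x <= 1 - d)) => [/inE'[_ ->]//|/supp[-> _]].
    by rewrite !mulr0.
  move=> ->; rewrite -[LHS]mulN1r -RintegralZl; last 2 first.
  - exact: measurable_oo01.
  - apply: L1_oo; apply: L1M_continuous => //; apply: continuous_subspaceT => x.
    exact: (cvgB (@step_h_continuous R h a x) (@step_h_continuous R h b x)).
  by apply: eq_Rintegral => x _; rewrite /phi; ring.
have EL : (fun h => \int[mu]_(x in oo01) (g' x * step_h h (x - b)) -
    \int[mu]_(x in oo01) (g' x * step_h h (x - a))) @ 0^'+ --> f' a - f' b.
  exact: cvg_trans (near_eq_cvg E) L.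
have U := cvg_unique (@Rhausdorff R) EL RR.
have ad : d <= a <= 1 - d by rewrite (ltW da)/= ltW// (lt_trans ab).
have bd : d <= b <= 1 - d by rewrite (ltW db) andbT ltW// (lt_trans da).
have [fa _] := inE' a ad; have [fb _] := inE' b bd.
have a0' := ltW a0; have b1' := ltW b1; have ab' := ltW ab.
have -> : \int[mu]_(t in `]a, b]) g t = \int[mu]_(t in `]a, b]) g' t.
  apply: eq_Rintegral => t; rewrite inE/= in_itv/= => /andP[ta tb].
  have td : d <= t <= 1 - d.
    by rewrite (le_trans tb (ltW db)) andbT (le_trans (ltW da) (ltW ta)).
  by have [_ ->] := inE' t td.
by rewrite -prim_diff// -fa -fb; apply: oppr_inj; rewrite !opprB (U _); ring.
Unshelve. all: by end_near. Qed.

(** The primitives differ by a constant, and almost everywhere they have derivatives [g1] and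
    [g2]. *)
Lemma locally_integrable_ae_eq g1 g2 :
  locally_integrable oo01 g1 -> locally_integrable oo01 g2 ->
  (forall a b, 0 < a -> a < b -> b < 1 ->
    \int[mu]_(t in `]a, b]) g1 t = \int[mu]_(t in `]a, b]) g2 t) ->
  {ae mu, forall x, oo01 x -> g1 x = g2 x}.
Proof.
move=> l1 l2 H.
(* Countably many intervals ]1/(n+1), 1 - 1/(n+1)[ exhaust (0,1), and on each of them the cut-offs
   are integrable. *)
suff K (n : nat) : {ae mu, forall x, n.+1%:R^-1 < x < 1 - n.+1%:R^-1 -> g1 x = g2 x}.
  apply: ae_imply (ae_foralln K) => x Hx; rewrite /oo01/= in_itv/= => /andP[x0 x1].
  have m0 : 0 < Num.min x (1 - x) by rewrite lt_min x0 subr_gt0.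
  have [n /=] := near_infty_natSinv_lt (PosNum m0); move=> _ /(_ n (leqnn n)) /=.
  by rewrite lt_min => /andP[n1 n2]; apply: (Hx n); rewrite n1/= ltrBrDr -ltrBrDl.
set d := n.+1%:R^-1; have d0 : 0 < d by rewrite invr_gt0.
have L (g : R -> R) : locally_integrable oo01 g -> L1 (g \_ `[d, 1 - d]).
  by move=> lg; exact: locally_L1.
have D (g : R -> R) (lg : locally_integrable oo01 g) := is_derive_prim_ae (L g lg).
apply: ae_imply (ae_and (D _ l1) (D _ l2)) => x [h1 h2] /andP[dx xd].
have x01 : 0 < x < 1 by apply/andP; split; lra.
have restrE (g : R -> R) y : d <= y <= 1 - d -> (g \_ `[d, 1 - d]) y = g y.
  by move=> yd; rewrite patchE ifT// inE/= in_itv.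
have xd' : d <= x <= 1 - d by rewrite !ltW.
move: (h1 x01) (h2 x01); rewrite !restrE// => {}h1 {}h2.
set P1 := prim _ in h1; set P2 := prim _ in h2.
have e y : d < y < 1 - d -> P1 y - P1 d = P2 y - P2 d.
  move=> /andP[dy yd].
  have y1 : y <= 1 by rewrite (le_trans (ltW yd))// gerBl ltW.
  rewrite /P1 /P2 !prim_diff//; try exact: L; try exact: ltW.
  have rE (g : R -> R) : \int[mu]_(t in `]d, y]) (g \_ `[d, 1 - d]) t = \int[mu]_(t in `]d, y]) g t.
    apply: eq_Rintegral => t; rewrite inE/= in_itv/= => /andP[t1 t2].
    by rewrite restrE// (ltW t1) (le_trans t2 (ltW yd)).
  by rewrite !rE (H d y)//; lra.
have h3 : is_derive x 1 (fun y => P2 y + (P1 d - P2 d)) (g1 x).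
  apply: (@near_is_derive _ P1 _ _ _ `]d, 1 - d[%classic).
  - exact: interval_open.
  - by rewrite /= in_itv/= dx.
  - by move=> y; rewrite /= in_itv/= => /e; lra.
have h4 := is_derive_sum2 h2 (is_derive_cst (P1 d - P2 d) x 1).
rewrite addr0 in h4.
by rewrite -(is_derive_derive1 h3) (is_derive_derive1 h4).
Qed.

Lemma weak_derivative_unique f g1 g2 : (forall x, oo01 x -> {for x, continuous f}) ->
  is_weak_derivative f g1 -> is_weak_derivative f g2 ->
  {ae mu, forall x, oo01 x -> g1 x = g2 x}.
Proof.
move=> cf w1 w2; apply: locally_integrable_ae_eq; [by case: w1|by case: w2|].
move=> a b a0 ab b1.
have [ca cb] : {for a, continuous f} /\ {for b, continuous f}.
  split; apply: cf; rewrite /oo01/= in_itv/=; apply/andP; split; lra.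
by rewrite -(weak_derivative_FTC w1)// -(weak_derivative_FTC w2).
Qed.

Lemma locally_integrable_ae f g : measurable_fun (oo01 : set R) g ->
  {ae mu, forall x, oo01 x -> f x = g x} ->
  locally_integrable oo01 f -> locally_integrable oo01 g.
Proof.
move=> mg fg [mf oo H]; split => // K KA cK; apply: le_lt_trans (H K KA cK).
rewrite le_eqVlt; apply/orP; left; apply/eqP/ae_eq_integral.
- exact: compact_measurable.
- apply/measurable_EFinP/measurableT_comp => //.
  by apply: measurable_funS mg => //; exact: measurable_oo01.
- apply/measurable_EFinP/measurableT_comp => //.
  by apply: measurable_funS mf => //; exact: measurable_oo01.
- by apply: ae_imply fg => x fg Kx; rewrite fg//; exact: KA.
Qed.

Lemma Rintegral_ae f g : measurable_fun (oo01 : set R) f ->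
  measurable_fun (oo01 : set R) g ->
  {ae mu, forall x, oo01 x -> f x = g x} ->
  \int[mu]_(x in oo01) f x = \int[mu]_(x in oo01) g x.
Proof.
move=> mf mg fg; rewrite /Rintegral; congr fine; apply: ae_eq_integral.
- exact: measurable_oo01.
- exact/measurable_EFinP.
- exact/measurable_EFinP.
- by apply: ae_imply fg => x fg xA; rewrite fg.
Qed.

Lemma test_function_measurable phi : test_function phi ->
  measurable_fun (oo01 : set R) phi /\ measurable_fun (oo01 : set R) (derive1 phi).
Proof.
move=> [sp _]; split; apply: measurable_funTS; apply: continuous_measurable_fun.
  exact: smooth_continuous.
exact/smooth_continuous/smooth_derive1.
Qed.

(** This passes between the arbitrarily chosen [weak_derivative] and concrete representatives;
    measurability of the new pair is asked for as a part of local integrability. *)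
Lemma is_weak_derivative_ae f f' g g' :
  measurable_fun (oo01 : set R) f' -> measurable_fun (oo01 : set R) g' ->
  {ae mu, forall x, oo01 x -> f x = f' x} -> {ae mu, forall x, oo01 x -> g x = g' x} ->
  is_weak_derivative f g -> is_weak_derivative f' g'.
Proof.
move=> mf' mg' ff' gg' [lf lg H]; split.
- exact: locally_integrable_ae ff' lf.
- exact: locally_integrable_ae gg' lg.
move=> phi t; have [mp mdp] := test_function_measurable t.
have [mf mg] : measurable_fun (oo01 : set R) f /\ measurable_fun (oo01 : set R) g.
  by split; [case: lf|case: lg].
rewrite -(@Rintegral_ae (fun x => f x * derive1 phi x)); last 3 first.
- exact: measurable_funM.
- exact: measurable_funM.
- by apply: ae_imply ff' => x h /h ->.
rewrite H// (@Rintegral_ae _ (fun x => g' x * phi x))//.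
- exact: measurable_funM.
- exact: measurable_funM.
- by apply: ae_imply gg' => x h /h ->.
Qed.

Lemma weak_derivativeP f g : is_weak_derivative f g ->
  is_weak_derivative f (weak_derivative f).
Proof. by move=> fg; apply: (@xgetPex _ (fun=> 0) [set g | is_weak_derivative f g]); exists g. Qed.

End WeakDerivatives.

(** * The arc length element and its reciprocal *)

Section EnergyDensity.
Context {R : realType}.
Implicit Types (q s : R).

(** The arc length element of a graph of slope q. Writing (1 + q^2)^(-5/2) as [iarcl q ^+ 5] removes
    real powers, and the derivatives of [arcl] and [iarcl] are polynomials in q and [iarcl]. *)
Definition arcl q : R := Num.sqrt (1 + q ^+ 2).
Definition iarcl q : R := (arcl q)^-1.

Lemma arcl_sqr q : arcl q ^+ 2 = 1 + q ^+ 2.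
Proof. by rewrite sqr_sqrtr// addr_ge0// sqr_ge0. Qed.

Lemma arcl_gt0 q : 0 < arcl q.
Proof. by rewrite sqrtr_gt0 ltr_wpDr// sqr_ge0. Qed.

Lemma arcl_neq0 q : arcl q != 0. Proof. by rewrite gt_eqF// arcl_gt0. Qed.

Lemma arcl_ge1 q : 1 <= arcl q.
Proof. by have := arcl_sqr q; have := arcl_gt0 q; have := sqr_ge0 q; nra. Qed.

Lemma arcl_ge q : `|q| <= arcl q.
Proof.
have := arcl_sqr q; have := arcl_gt0 q; rewrite ler_norml => s0 s2.
by apply/andP; split; nra.
Qed.

Lemma iarcl_gt0 q : 0 < iarcl q. Proof. by rewrite invr_gt0 arcl_gt0. Qed.

Lemma iarcl_le1 q : iarcl q <= 1.
Proof. by rewrite invf_le1 ?arcl_gt0// arcl_ge1. Qed.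

Lemma mul_iarcl q : `|q * iarcl q| <= 1.
Proof.
rewrite normrM (gtr0_norm (iarcl_gt0 q)) ler_pdivrMr ?arcl_gt0// mul1r.
exact: arcl_ge.
Qed.

Lemma is_derive_arcl q : is_derive q 1 arcl (q * iarcl q).
Proof.
have d : is_derive q 1 (fun y : R => 1 + y ^+ 2) (2 * q).
  apply: (is_derive_eq (is_derive_sum2 (is_derive_cst (1 : R) q (1 : R))
    (is_derive_pow 2 (is_derive_id q 1)))).
  by rewrite add0r mulr1.
have p : 0 < 1 + q ^+ 2 by rewrite ltr_wpDr// sqr_ge0.
apply: (is_derive_eq (@is_derive_chain _ Num.sqrt (fun y => 1 + y ^+ 2) _ _ _ (is_derive1_sqrt p) d)).
by rewrite /iarcl -/(arcl q); field; exact: arcl_neq0.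
Qed.

Lemma is_derive_iarcl q : is_derive q 1 iarcl (- (q * iarcl q ^+ 3)).
Proof.
apply: (is_derive_eq (is_derive_inv (arcl_neq0 q) (is_derive_arcl q))).
by rewrite /iarcl; field; exact: arcl_neq0.
Qed.

Lemma iarcl_continuous : continuous iarcl.
Proof. by move=> q; exact: is_derive_cont (is_derive_iarcl q). Qed.

Lemma arcl_continuous : continuous arcl.
Proof. by move=> q; exact: is_derive_cont (is_derive_arcl q). Qed.

Lemma powR52 q : ((1 + q ^+ 2) `^ (5%:R / 2%:R))^-1 = iarcl q ^+ 5.
Proof.
have p : 0 <= 1 + q ^+ 2 by rewrite addr_ge0// sqr_ge0.
rewrite /iarcl exprVn; congr (_^-1).
by rewrite mulrC powRrM powR12_sqrt// powR_mulrn// sqrtr_ge0.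
Qed.

End EnergyDensity.

(** * The space [H20] through representatives, and the energy in terms of them *)

Section SobolevH20.
Context {R : realType}.
Notation mu := (@lebesgue_measure R).
Implicit Types (f g phi p v w : R -> R) (x y a b h d : R).

Lemma test_function_ends phi : test_function phi -> phi 0 = 0 /\ phi 1 = 0.
Proof.
move=> /test_function_margin[d d0 H].
split; apply/eqP; apply: contraT => /H /andP[? ?]; lra.
Qed.

Lemma test_function_L1M f phi : L1 f -> test_function phi ->
  L1 (fun x => f x * phi x) /\ L1 (fun x => f x * derive1 phi x).
Proof.
move=> f1 [sp _]; split; apply: L1M_continuous => //; apply: continuous_subspaceT.
  exact: smooth_continuous.
exact/smooth_continuous/smooth_derive1.
Qed.

(** The integral of (f phi)' over [0,1] is 0, because phi vanishes at the ends. *)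
Lemma C1_weak_derivative f g : (forall x : R, is_derive x 1 f (g x)) -> continuous g ->
  is_weak_derivative f g.
Proof.
move=> df cg.
have cf : continuous f by move=> x; exact: is_derive_cont (df x).
have f1 : L1 f by apply/L1_continuous/continuous_subspaceT.
have g1 : L1 g by apply/L1_continuous/continuous_subspaceT.
split; [exact: L1_locally|exact: L1_locally|].
move=> phi t; have [t0 t1] := test_function_ends t.
have [fp fdp] := test_function_L1M f1 t; have [gp _] := test_function_L1M g1 t.
apply/eqP; rewrite -subr_eq0 opprK -RintegralD; last 3 first.
- exact: measurable_oo01.
- exact: L1_oo.
- exact: L1_oo.
rewrite Rintegral_oo01; last exact: L1D.
have [sp _] := t.
have dp x : is_derive x 1 (fun y => f y * phi y) (f x * derive1 phi x + g x * phi x).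
  apply: (is_derive_eq (is_derive_prod2 (df x) (smooth_is_derive x sp))).
  by rewrite addrC.
have cd : continuous (fun x => f x * derive1 phi x + g x * phi x).
  move=> x; apply: cvgD; apply: cvgM; [exact: cf| |exact: cg|].
    exact: (smooth_continuous (smooth_derive1 sp)).
  exact: (smooth_continuous sp).
have := @prim_FTC2 R _ _ 0 1 dp cd (lexx _) ler01 (lexx _).
by rewrite prim0 subr0 t0 t1 !mulr0 subrr => ->.
Qed.

Lemma weak_derivativeD f g f' g' : L1 f -> L1 g -> L1 f' -> L1 g' ->
  is_weak_derivative f g -> is_weak_derivative f' g' ->
  is_weak_derivative (fun x => f x + f' x) (fun x => g x + g' x).
Proof.
move=> f1 g1 f1' g1' [_ _ H] [_ _ H'].
split; [by apply: L1_locally; exact: L1D..|].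
move=> phi t; have [_ a] := test_function_L1M f1 t; have [b _] := test_function_L1M g1 t.
have [_ a'] := test_function_L1M f1' t; have [b' _] := test_function_L1M g1' t.
have moo := @measurable_oo01 R.
transitivity (\int[mu]_(x in oo01) (f x * derive1 phi x + f' x * derive1 phi x)).
  by apply: eq_Rintegral => x _; ring.
rewrite RintegralD//; [|exact: L1_oo..].
rewrite H// H'// -opprD; congr (- _).
transitivity (\int[mu]_(x in oo01) (g x * phi x + g' x * phi x)); last first.
  by apply: eq_Rintegral => x _; ring.
by rewrite RintegralD//; exact: L1_oo.
Qed.

Lemma within_cc_measurable f : {within `[0, 1], continuous f} ->
  measurable_fun (oo01 : set R) f.
Proof.
move=> cf; have mc : measurable_fun (cc01 : set R) f.
  by apply: subspace_continuous_measurable_fun => //; exact: measurable_itv.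
by apply: measurable_funS mc; [exact: measurable_itv|exact: oo_sub_cc].
Qed.

(** The energy is defined through chosen weak derivatives, known only up to null sets; uniqueness
    replaces them by any continuous slope [p] and any weak derivative [w] of it. *)
Lemma elastica_rep v p w :
  {within `[0, 1], continuous v} -> {within `[0, 1], continuous p} ->
  is_weak_derivative v p -> is_weak_derivative p w ->
  let dv := weak_derivative v in
  [/\ is_weak_derivative v dv, is_weak_derivative dv (weak_derivative dv),
   {ae mu, forall x, oo01 x -> dv x = p x},
   {ae mu, forall x, oo01 x -> weak_derivative dv x = w x} &
   elastica v = (\int[mu]_(x in oo01) (w x ^+ 2 * iarcl (p x) ^+ 5)%:E)%E].
Proof.
move=> cv cp vp pw dv.
have oc f : {within `[0, 1], continuous f} -> forall x, oo01 x -> {for x, continuous f}.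
  by move=> cf x; rewrite /oo01/= in_itv/= => x01; exact: within_cc_oo.
have vdv : is_weak_derivative v dv := weak_derivativeP vp.
have dvp := weak_derivative_unique (oc _ cv) vdv vp.
have pdv : {ae mu, forall x, oo01 x -> p x = dv x}.
  by apply: ae_imply dvp => x h /h ->.
have mp := within_cc_measurable cp.
have mdv : measurable_fun (oo01 : set R) dv by case: vdv => _ [].
have mw : measurable_fun (oo01 : set R) w by case: pw => _ [].
have ww : {ae mu, forall x, oo01 x -> w x = w x} by exact: aeW.
have dvw : is_weak_derivative dv w by exact: is_weak_derivative_ae pw.
have dvd := weak_derivativeP dvw.
have md : measurable_fun (oo01 : set R) (weak_derivative dv) by case: dvd => _ [].
have pd : is_weak_derivative p (weak_derivative dv).
  by apply: is_weak_derivative_ae dvd => //; exact: aeW.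
have dw := weak_derivative_unique (oc _ cp) pd pw.
have miarcl f : measurable_fun (oo01 : set R) f ->
    measurable_fun (oo01 : set R) (fun x => iarcl (f x) ^+ 5).
  move=> mf; apply: measurable_funX.
  by apply: measurableT_comp mf; apply: continuous_measurable_fun; exact: iarcl_continuous.
split => //; rewrite /elastica.
under eq_integral do rewrite powR52.
apply: ae_eq_integral.
- exact: measurable_oo01.
- apply/measurable_EFinP/measurable_funM; [exact: measurable_funX|exact: miarcl].
- apply/measurable_EFinP/measurable_funM; [exact: measurable_funX|exact: miarcl].
- by apply: ae_imply (ae_and dvp dw) => x [h1 h2] x01; rewrite -/dv (h1 x01) (h2 x01).
Qed.

(** The bound |w| <= 1 + w^2 suffices on an interval of finite measure. *)
Lemma L2_L1 w : L2 w -> L1 w /\ L1 (fun x => w x ^+ 2).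
Proof.
move=> [mw w2].
have w21 : L1 (fun x => w x ^+ 2).
  apply: oo_L1; apply/integrableP; split.
    exact/measurable_EFinP/measurable_funX.
  by under eq_integral do rewrite gee0_abs ?lee_fin ?sqr_ge0//.
split => //; apply: oo_L1.
have h1 : mu.-integrable oo01 (EFin \o (fun x => 1 + w x ^+ 2)).
  by apply: L1_oo; apply: L1D => //; exact: L1_cst.
apply: le_integrable h1 => //; first exact: measurable_oo01.
  exact/measurable_EFinP.
move=> x _; rewrite lee_fin [`|1 + _|]ger0_norm ?addr_ge0 ?sqr_ge0//.
by rewrite ler_norml; apply/andP; split; nra.
Qed.

Lemma L1_L2 w : L1 w -> L1 (fun x => w x ^+ 2) -> L2 w.
Proof.
move=> w1 w2; have /integrableP[/measurable_EFinP mw _] := L1_oo w1; split => //.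
have /integrableP[_] := L1_oo w2.
by under eq_integral do rewrite /= ger0_norm ?sqr_ge0//.
Qed.

Lemma L2_ae f g : measurable_fun (oo01 : set R) g ->
  {ae mu, forall x, oo01 x -> f x = g x} -> L2 f -> L2 g.
Proof.
move=> mg fg [mf f2]; split => //; apply: le_lt_trans f2.
rewrite le_eqVlt; apply/orP; left; apply/eqP/ae_eq_integral.
- exact: measurable_oo01.
- exact/measurable_EFinP/measurable_funX.
- exact/measurable_EFinP/measurable_funX.
- by apply: ae_imply fg => x fg x01; rewrite fg.
Qed.

(** The difference f - prim g is constant on (0,1) by [weak_derivative_FTC], and continuity carries
    the constant to both end points. *)
Lemma weak_derivative_prim f g : {within `[0, 1], continuous f} -> L1 g ->
  is_weak_derivative f g -> forall x, 0 <= x <= 1 -> f x = f 0 + prim g x.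
Proof.
move=> cf g1 fg.
pose D x := f x - prim g x.
have cD : {within `[0, 1], continuous D}.
  by move=> x; apply: cvgB; [exact: cf|exact: prim_continuous].
have cst x y : 0 < x -> x < y -> y < 1 -> D y = D x.
  move=> x0 xy y1; apply/eqP; rewrite -subr_eq0; apply/eqP.
  have := weak_derivative_FTC fg x0 xy y1 _ _.
  rewrite -prim_diff//; [|exact: ltW..] => H.
  have : f y - f x = prim g y - prim g x.
    by apply: H; apply: within_cc_oo => //; apply/andP; split; lra.
  by rewrite /D; lra.
have cst2 x y : 0 < x < 1 -> 0 < y < 1 -> D y = D x.
  move=> /andP[x0 x1] /andP[y0 y1]; have [xy|yx|->//] := ltgtP x y.
    exact: cst.
  by symmetry; exact: cst.
have h01 : 0 < (2^-1 : R) < 1 by apply/andP; split; lra.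
have E x : 0 < x < 1 -> D x = D 2^-1 by move=> x01; exact: cst2.
move: cD; rewrite continuous_within_itvP ?ltr01// => -[_ D0 D1].
have lim0 : D @ 0^'+ --> D 2^-1.
  apply: cvg_near_cst; near=> x; apply: E; apply/andP; split.
    by near: x; exact: nbhs_right_gt.
  by near: x; exact: nbhs_right_lt.
have lim1 : D @ 1^'- --> D 2^-1.
  apply: cvg_near_cst; near=> x; apply: E; apply/andP; split.
    by near: x; exact: nbhs_left_gt.
  by near: x; exact: nbhs_left_lt.
have e0 := cvg_unique (@Rhausdorff R) D0 lim0.
have e1 := cvg_unique (@Rhausdorff R) D1 lim1.
have DE x : 0 <= x <= 1 -> D x = D 0.
  move=> /andP[x0 x1]; rewrite (e0 _).
  have [->|xn0] := eqVneq x 0; first exact: e0.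
  have [->|xn1] := eqVneq x 1; first exact: e1.
  by apply: E; rewrite !lt_neqAle x0 x1 xn1 eq_sym xn0.
move=> x x01; have := DE x x01; rewrite /D prim0 subr0 => /eqP.
by rewrite subr_eq => /eqP.
Unshelve. all: by end_near. Qed.

(** The definition provides a chosen weak derivative that has a weak derivative in L2, and
    separately a continuous one; the two agree a.e., so the continuous slope inherits the second
    derivative. *)
Lemma H20_data v : H20 v -> exists p w : R -> R,
  [/\ {within `[0, 1], continuous p}, p 0 = 0 /\ p 1 = 0,
      L1 w /\ L1 (fun x => w x ^+ 2) &
      is_weak_derivative v p /\ is_weak_derivative p w].
Proof.
move=> [[_ [[g wg] [_ [[g' wg'] [L2w _]]]]] cv [v0 v1] [p [wp cp p0 p1]]].
exists p, (weak_derivative (weak_derivative v)).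
have oc x : oo01 x -> {for x, continuous v}.
  by rewrite /oo01/= in_itv/= => x01; exact: within_cc_oo.
have vdv := weak_derivativeP wg; have wdd := weak_derivativeP wg'.
have := weak_derivative_unique oc vdv wp => dvp.
have mw : measurable_fun (oo01 : set R) (weak_derivative (weak_derivative v)).
  by case: L2w.
have pw : is_weak_derivative p (weak_derivative (weak_derivative v)).
  apply: (is_weak_derivative_ae (within_cc_measurable cp) mw dvp _ wdd).
  by apply: aeW => x _.
split; [exact: cp|by split|exact: L2_L1|by split; [exact: wp|exact: pw]].
Qed.

(** Perturbed functions enter the admissible set through this converse of [H20_data]. *)
Lemma H20_intro v p w : {within `[0, 1], continuous v} -> v 0 = 0 -> v 1 = 0 ->
  {within `[0, 1], continuous p} -> p 0 = 0 -> p 1 = 0 ->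
  L1 w -> L1 (fun x => w x ^+ 2) ->
  is_weak_derivative v p -> is_weak_derivative p w -> H20 v.
Proof.
move=> cv v0 v1 cp p0 p1 w1 w2 vp pw.
have [vdv dvd dvp dw _] := elastica_rep cv cp vp pw.
have L2c f : {within `[0, 1], continuous f} -> L2 f.
  move=> cf; apply: L1_L2; first exact: L1_continuous.
  apply: L1_continuous => x; apply: (@cvg_comp _ _ _ f (fun y : R => y ^+ 2)) (cf x) _.
  exact: exprn_continuous.
have mdv : measurable_fun (oo01 : set R) (weak_derivative v) by case: vdv => _ [].
have mdd : measurable_fun (oo01 : set R) (weak_derivative (weak_derivative v)).
  by case: dvd => _ [].
have L2dv : L2 (weak_derivative v).
  apply: (L2_ae mdv _ (L2c _ cp)).
  by apply: ae_imply dvp => x h x01; rewrite (h x01).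
have L2dd : L2 (weak_derivative (weak_derivative v)).
  apply: (L2_ae mdd _ (L1_L2 w1 w2)).
  by apply: ae_imply dw => x h x01; rewrite (h x01).
split; [|exact: cv|by split|by exists p; split].
split; first exact: L2c.
split; first by exists p.
split; first exact: L2dv.
split; last by split; [exact: L2dd|].
by exists (weak_derivative (weak_derivative v)).
Qed.

End SobolevH20.

(** * Second-order expansion of the energy density *)

Section FirstVariation.
Context {R : realType}.
Notation mu := (@lebesgue_measure R).
Implicit Types (f g phi p v w : R -> R) (x y a b h d q s t : R).

Lemma within_cc_comp f (F : R -> R) : continuous F -> {within `[0, 1], continuous f} ->
  {within `[0, 1], continuous (fun x => F (f x))}.
Proof. by move=> cF cf x; apply: (@cvg_comp _ _ _ f F _ _ _ (cf x)); exact: cF. Qed.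

Lemma expn_continuous n : continuous (fun x : R => x ^+ n).
Proof. exact: exprn_continuous. Qed.

Definition dens q : R := iarcl q ^+ 5.
Definition ddens q : R := - 5 * q * iarcl q ^+ 7.

Lemma is_derive_dens q : is_derive q 1 dens (ddens q).
Proof.
by apply: (is_derive_eq (is_derive_pow 5 (is_derive_iarcl q))); rewrite /ddens /=; ring.
Qed.

Lemma is_derive_ddens q :
  is_derive q 1 ddens (- 5 * iarcl q ^+ 7 + 35 * q ^+ 2 * iarcl q ^+ 9).
Proof.
have d := is_derive_prod2 (is_derive_scal (- 5) (is_derive_id q 1)) (is_derive_pow 7 (is_derive_iarcl q)).
by apply: (is_derive_eq d); rewrite /=; ring.
Qed.

Lemma dens_continuous : continuous dens.
Proof. by move=> q; exact: is_derive_cont (is_derive_dens q). Qed.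

Lemma ddens_continuous : continuous ddens.
Proof. by move=> q; exact: is_derive_cont (is_derive_ddens q). Qed.

Lemma iarcl_exp_itv n q : 0 <= iarcl q ^+ n <= 1.
Proof. by rewrite exprn_ge0 ?exprn_ile1// ?iarcl_le1// ltW// iarcl_gt0. Qed.

Lemma dens_itv q : 0 <= dens q <= 1. Proof. exact: iarcl_exp_itv. Qed.

Lemma ddens_bound q : `|ddens q| <= 5.
Proof.
have -> : ddens q = - 5 * ((q * iarcl q) * iarcl q ^+ 6) by rewrite /ddens; ring.
have /andP[r0 r1] := iarcl_exp_itv 6 q.
rewrite normrM normrN (@ger0_norm _ 5)// normrM (ger0_norm r0).
by have := mul_iarcl q; have := normr_ge0 (q * iarcl q); nra.
Qed.

(** With s = q / [arcl q] in [-1, 1], the expression is [iarcl q ^+ 7] times 35 s^2 - 5, and 40 = 35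
    + 5. *)
Lemma dddens_bound q : `|- 5 * iarcl q ^+ 7 + 35 * q ^+ 2 * iarcl q ^+ 9| <= 40.
Proof.
have -> : - 5 * iarcl q ^+ 7 + 35 * q ^+ 2 * iarcl q ^+ 9 =
  iarcl q ^+ 7 * (35 * (q * iarcl q) ^+ 2 - 5) by ring.
have /andP[r0 r1] := iarcl_exp_itv 7 q.
have h : 0 <= (q * iarcl q) ^+ 2 <= 1.
  by rewrite sqr_ge0/= -[X in X <= _]ger0_norm ?sqr_ge0// normrX exprn_ile1// mul_iarcl.
rewrite normrM (ger0_norm r0); move/andP: h => [h0 h1].
have : `|35 * (q * iarcl q) ^+ 2 - 5| <= 40 by rewrite ler_norml; apply/andP; split; lra.
by have := normr_ge0 (35 * (q * iarcl q) ^+ 2 - 5); nra.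
Qed.

Lemma lipschitz_MVT (F dF : R -> R) (L : R) : (forall x : R, is_derive x 1 F (dF x)) ->
  (forall x, `|dF x| <= L) -> forall x y, `|F y - F x| <= L * `|y - x|.
Proof.
move=> D B.
have cF : continuous F by move=> x; exact: is_derive_cont (D x).
suff H x y : x <= y -> `|F y - F x| <= L * `|y - x|.
  move=> x y; case: (leP x y) => [/H//|/ltW/H].
  by rewrite distrC [`|x - y|]distrC.
move=> xy.
have [c _ ->] := MVT_segment xy (fun z _ => D z) (continuous_subspaceT cF).
by rewrite normrM ler_wpM2r.
Qed.

(** The mean value theorem for F(x + y) - F'(x) y, followed by the Lipschitz bound on F'; this costs
    the factor 1/2 of Taylor's formula, which is harmless here. *)
Lemma taylor_MVT (F dF ddF : R -> R) (L : R) : (forall x : R, is_derive x 1 F (dF x)) ->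
  (forall x : R, is_derive x 1 dF (ddF x)) ->
  (forall x, `|ddF x| <= L) -> forall x s,
  `|F (x + s) - F x - dF x * s| <= L * s ^+ 2.
Proof.
move=> D D2 B x s.
have d1 (y : R) : is_derive y 1 (fun y => F (x + y) - dF x * y) (dF (x + y) - dF x).
  have e1 : is_derive y 1 (fun y : R => x + y) 1.
    have := is_derive_affine y 1 x.
    by congr (is_derive _ _ _ _); apply/funext => z; rewrite mul1r addrC.
  have e2 := @is_derive_chain _ F (fun y => x + y) _ _ _ (D (x + y)) e1.
  have e3 := is_deriveB e2 (is_derive_scal (dF x) (is_derive_id y 1)).
  by apply: (is_derive_eq e3); rewrite !mulr1.
have cF : continuous (fun y => F (x + y) - dF x * y) by move=> y; exact: is_derive_cont (d1 y).
have Lb y : `|dF (x + y) - dF x| <= L * `|y|.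
  by have := lipschitz_MVT D2 B x (x + y); rewrite [x + y - x]addrC addKr.
have L0 : 0 <= L by apply: le_trans (B 0).
suff [c cs ->] : exists2 c, `|c| <= `|s| & F (x + s) - F x - dF x * s = (dF (x + c) - dF x) * s.
  rewrite normrM (le_trans (ler_wpM2r _ (Lb c)))// -[s ^+ 2]ger0_norm ?sqr_ge0//.
  by rewrite normrX expr2 mulrA ler_wpM2r// ler_wpM2l.
case: (leP 0 s) => [s0|/ltW s0].
  have [c cs e] := MVT_segment s0 (fun z _ => d1 z) (continuous_subspaceT cF).
  exists c; last by move: e; rewrite addr0 mulr0 !subr0 => <-; ring.
  by move: cs; rewrite in_itv/= => /andP[c0 cs]; rewrite !ger0_norm.
have [c cs e] := MVT_segment s0 (fun z _ => d1 z) (continuous_subspaceT cF).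
exists c; last first.
  move: e; rewrite addr0 mulr0 subr0 sub0r => e.
  by transitivity (- ((dF (x + c) - dF x) * - s)); [rewrite -e; ring|ring].
by move: cs; rewrite in_itv/= => /andP[c0 cs]; rewrite !ler0_norm ?lerN2.
Qed.

(* [45 M^2 (1 + w^2)] does not depend on [t] and is integrable, so the remainder
   is O(t^2) after integration. *)
Lemma energy_expansion (w p f1 f2 t M : R) : 0 <= t -> t <= 1 -> `|f1| <= M -> `|f2| <= M ->
  (w + t * f2) ^+ 2 * dens (p + t * f1) <=
  w ^+ 2 * dens p + t * (2 * w * dens p * f2 + w ^+ 2 * ddens p * f1) +
  t ^+ 2 * (45 * M ^+ 2) * (1 + w ^+ 2).
Proof.
move=> t0 t1 h1 h2; set s := t * f1; have M0 : 0 <= M by apply: le_trans h1.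
have sM : `|s| <= t * M by rewrite normrM (ger0_norm t0) ler_wpM2l.
have s2M : s ^+ 2 <= (t * M) ^+ 2.
  by rewrite -[s ^+ 2]ger0_norm ?sqr_ge0// normrX lerXn2r// ?nnegrE// mulr_ge0.
have a1 := taylor_MVT is_derive_dens is_derive_ddens dddens_bound p s.
have a2 := lipschitz_MVT is_derive_dens ddens_bound p (p + s).
rewrite [p + s - p]addrC addKr in a2.
have /andP[G0 G1] := dens_itv (p + s).
set Gs := dens (p + s) in a1 a2 G0 G1 *; set G := dens p in a1 a2 *; set G' := ddens p in a1 *.
have -> : (w + t * f2) ^+ 2 * Gs = w ^+ 2 * G + t * (2 * w * G * f2 + w ^+ 2 * G' * f1) +
  (w ^+ 2 * (Gs - G - G' * s) + 2 * w * (t * f2) * (Gs - G) + (t * f2) ^+ 2 * Gs).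
  by rewrite /s; ring.
rewrite lerD2l.
(* With T = (t M)^2 the three error terms are at most 40 w^2 T, 5 T (1 + w^2) and T, and their sum
   is at most 45 T (1 + w^2). *)
have b1 : w ^+ 2 * (Gs - G - G' * s) <= w ^+ 2 * (40 * (t * M) ^+ 2).
  rewrite ler_wpM2l ?sqr_ge0// (le_trans (ler_norm _))// (le_trans a1)// ler_wpM2l//.
have f2M : `|t * f2| <= t * M by rewrite normrM (ger0_norm t0) ler_wpM2l.
have b2 : 2 * w * (t * f2) * (Gs - G) <= 2 * `|w| * (t * M) * (5 * (t * M)).
  apply: le_trans (ler_norm _) _; rewrite !normrM (@ger0_norm _ 2)// -normrM.
  rewrite ler_pM// ?mulr_ge0//.
    by rewrite ler_wpM2l// mulr_ge0.
  by apply: le_trans a2 _; rewrite ler_wpM2l.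
have b3 : (t * f2) ^+ 2 * Gs <= (t * M) ^+ 2.
  rewrite -[X in _ <= X]mulr1 ler_pM ?sqr_ge0//.
  by rewrite -[(t * f2) ^+ 2]ger0_norm ?sqr_ge0// normrX lerXn2r// ?nnegrE// mulr_ge0.
have w1 : 2 * `|w| <= 1 + w ^+ 2.
  by rewrite -[w ^+ 2]ger0_norm ?sqr_ge0// normrX; have := sqr_ge0 (`|w| - 1); nra.
have tM2 : 0 <= (t * M) ^+ 2 by exact: sqr_ge0.
have e1 : 2 * `|w| * (t * M) * (5 * (t * M)) = 5 * (t * M) ^+ 2 * (2 * `|w|) by ring.
have e2 : 5 * (t * M) ^+ 2 * (2 * `|w|) <= 5 * (t * M) ^+ 2 * (1 + w ^+ 2).
  by rewrite ler_wpM2l// mulr_ge0.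
have w2 := sqr_ge0 w.
have e3 : (t * M) ^+ 2 <= (t * M) ^+ 2 * (1 + w ^+ 2) by rewrite ler_peMr// lerDl.
have e4 : w ^+ 2 * (40 * (t * M) ^+ 2) <= 39 * ((t * M) ^+ 2 * (1 + w ^+ 2)) + w ^+ 2 * (t * M) ^+ 2.
  rewrite mulrDr mulr1; lra.
have -> : t ^+ 2 * (45 * M ^+ 2) * (1 + w ^+ 2) = 45 * ((t * M) ^+ 2 * (1 + w ^+ 2)) by ring.
rewrite e1 in b2.
rewrite mulrDr mulr1 in e2 e3 e4 *.
nra.
Qed.

End FirstVariation.

(** * Symmetry of the minimiser and comparison with competitors *)

Section MinimiserData.
Context {R : realType}.
Notation mu := (@lebesgue_measure R).
Implicit Types (f g phi p v w : R -> R) (x y a b h d q s t : R).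

Definition C2_fun phi phi1 phi2 :=
  [/\ forall x : R, is_derive x 1 phi (phi1 x),
      forall x : R, is_derive x 1 phi1 (phi2 x) & continuous phi2].

Lemma oo01E x : oo01 x <-> 0 < x < 1. Proof. by rewrite /oo01/= in_itv. Qed.

Lemma is_derive_onem f x d : is_derive (1 - x) 1 f d ->
  is_derive x 1 (fun y => f (1 - y)) (- d).
Proof.
move=> df; have e : is_derive x 1 (fun y : R => 1 - y) (-1).
  have := is_derive_affine x (-1) 1.
  by congr (is_derive _ _ _ _); apply/funext => y; rewrite mulN1r addrC.
by apply: (is_derive_eq (@is_derive_chain _ f (fun y => 1 - y) _ _ _ df e)); rewrite mulrN1.
Qed.

Lemma C2_fun_weak phi phi1 phi2 : C2_fun phi phi1 phi2 ->
  [/\ continuous phi, continuous phi1, is_weak_derivative phi phi1 &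
      is_weak_derivative phi1 phi2].
Proof.
move=> [d1 d2 c2].
have c0 : continuous phi by move=> x; exact: is_derive_cont (d1 x).
have c1 : continuous phi1 by move=> x; exact: is_derive_cont (d2 x).
by split=> //; exact: C1_weak_derivative.
Qed.

Lemma within_ccD f g : {within `[0, 1], continuous f} -> {within `[0, 1], continuous g} ->
  {within `[0, 1], continuous (fun x => f x + g x)}.
Proof. by move=> cf cg x; apply: cvgD; [exact: cf|exact: cg]. Qed.

Lemma L1_sqrD w f : L1 w -> L1 (fun x => w x ^+ 2) -> continuous f ->
  L1 (fun x => (w x + f x) ^+ 2).
Proof.
move=> w1 w2 cf.
have wf : L1 (fun x => 2 * (w x * f x)).
  by apply: L1Z; apply: L1M_continuous => //; exact: continuous_subspaceT.
have ff : L1 (fun x => f x * f x).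
  apply: L1M_continuous; last exact: continuous_subspaceT.
  exact/L1_continuous/continuous_subspaceT.
have := L1D (L1D w2 wf) ff.
by congr L1; apply/funext => x; ring.
Qed.

Lemma L1_energy w p : L1 (fun x => w x ^+ 2) -> {within `[0, 1], continuous p} ->
  L1 (fun x => w x ^+ 2 * dens (p x)).
Proof. by move=> w2 cp; apply: L1M_continuous => //; exact: within_cc_comp dens_continuous cp. Qed.

Lemma EFin_Rintegral_oo f : L1 f ->
  (\int[mu]_(x in oo01) f x)%:E = (\int[mu]_(x in oo01) (f x)%:E)%E.
Proof.
move=> f1; rewrite /Rintegral fineK//.
by apply: integrable_fin_num; [exact: measurable_oo01|exact: L1_oo].
Qed.

(** The perturbation is symmetric and vanishes with its slope at both ends, so u + phi stays
    admissible; both energies are finite, which makes the comparison one of real numbers. *)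
Lemma competitor_inequality psi u p w phi phi1 phi2 : is_minimiser psi u ->
  {within `[0, 1], continuous p} -> p 0 = 0 -> p 1 = 0 ->
  L1 w -> L1 (fun x => w x ^+ 2) ->
  is_weak_derivative u p -> is_weak_derivative p w ->
  C2_fun phi phi1 phi2 -> phi 0 = 0 -> phi 1 = 0 -> phi1 0 = 0 -> phi1 1 = 0 ->
  (forall x, phi (1 - x) = phi x) ->
  (forall x, oo01 x -> psi x <= u x + phi x) ->
  \int[mu]_(x in oo01) (w x ^+ 2 * dens (p x)) <=
  \int[mu]_(x in oo01) ((w x + phi2 x) ^+ 2 * dens (p x + phi1 x)).
Proof.
move=> [[uH u_sym _] uE] cp p0 p1 w1 w2 up pw C2 f0 f1 f10 f11 fsym fge.
have [c0 c1 wk1 wk2] := C2_fun_weak C2; have [_ _ c2] := C2.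
have [_ cu [u0 u1] _] := uH.
have cL1 f : continuous f -> L1 f by move=> cf; exact/L1_continuous/continuous_subspaceT.
have vp := weak_derivativeD (L1_continuous cu) (L1_continuous cp) (cL1 _ c0) (cL1 _ c1) up wk1.
have vw := weak_derivativeD (L1_continuous cp) w1 (cL1 _ c1) (cL1 _ c2) pw wk2.
have cv := within_ccD cu (continuous_subspaceT c0).
have cvp := within_ccD cp (continuous_subspaceT c1).
have vw2 := L1_sqrD w1 w2 c2.
have vH : H20 (fun x => u x + phi x).
  apply: (H20_intro cv _ _ cvp _ _ (L1D w1 (cL1 _ c2)) vw2 vp vw).
  - by rewrite u0 f0 addr0.
  - by rewrite u1 f1 addr0.
  - by rewrite p0 f10 addr0.
  - by rewrite p1 f11 addr0.
have vadm : admissible psi (fun x => u x + phi x).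
  by split => // x x01; rewrite -u_sym// fsym.
have [_ _ _ _ eu] := elastica_rep cu cp up pw.
have [_ _ _ _ ev] := elastica_rep cv cvp vp vw.
rewrite -lee_fin !EFin_Rintegral_oo; [|exact: L1_energy..].
rewrite -eu -ev uE; apply: ereal_inf_lbound.
by exists (fun x => u x + phi x).
Qed.

(** Differentiation of u(x) = u(1 - x) inside; at the ends both sides are 0. *)
Lemma slope_antisymmetric u p : {within `[0, 1], continuous p} -> p 0 = 0 -> p 1 = 0 ->
  (forall x, oo01 x -> u x = u (1 - x)) ->
  (forall x, 0 <= x <= 1 -> u x = u 0 + prim p x) ->
  forall x, 0 <= x <= 1 -> p (1 - x) = - p x.
Proof.
move=> cp p0 p1 usym uE x /andP[x0 x1].
have [->|xn0] := eqVneq x 0; first by rewrite subr0 p0 p1 oppr0.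
have [->|xn1] := eqVneq x 1; first by rewrite subrr p0 p1 oppr0.
have du y : 0 < y < 1 -> is_derive y 1 u (p y).
  move=> y01; have d := is_derive_prim (L1_continuous cp) y01 (within_cc_oo cp y01).
  apply: (@near_is_derive _ (fun z => u 0 + prim p z) _ _ _ `]0, 1[%classic).
  - exact: interval_open.
  - by rewrite /= in_itv.
  - by move=> z; rewrite /= in_itv/= => /andP[? ?]; rewrite (uE z)// !ltW.
  - by apply: (is_derive_eq (is_derive_sum2 (is_derive_cst (u 0) y (1 : R)) d)); rewrite add0r.
have x01 : 0 < x < 1 by rewrite !lt_neqAle x0 x1 xn1 eq_sym xn0.
have x01' : 0 < 1 - x < 1 by move/andP : x01 => [? ?]; apply/andP; split; lra.
have d1 := is_derive_onem (du _ x01').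
have d2 : is_derive x 1 (fun y => u (1 - y)) (p x).
  apply: (@near_is_derive _ u _ _ _ `]0, 1[%classic); last exact: du.
  - exact: interval_open.
  - by rewrite /= in_itv.
  - by move=> z /usym.
by rewrite -(is_derive_derive1 d2) (is_derive_derive1 d1) opprK.
Qed.

(** Differentiation of p(1 - x) = - p(x), at points x for which the primitive of [w] is
    differentiable at both x and 1 - x. *)
Lemma curvature_symmetric p w : L1 w -> (forall x, 0 <= x <= 1 -> p x = prim w x) ->
  (forall x, 0 <= x <= 1 -> p (1 - x) = - p x) ->
  {ae mu, forall x, oo01 x -> w (1 - x) = w x}.
Proof.
move=> w1 pE psym; have D := is_derive_prim_ae w1.
apply: ae_imply (ae_and D (ae_onem D)) => x [h1 h2] /oo01E x01.
have x01' : 0 < 1 - x < 1 by move/andP : x01 => [? ?]; apply/andP; split; lra.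
have d1 := is_derive_onem (h2 x01').
have d2 : is_derive x 1 (fun y => - prim w y) (- w (1 - x)).
  apply: (@near_is_derive _ _ _ _ _ `]0, 1[%classic _ _ _ d1).
  - exact: interval_open.
  - by rewrite /= in_itv.
  - move=> z; rewrite /= in_itv/= => /andP[? ?].
    by rewrite -!pE ?psym//; apply/andP; split; lra.
have d3 := is_deriveN (h1 x01).
by apply: oppr_inj; rewrite -(is_derive_derive1 d2) -(is_derive_derive1 d3).
Qed.

Lemma minimiser_data psi u : is_minimiser psi u -> exists p w : R -> R,
  [/\ [/\ {within `[0, 1], continuous p}, p 0 = 0, p 1 = 0, L1 w & L1 (fun x => w x ^+ 2)],
      [/\ forall x, 0 <= x <= 1 -> u x = prim p x,
      forall x, 0 <= x <= 1 -> p x = prim w x,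
      forall x, 0 <= x <= 1 -> p (1 - x) = - p x &
      forall x, w (1 - x) = w x] &
      is_weak_derivative u p /\ is_weak_derivative p w].
Proof.
move=> [[uH u_sym _] _]; have [p [w [cp [p0 p1] [w1 w2] [up pw]]]] := H20_data uH.
have [_ cu [u0 u1] _] := uH.
have uE x : 0 <= x <= 1 -> u x = u 0 + prim p x.
  by apply: weak_derivative_prim => //; exact: L1_continuous.
have pE x : 0 <= x <= 1 -> p x = prim w x.
  by move=> x01; rewrite (weak_derivative_prim cp w1 pw x01) p0 add0r.
have psym := slope_antisymmetric cp p0 p1 u_sym uE.
have wsym := curvature_symmetric w1 pE psym.
(* Averaging with the reflection changes [w] only on a null subset of (0,1) and makes the symmetry
   hold at every point, so that it can be used directly under an integral. *)
pose w' x := 2^-1 * (w x + w (1 - x)).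
have w'1 : L1 w' by apply: L1Z; apply: L1D => //; exact: L1_onem.
have ww' : {ae mu, forall x, oo01 x -> w x = w' x}.
  by apply: ae_imply wsym => x h x01; rewrite /w' h//; field.
have L2w' : L2 w'.
  apply: (L2_ae _ ww'); last exact: L1_L2.
  by have /integrableP[/measurable_EFinP] := L1_oo w'1.
exists p, w'; split.
- by split => //; have [] := L2_L1 L2w'.
- split => //.
  + by move=> x x01; rewrite uE// u0 add0r.
  + by move=> x x01; rewrite pE//; exact: prim_ae.
  + by move=> x; rewrite /w' subKr addrC.
- split => //; apply: (is_weak_derivative_ae (within_cc_measurable cp) _ _ ww' pw).
    by case: L2w'.
  by apply: aeW.
Qed.

End MinimiserData.

(** * The variational inequality and its limit at triples of points *)

Section EulerLagrange.
Context {R : realType}.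
Notation mu := (@lebesgue_measure R).
Implicit Types (f g phi v : R -> R) (x y a b c h d q s t : R).

Lemma Rintegral_ooD f g : L1 f -> L1 g ->
  \int[mu]_(x in oo01) (f x + g x) = \int[mu]_(x in oo01) f x + \int[mu]_(x in oo01) g x.
Proof.
by move=> f1 g1; apply: RintegralD; [exact: measurable_oo01|exact: L1_oo..].
Qed.

Lemma Rintegral_ooZ f (k : R) : L1 f ->
  \int[mu]_(x in oo01) (k * f x) = k * \int[mu]_(x in oo01) f x.
Proof.
by move=> f1; apply: RintegralZl; [exact: measurable_oo01|exact: L1_oo].
Qed.

(* The coefficients [c - b], [a - c], [b - a] and their first moments at [a], [b],
   [c] sum to 0, so the affine parts of the ramps cancel outside [a - h, c + h]. *)
Definition hat a b c h x : R :=
  (c - b) * ramp_h h (x - a) + (a - c) * ramp_h h (x - b) + (b - a) * ramp_h h (x - c).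
Definition hat1 a b c h x : R :=
  (c - b) * step_h h (x - a) + (a - c) * step_h h (x - b) + (b - a) * step_h h (x - c).
Definition hat2 a b c h x : R :=
  (c - b) * bump_h h (x - a) + (a - c) * bump_h h (x - b) + (b - a) * bump_h h (x - c).

Lemma hat_C2 a b c h : h != 0 -> C2_fun (hat a b c h) (hat1 a b c h) (hat2 a b c h).
Proof.
move=> h0; split=> x.
- apply: is_derive_sum2; first apply: is_derive_sum2; exact/is_derive_scal/is_derive_ramp_h.
- apply: is_derive_sum2; first apply: is_derive_sum2; exact/is_derive_scal/is_derive_step_h.
- by apply: cvgD; first apply: cvgD; apply: cvgM; [exact: cvg_cst|exact: bump_h_continuous
    |exact: cvg_cst|exact: bump_h_continuous|exact: cvg_cst|exact: bump_h_continuous].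
Qed.

(** Up to the factor h^2 this is convexity of [ramp] at (x - c)/h <= (x - b)/h <= (x - a)/h; the
    order of a, b, c is reversed. *)
Lemma hat_ge0 a b c h x : 0 < h -> a <= b -> b <= c -> 0 <= hat a b c h x.
Proof.
move=> h0 ab bc; rewrite /hat /ramp_h.
have hN0 : h != 0 by rewrite gt_eqF.
have hi : 0 <= h^-1 by rewrite invr_ge0 ltW.
have := @ramp_convex R ((x - c) / h) ((x - b) / h) ((x - a) / h) _ _.
set rb := ramp _; set rc := ramp _; set ra := ramp _ => H.
have {}H := H (ler_wpM2r hi (lerB (lexx x) bc)) (ler_wpM2r hi (lerB (lexx x) ab)).
have -> : (c - b) * (h * ra) + (a - c) * (h * rb) + (b - a) * (h * rc) =
  h ^+ 2 * (((x - a) / h - (x - b) / h) * rc + ((x - b) / h - (x - c) / h) * ra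
     - ((x - a) / h - (x - c) / h) * rb) by field.
by rewrite mulr_ge0 ?sqr_ge0// subr_ge0.
Qed.

Lemma hat_out a b c h x : 0 < h -> a <= b -> b <= c -> ~~ (a - h <= x <= c + h) ->
  hat a b c h x = 0 /\ hat1 a b c h x = 0.
Proof.
move=> h0 ab bc; rewrite negb_and -!ltNge => /orP[xa|xc].
  have H d : a <= d -> ramp_h h (x - d) = 0 /\ step_h h (x - d) = 0.
    move=> ad; split; last by rewrite step_h0//; lra.
    by rewrite /ramp_h ramp_le ?mulr0// ler_pdivrMr//; lra.
  have [r1 s1] := H a (lexx a); have [r2 s2] := H b ab.
  have [r3 s3] := H c (le_trans ab bc).
  by rewrite /hat /hat1 r1 r2 r3 s1 s2 s3 !mulr0 !addr0.
have hN0 : h != 0 by rewrite gt_eqF.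
have H d : d <= c -> ramp_h h (x - d) = h * ramp 1 + (x - d) - h /\ step_h h (x - d) = 1.
  move=> dc; split; last by rewrite step_h1//; lra.
  rewrite /ramp_h ramp_ge1; first by field.
  by rewrite ler_pdivlMr//; lra.
have [r1 s1] := H a (le_trans ab bc); have [r2 s2] := H b bc.
have [r3 s3] := H c (lexx c).
by rewrite /hat /hat1 r1 r2 r3 s1 s2 s3; split; ring.
Qed.

Context (psi u p w : R -> R).
Context (psi_cont : {within `[0, 1], continuous psi}).
Context (psi_sym : forall x, oo01 x -> psi x = psi (1 - x)).
Context (u_min : is_minimiser psi u).
Context (cp : {within `[0, 1], continuous p}) (p0 : p 0 = 0) (p1 : p 1 = 0).
Context (w1 : L1 w) (w2 : L1 (fun x => w x ^+ 2)).
Context (psym : forall x, 0 <= x <= 1 -> p (1 - x) = - p x).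
Context (wsym : forall x, w (1 - x) = w x).
Context (up : is_weak_derivative u p) (pw : is_weak_derivative p w).

(* [momentum] is A and [forcing] is -B, so that [kinked] below is F = A + int B. *)
Definition momentum x : R := 2 * w x * dens (p x).
Definition forcing x : R := w x ^+ 2 * ddens (p x).

Lemma L1_momentum : L1 momentum.
Proof.
have := L1Z 2 (L1M_continuous w1 (within_cc_comp dens_continuous cp)).
by congr L1; apply/funext => x; rewrite /momentum mulrA.
Qed.

Lemma L1_forcing : L1 forcing.
Proof. exact: L1M_continuous w2 (within_cc_comp ddens_continuous cp). Qed.

Definition first_variation phi1 phi2 : R :=
  \int[mu]_(x in oo01) (momentum x * phi2 x + forcing x * phi1 x).

Lemma L1_variation phi1 phi2 : continuous phi1 -> continuous phi2 ->
  L1 (fun x => momentum x * phi2 x + forcing x * phi1 x).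
Proof.
move=> c1 c2; apply: L1D; apply: L1M_continuous; first exact: L1_momentum.
- exact: continuous_subspaceT.
- exact: L1_forcing.
- exact: continuous_subspaceT.
Qed.

Lemma C2_funZ t phi phi1 phi2 : C2_fun phi phi1 phi2 ->
  C2_fun (fun x => t * phi x) (fun x => t * phi1 x) (fun x => t * phi2 x).
Proof.
move=> [d1 d2 c2]; split=> x.
- exact: is_derive_scal.
- exact: is_derive_scal.
- by apply: cvgM; [exact: cvg_cst|exact: c2].
Qed.

(** Minimality along u + t phi and the expansion give 0 <= T + t K for small t > 0, with T the first
    variation and K independent of t. *)
Lemma symmetric_variation_ge0 phi phi1 phi2 (t0 : R) : C2_fun phi phi1 phi2 ->
  phi 0 = 0 -> phi 1 = 0 -> phi1 0 = 0 -> phi1 1 = 0 ->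
  (forall x, phi (1 - x) = phi x) -> 0 < t0 ->
  (forall t x, 0 < t -> t <= t0 -> oo01 x -> psi x <= u x + t * phi x) ->
  0 <= first_variation phi1 phi2.
Proof.
move=> C2 f0 f1 f10 f11 fsym t00 adm.
have [c0 c1 _ _] := C2_fun_weak C2; have [_ _ c2] := C2.
have [M1 HM1] := continuous_itv_bounded (continuous_subspaceT c1).
have [M2 HM2] := continuous_itv_bounded (continuous_subspaceT c2).
pose M := Num.max M1 M2.
pose I := \int[mu]_(x in oo01) (1 + w x ^+ 2).
set T := first_variation _ _.
have LI : L1 (fun x => 1 + w x ^+ 2) by apply: L1D => //; exact: L1_cst.
have LT := L1_variation c1 c2.
have LE := L1_energy w2 cp.
have key t : 0 < t -> t <= t0 -> t <= 1 -> 0 <= T + t * (45 * M ^+ 2 * I).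
  move=> t_gt0 tt0 t1; have C2t := C2_funZ t C2.
  have := competitor_inequality u_min cp p0 p1 w1 w2 up pw C2t.
  rewrite f0 f1 f10 f11 !mulr0 => /(_ erefl erefl erefl erefl) H.
  have {}H := H (fun x => congr1 ( *%R t) (fsym x)) (fun x => adm t x t_gt0 tt0).
  have [c0' c1' _ _] := C2_fun_weak C2t; have [_ _ c2'] := C2t.
  have L : L1 (fun x => (w x + t * phi2 x) ^+ 2 * dens (p x + t * phi1 x)).
    apply: L1_energy; first exact: L1_sqrD.
    exact: within_ccD cp (continuous_subspaceT c1').
  have LR : L1 (fun x => w x ^+ 2 * dens (p x) + t * (momentum x * phi2 x + forcing x * phi1 x)).
    by apply: L1D => //; exact: L1Z.
  have LR2 := L1D LR (L1Z (t ^+ 2 * (45 * M ^+ 2)) LI).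
  have H2 : \int[mu]_(x in oo01) ((w x + t * phi2 x) ^+ 2 * dens (p x + t * phi1 x)) <=
    \int[mu]_(x in oo01) (w x ^+ 2 * dens (p x) + t * (momentum x * phi2 x + forcing x * phi1 x) +
       t ^+ 2 * (45 * M ^+ 2) * (1 + w x ^+ 2)).
    apply: le_Rintegral; [exact: measurable_oo01|exact: L1_oo|exact: L1_oo|].
    move=> x /oo_sub_cc; rewrite /= in_itv/= => x01.
    apply: energy_expansion; [exact: ltW|exact: t1| |].
      by rewrite le_max HM1.
    by rewrite le_max HM2 ?orbT.
  have := le_trans H H2; rewrite Rintegral_ooD//; last exact: L1Z.
  rewrite Rintegral_ooD//; last exact: L1Z.
  rewrite !Rintegral_ooZ// -/(first_variation phi1 phi2) -/T -/I -addrA lerDl.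
  have -> : t * T + t ^+ 2 * (45 * M ^+ 2) * I = t * (T + t * (45 * M ^+ 2 * I)) by ring.
  by rewrite pmulr_rge0.
rewrite leNgt; apply/negP => T0.
set K := 45 * M ^+ 2 * I in key.
have I0 : 0 <= I by apply: Rintegral_ge0 => x _; rewrite addr_ge0// sqr_ge0.
have K0 : 0 <= K by apply: mulr_ge0 => //; apply: mulr_ge0 => //; exact: sqr_ge0.
(* If T < 0, this choice gives t K < - T / 2, hence T + t K < 0. *)
pose t := Num.min (Num.min t0 1) (- T / (2 * (K + 1))).
have K1 : 0 < 2 * (K + 1) by lra.
have tpos : 0 < t by rewrite !lt_min t00 ltr01/= divr_gt0// oppr_gt0.
have ta : t <= t0 by rewrite !ge_min lexx.
have tb : t <= 1 by rewrite !ge_min lexx orbT.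
have tc : t * (2 * (K + 1)) <= - T by rewrite -ler_pdivlMr// ge_min lexx orbT.
have := key t tpos ta tb; nra.
Qed.

Lemma dens_even q : dens (- q) = dens q.
Proof. by rewrite /dens /iarcl /arcl sqrrN. Qed.

Lemma ddens_odd q : ddens (- q) = - ddens q.
Proof. by rewrite /ddens /iarcl /arcl sqrrN mulrN mulNr. Qed.

(** The symmetrisation of [phi] is tested. As [momentum] is even and [forcing] odd about 1/2, the
    reflected half contributes the same amount, and twice the first variation of [phi] itself comes
    out. *)
Lemma variation_ge0 phi phi1 phi2 (t0 : R) : C2_fun phi phi1 phi2 ->
  phi 0 = 0 -> phi 1 = 0 -> phi1 0 = 0 -> phi1 1 = 0 -> 0 < t0 ->
  (forall t x, 0 < t -> t <= t0 -> oo01 x -> psi x <= u x + t * (phi x + phi (1 - x))) ->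
  0 <= first_variation phi1 phi2.
Proof.
move=> C2 f0 f1 f10 f11 t00 adm; have [d1 d2 c2] := C2.
have [c0 c1 _ _] := C2_fun_weak C2.
have cr f : continuous f -> continuous (fun x => f (1 - x)).
  move=> cf x; apply: (@continuous_comp _ _ _ (fun y : R => 1 - y) f); last exact: cf.
  by apply: cvgB; [exact: cvg_cst|exact: cvg_id].
have C2s : C2_fun (fun x => phi x + phi (1 - x)) (fun x => phi1 x - phi1 (1 - x))
    (fun x => phi2 x + phi2 (1 - x)).
  split=> x.
  - exact: is_derive_sum2 (d1 x) (is_derive_onem (d1 (1 - x))).
  - apply: (is_derive_eq (is_deriveB (d2 x) (is_derive_onem (d2 (1 - x))))).
    by rewrite opprK.
  - by apply: cvgD; [exact: c2|exact: cr].
have := symmetric_variation_ge0 C2s _ _ _ _ _ t00 adm.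
rewrite subr0 subrr f0 f1 f10 f11 subrr addr0 => /(_ erefl erefl erefl erefl) H.
have {}H : 0 <= first_variation (fun x => phi1 x - phi1 (1 - x)) (fun x => phi2 x + phi2 (1 - x)).
  by apply: H => x; rewrite subKr addrC.
have LT := L1_variation c1 c2.
have E : first_variation (fun x => phi1 x - phi1 (1 - x)) (fun x => phi2 x + phi2 (1 - x)) =
    2 * first_variation phi1 phi2.
  transitivity (first_variation phi1 phi2 +
     \int[mu]_(x in oo01) (momentum (1 - x) * phi2 (1 - x) + forcing (1 - x) * phi1 (1 - x))).
    rewrite -Rintegral_ooD//; last exact: L1_onem LT.
    apply: eq_Rintegral => x; rewrite inE => /oo_sub_cc; rewrite /= in_itv/= => x01.
    by rewrite /momentum /forcing psym// wsym dens_even ddens_odd; ring.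
  by rewrite (Rintegral_onem LT) mulr2n mulrDl mul1r.
by move: H; rewrite E pmulr_rge0.
Qed.

(** In the sense of distributions its second derivative is the contact measure, the nonnegative
    functional of the variational inequality; its slope can jump only where u touches psi. *)
Definition kinked x : R := momentum x - prim forcing x.

(** The concentrating kernels [bump_h] meet only [momentum]; [forcing] is paired with [step_h],
    whose limit exists at every interior point. *)
Definition good_pt x := 0 < x < 1 /\ lebesgue_pt (momentum \_ `[0, 1]) x.

Lemma good_pt_ae : {ae mu, forall x, 0 < x < 1 -> good_pt x}.
Proof.
have mcc : measurable (`[0, 1]%classic : set R) by exact: measurable_itv.
apply: ae_imply (lebesgue_differentiation (integrable_locally_restrict mcc L1_momentum)).
by move=> x lx x01; split.
Qed.

(** Each point contributes separately, with limit [kinked] plus the constant [prim forcing 1]; the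
    constant drops out because c - b, a - c and b - a sum to 0. *)
Lemma hat_variation_cvg a b c : good_pt a -> good_pt b -> good_pt c ->
  first_variation (hat1 a b c h) (hat2 a b c h) @[h --> 0^'+] -->
  (c - b) * kinked a + (a - c) * kinked b + (b - a) * kinked c.
Proof.
pose V a h := \int[mu]_(x in oo01) (momentum x * bump_h h (x - a)) +
  \int[mu]_(x in oo01) (forcing x * step_h h (x - a)).
have Vcvg d : good_pt d -> V d h @[h --> 0^'+] --> kinked d + prim forcing 1.
  move=> [d01 ld].
  have -> : kinked d + prim forcing 1 = momentum d + (prim forcing 1 - prim forcing d).
    by rewrite /kinked; ring.
  by apply: cvgD; [apply: bump_cvg => //; exact: L1_momentum|apply: step_cvg => //; exact: L1_forcing].
move=> ga gb gc.
have -> : (fun h => first_variation (hat1 a b c h) (hat2 a b c h)) =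
   (fun h => (c - b) * V a h + (a - c) * V b h + (b - a) * V c h).
  apply/funext => h.
  have m d := L1_bump h d L1_momentum; have f d := L1_step h d L1_forcing.
  have mf d := L1D (m d) (f d).
  have VE d : V d h = \int[mu]_(x in oo01)
      (momentum x * bump_h h (x - d) + forcing x * step_h h (x - d)).
    by rewrite (Rintegral_ooD (m d) (f d)).
  have za := L1Z (c - b) (mf a); have zb := L1Z (a - c) (mf b).
  have zc := L1Z (b - a) (mf c).
  rewrite !VE; transitivity (\int[mu]_(x in oo01)
     (((c - b) * (momentum x * bump_h h (x - a) + forcing x * step_h h (x - a)) +
     (a - c) * (momentum x * bump_h h (x - b) + forcing x * step_h h (x - b))) +
     (b - a) * (momentum x * bump_h h (x - c) + forcing x * step_h h (x - c)))).
    by apply: eq_Rintegral => x _; rewrite /hat1 /hat2; ring.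
  rewrite (Rintegral_ooD (L1D za zb) zc) (Rintegral_ooD za zb).
  by rewrite (Rintegral_ooZ _ (mf a)) (Rintegral_ooZ _ (mf b)) (Rintegral_ooZ _ (mf c)).
have -> : (c - b) * kinked a + (a - c) * kinked b + (b - a) * kinked c =
  (c - b) * (kinked a + prim forcing 1) + (a - c) * (kinked b + prim forcing 1) +
  (b - a) * (kinked c + prim forcing 1) by ring.
by apply: cvgD; first apply: cvgD; apply: cvgM; [exact: cvg_cst|exact: Vcvg
  |exact: cvg_cst|exact: Vcvg|exact: cvg_cst|exact: Vcvg].
Qed.

(** Raising u keeps it above psi, so a nonnegative hat is an allowed direction wherever it sits. *)
Lemma kinked_convex a b c : good_pt a -> good_pt b -> good_pt c -> a <= b -> b <= c ->
  0 <= (c - b) * kinked a + (a - c) * kinked b + (b - a) * kinked c.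
Proof.
move=> ga gb gc ab bc; have L := hat_variation_cvg ga gb gc.
have [/andP[a0 _] _] := ga; have [/andP[_ c1] _] := gc.
rewrite -(cvg_lim (@Rhausdorff R) L); apply: limr_ge; first by apply/cvg_ex; eexists; exact: L.
near=> h.
have h0 : 0 < h by near: h; exact: nbhs_right_gt.
have ha : h < a by near: h; apply: nbhs_right_lt.
have hc : h < 1 - c by near: h; apply: nbhs_right_lt; rewrite subr_gt0.
have hN0 : h != 0 by rewrite gt_eqF.
have [k0 k1] : ~~ (a - h <= 0 <= c + h) /\ ~~ (a - h <= 1 <= c + h).
  by rewrite !negb_and -!ltNge; split; apply/orP; [left|right]; lra.
have [z0 z1] := hat_out h0 ab bc k0; have [z2 z3] := hat_out h0 ab bc k1.
apply: (variation_ge0 (hat_C2 a b c hN0) z0 z2 z1 z3 ltr01) => t x t0 _ x01.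
have [[_ _ uge] _] := u_min.
apply: le_trans (uge x x01) _; rewrite lerDl.
by apply: mulr_ge0; [exact: ltW|apply: addr_ge0; exact: hat_ge0].
Unshelve. all: by end_near. Qed.

(** Over a gap the hat may also be subtracted: on its compact support u - psi has a positive
    minimum, so small multiples stay admissible and the inequality reverses. *)
Lemma kinked_affine a b c (l r : R) : 0 <= l -> r <= 1 ->
  (forall x, l < x < r -> psi x < u x) -> l < a -> c < r ->
  good_pt a -> good_pt b -> good_pt c -> a <= b -> b <= c ->
  (c - b) * kinked a + (a - c) * kinked b + (b - a) * kinked c = 0.
Proof.
move=> l0 r1 gap la cr ga gb gc ab bc.
apply/eqP; rewrite eq_le kinked_convex// andbT.
have L := hat_variation_cvg ga gb gc.
have ac := le_trans ab bc.
rewrite -(cvg_lim (@Rhausdorff R) L); apply: limr_le; first by apply/cvg_ex; eexists; exact: L.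
near=> h.
have h0 : 0 < h by near: h; exact: nbhs_right_gt.
have ha : h < a - l by near: h; apply: nbhs_right_lt; rewrite subr_gt0.
have hc : h < r - c by near: h; apply: nbhs_right_lt; rewrite subr_gt0.
have hN0 : h != 0 by rewrite gt_eqF.
have [k0 k1] : ~~ (a - h <= 0 <= c + h) /\ ~~ (a - h <= 1 <= c + h).
  by rewrite !negb_and -!ltNge; split; apply/orP; [left|right]; lra.
have [z0 z1] := hat_out h0 ab bc k0; have [z2 z3] := hat_out h0 ab bc k1.
have C2 := hat_C2 a b c hN0; have [ch c1 _ _] := C2_fun_weak C2; have [_ _ c2] := C2.
have [[uH u_sym uge] _] := u_min; have [_ cu _ _] := uH.
have [M HM] := continuous_itv_bounded (continuous_subspaceT ch).
have J01 x : a - h <= x <= c + h -> 0 <= x <= 1 /\ l < x < r.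
  have la' : l < a - h by rewrite ltrBrDr -ltrBrDl.
  have cr' : c + h < r by rewrite -ltrBrDl.
  move=> /andP[xa xc]; rewrite (lt_le_trans la' xa) (le_lt_trans xc cr').
  by rewrite (le_trans l0 (ltW (lt_le_trans la' xa))) (le_trans (ltW (le_lt_trans xc cr'))).
have cJ : {within `[a - h, c + h], continuous (fun x => u x - psi x)}.
  have sub : `[a - h, c + h]%classic `<=` `[0, 1]%classic.
    by move=> x; rewrite /= !in_itv/= => /J01[].
  apply: (continuous_subspaceW sub) => x.
  by apply: cvgB; [exact: cu|exact: psi_cont].
have [|m mJ Hm] := EVT_min _ cJ; first lra.
have e0 : 0 < u m - psi m.
  by rewrite subr_gt0; apply: gap; move: mJ; rewrite in_itv/= => /J01[].
(* The symmetrised hat is at most 2 |M|, so t <= t0 lowers u by no more than the minimal gap; the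
   [+ 1] avoids division by 0. *)
pose t0 := (u m - psi m) / (2 * (`|M| + 1)).
have M1 : 0 < 2 * (`|M| + 1) by rewrite mulr_gt0// ltr_wpDl.
have t00 : 0 < t0 by rewrite divr_gt0.
have C2n := C2_funZ (-1) C2.
have := variation_ge0 C2n _ _ _ _ t00 _; rewrite z0 z1 z2 z3 !mulr0.
move=> /(_ erefl erefl erefl erefl) H.
have : 0 <= first_variation (fun x => -1 * hat1 a b c h x) (fun x => -1 * hat2 a b c h x).
  apply: H => t x tpos tt0 x01.
  have x01' := oo01_onem x01.
  have cc y : oo01 y -> 0 <= y <= 1 by move/oo_sub_cc; rewrite /= in_itv.
  have hM y : oo01 y -> hat a b c h y <= `|M|.
    by move=> y01; apply: le_trans (ler_norm _) _; apply: le_trans (HM y (cc y y01)) (ler_norm _).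
  have tM : t * (2 * (`|M| + 1)) <= u m - psi m by rewrite -ler_pdivlMr.
  have h1 := hM x x01; have h2 := hM (1 - x) x01'.
  have hx := hat_ge0 x h0 ab bc; have hx' := hat_ge0 (1 - x) h0 ab bc.
  have ux := uge x x01.
  have tot : t * (hat a b c h x + hat a b c h (1 - x)) <= u m - psi m.
    apply: le_trans (ler_wpM2l (ltW tpos) _) tM; rewrite mulr_natl mulr2n.
    by apply: lerD; [apply: le_trans h1 _|apply: le_trans h2 _]; rewrite lerDl.
  have -> : u x + t * (-1 * hat a b c h x + -1 * hat a b c h (1 - x)) =
    u x - t * (hat a b c h x + hat a b c h (1 - x)) by ring.
  case: (boolP (a - h <= x <= c + h)) => xJ.
    by have := Hm x; rewrite in_itv/= => /(_ xJ) mx; rewrite lerBrDr -lerBrDl (le_trans tot).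
  (* The reflected hat acts at x when 1 - x lies in the support; the symmetry of u and psi carries
     the gap over to x. *)
  case: (boolP (a - h <= 1 - x <= c + h)) => xJ'.
    have := Hm (1 - x); rewrite in_itv/= => /(_ xJ').
    by rewrite -(u_sym x x01) -(psi_sym x01) => mx; rewrite lerBrDr -lerBrDl (le_trans tot).
  have [-> _] := hat_out h0 ab bc xJ; have [-> _] := hat_out h0 ab bc xJ'.
  by rewrite addr0 mulr0 subr0.
have -> : first_variation (fun x => -1 * hat1 a b c h x) (fun x => -1 * hat2 a b c h x) =
   -1 * first_variation (hat1 a b c h) (hat2 a b c h).
  rewrite -Rintegral_ooZ; last exact: L1_variation.
  by apply: eq_Rintegral => x _; ring.
by rewrite mulN1r oppr_ge0.
Unshelve. all: by end_near. Qed.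

End EulerLagrange.

(** * From convexity on a set of full measure to the primitive of a bounded monotone function *)

Section MonotoneDensity.
Context {R : realType}.
Notation mu := (@lebesgue_measure R).
Implicit Types (f g F G m : R -> R) (E : set R) (x y z a b c d : R).

(** Otherwise ]l, r[ would lie in the null set where [E] fails. *)
Lemma ae_dense E l r : {ae mu, forall x, 0 < x < 1 -> E x} -> 0 <= l -> l < r -> r <= 1 ->
  exists2 x, l < x < r & E x.
Proof.
move=> [N [mN N0 EN]] l0 lr r1; apply: contrapT => H.
have sub : `]l, r[%classic `<=` N.
  move=> x; rewrite /= in_itv/= => /andP[lx xr]; apply: EN => /= xE.
  apply: H; exists x; first by rewrite lx.
  by apply: xE; apply/andP; split; lra.
have : (mu `]l, r[ <= mu N)%E by apply: le_measure; rewrite ?inE.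
by rewrite N0 lebesgue_measure_itv/= lte_fin lr -EFinB lee_fin leNgt subr_gt0 lr.
Qed.

(* Splitting an interval once improves the constant by the factor 2/3, because
   the increments of [m] add up; iterating gives 0. *)
Lemma increment_contraction E G m :
  (forall x y, E x -> E y -> x < y -> exists z,
     [/\ E z, x < z < y, z - x <= 2 / 3 * (y - x) & y - z <= 2 / 3 * (y - x)]) ->
  (forall x y, E x -> E y -> x < y -> `|G y - G x| <= (y - x) * (m y - m x)) ->
  forall x y, E x -> E y -> G x = G y.
Proof.
move=> dE H.
have mm x y : E x -> E y -> x < y -> m x <= m y.
  move=> Ex Ey xy; have := le_trans (normr_ge0 _) (H x y Ex Ey xy).
  by rewrite pmulr_rge0 ?subr_gt0// subr_ge0.
have Hn n : forall x y, E x -> E y -> x < y ->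
    `|G y - G x| <= (2 / 3) ^+ n * ((y - x) * (m y - m x)).
  elim: n => [|n IH] x y Ex Ey xy; first by rewrite expr0 mul1r; exact: H.
  have [z [Ez /andP[xz zy] zx yz]] := dE x y Ex Ey xy.
  have -> : G y - G x = (G y - G z) + (G z - G x) by ring.
  apply: le_trans (ler_normD _ _) _.
  apply: le_trans (lerD (IH z y Ez Ey zy) (IH x z Ex Ez xz)) _.
  rewrite -mulrDr exprSr -mulrA ler_wpM2l// ?exprn_ge0//.
  have a1 : (y - z) * (m y - m z) <= 2 / 3 * (y - x) * (m y - m z).
    by rewrite ler_wpM2r// subr_ge0 mm.
  have a2 : (z - x) * (m z - m x) <= 2 / 3 * (y - x) * (m z - m x).
    by rewrite ler_wpM2r// subr_ge0 mm.
  apply: le_trans (lerD a1 a2) _.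
  by rewrite -mulrDr le_eqVlt; apply/orP; left; apply/eqP; ring.
suff K x y : E x -> E y -> x < y -> G x = G y.
  by move=> x y Ex Ey; have [xy|xy|->//] := ltgtP x y; [|symmetry]; exact: K.
move=> Ex Ey xy; apply/eqP; rewrite eq_sym -subr_eq0 -normr_le0.
set C := (y - x) * (m y - m x).
have L : (fun n : nat => (2 / 3) ^+ n * C) @ \oo --> (0 : R).
  rewrite -[X in _ --> X](mul0r C); apply: cvgM; last exact: cvg_cst.
  by apply: cvg_expr; rewrite ger0_norm; lra.
rewrite -(cvg_lim (@Rhausdorff R) L); apply: limr_ge; first by apply/cvg_ex; exists 0.
by apply: nearW => n; exact: Hn.
Qed.

Lemma monotone_L1 m (M : R) : {homo m : x y / x <= y} -> (forall x, `|m x| <= M) -> L1 m.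
Proof.
move=> hm bm; apply: (@L1_bounded _ _ M) => //.
apply: nondecreasing_measurable; first exact: measurable_itv.
exact: hm.
Qed.

Lemma prim_increment f x y (k1 k2 : R) : L1 f -> 0 <= x -> x <= y -> y <= 1 ->
  (forall t, x < t <= y -> k1 <= f t <= k2) ->
  k1 * (y - x) <= prim f y - prim f x <= k2 * (y - x).
Proof.
move=> f1 x0 xy y1 H; have y0 := le_trans x0 xy.
have E (k : R) : prim (fun=> k) y - prim (fun=> k) x = k * (y - x).
  by rewrite !prim_cst// mulrBr.
rewrite -!E; apply/andP; split; apply: le_prim => //; try exact: L1_cst.
  by move=> t /H/andP[].
by move=> t /H/andP[].
Qed.

Section Slopes.
Context (E : set R) (F : R -> R) (d : R).
Context (E_ae : {ae mu, forall x, 0 < x < 1 -> E x}) (E01 : forall x, E x -> 0 < x < 1).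
Context (F_convex : forall a b c, E a -> E b -> E c -> a <= b -> b <= c ->
  0 <= (c - b) * F a + (a - c) * F b + (b - a) * F c).
Context (d_gt0 : 0 < d) (d_lt1 : d < 1).
Context (F_left : forall a b c, E a -> E b -> E c -> a <= b -> b <= c -> c < d ->
  (c - b) * F a + (a - c) * F b + (b - a) * F c = 0).
Context (F_right : forall a b c, E a -> E b -> E c -> a <= b -> b <= c -> 1 - d < a ->
  (c - b) * F a + (a - c) * F b + (b - a) * F c = 0).

Let s a b := (F b - F a) / (b - a).

Let sE a b : a < b -> s a b * (b - a) = F b - F a.
Proof. by move=> ab; rewrite divfK// subr_eq0 gt_eqF. Qed.

(** The right end is moved first, then the left end; each move is one three-point inequality. *)
Let s_mono a b a' b' : E a -> E b -> E a' -> E b' -> a < b -> a' < b' -> a <= a' -> b <= b' ->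
  s a b <= s a' b'.
Proof.
move=> Ea Eb Ea' Eb' ab ab' aa bb.
have ab2 : a < b' by exact: lt_le_trans ab bb.
have h1 : s a b <= s a b'.
  rewrite ler_pdivrMr ?subr_gt0// mulrAC ler_pdivlMr ?subr_gt0//.
  by have := F_convex Ea Eb Eb' (ltW ab) bb; lra.
apply: le_trans h1 _.
rewrite ler_pdivrMr ?subr_gt0// mulrAC ler_pdivlMr ?subr_gt0//.
by have := F_convex Ea Ea' Eb' aa (ltW ab'); lra.
Qed.

Let s_eq a b c : a < b -> b < c -> (c - b) * F a + (a - c) * F b + (b - a) * F c = 0 ->
  s a b = s b c.
Proof.
move=> ab bc H.
have [h1 h2] : b - a != 0 /\ c - b != 0 by rewrite !subr_eq0 !gt_eqF.
by apply/eqP; rewrite eqr_div//; apply/eqP; lra.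
Qed.

(** Chords near 0 all have the same slope, since F is affine there. One of them is taken left of
    both [a] and the reference chord, and monotonicity compares it with s a b. Convexity alone would
    give no lower bound. *)
Let left_slope : exists alpha, forall a b, E a -> E b -> a < b -> alpha <= s a b.
Proof.
have [e0 /andP[e00 e0d] Ee0] := ae_dense E_ae (lexx 0) d_gt0 (ltW d_lt1).
have [e1 /andP[e01 e1d] Ee1] := ae_dense E_ae (ltW e00) e0d (ltW d_lt1).
exists (s e0 e1) => a b Ea Eb ab; have /andP[a0 a1] := E01 Ea.
have m0 : 0 < Num.min a e0 by rewrite lt_min a0.
have m1 : Num.min a e0 <= 1 by rewrite ge_min ltW.
have [y /andP[y0]] := ae_dense E_ae (lexx 0) m0 m1; rewrite lt_min => /andP[ya ye] Ey.
have [x /andP[x0 xy] Ex] := ae_dense E_ae (lexx 0) y0 (ltW (lt_trans ya a1)).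
rewrite -(s_eq ye e01); last by apply: F_left => //; exact: ltW.
rewrite -(s_eq xy ye); last by apply: F_left => //; exact: ltW.
apply: s_mono => //; first exact: ltW (lt_trans xy ya).
exact: ltW (lt_trans ya ab).
Qed.

Let right_slope : exists beta, forall a b, E a -> E b -> a < b -> s a b <= beta.
Proof.
have d1 : 1 - d < 1 by rewrite gtrBl.
have d0 : 0 <= 1 - d by rewrite subr_ge0 ltW.
have [e1 /andP[e1d e11] Ee1] := ae_dense E_ae d0 d1 (lexx 1).
have [e0 /andP[e0d e01] Ee0] := ae_dense E_ae d0 e1d (ltW e11).
exists (s e0 e1) => a b Ea Eb ab; have /andP[b0 b1] := E01 Eb.
have m1 : Num.max b e1 < 1 by rewrite gt_max b1.
have m0 : 0 <= Num.max b e1 by rewrite le_max ltW.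
have [x /andP[]] := ae_dense E_ae m0 m1 (lexx 1); rewrite gt_max => /andP[bx ex] x1 Ex.
have [y /andP[xy y1] Ey] := ae_dense E_ae (ltW (lt_trans b0 bx)) x1 (lexx 1).
rewrite (s_eq e01 ex); last by apply: F_right => //; exact: ltW.
rewrite (s_eq ex xy); last by apply: F_right => //; exact: ltW.
apply: s_mono => //; first exact: ltW (lt_trans ab bx).
exact: ltW (lt_trans bx xy).
Qed.

Lemma convex_primitive : exists m (M k : R), [/\ {homo m : x y / x <= y},
  forall x, `|m x| <= M & forall x, E x -> F x = k + prim m x].
Proof.
have [al Hal] := left_slope; have [be Hbe] := right_slope.
have [e1 /andP[e10 e11] Ee1] := ae_dense E_ae (lexx 0) ltr01 (lexx 1).
have [e0 /andP[e00 e01] Ee0] := ae_dense E_ae (lexx 0) e10 (ltW e11).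
have albe : al <= be := le_trans (Hal e0 e1 Ee0 Ee1 e01) (Hbe e0 e1 Ee0 Ee1 e01).
(* The supremum of these slopes is the left derivative of F at points of (0,1); [al] is adjoined so
   that the set is nonempty for every real x. *)
pose S x := [set q | q = al \/ exists a b, [/\ E a, E b, a < b, b <= x & q = s a b]].
have Sub x : ubound (S x) be.
  by move=> q [->//|[a [b [Ea Eb ab _ ->]]]]; exact: Hbe.
have Sn x : S x !=set0 by exists al; left.
have Ss x : has_sup (S x) by split => //; exists be.
pose m x := sup (S x).
have m_ge x q : S x q -> q <= m x by move=> Sq; apply: ub_le_sup => //; exists be.
have m_le x q : ubound (S x) q -> m x <= q by move=> Uq; exact: ge_sup.
have m_homo : {homo m : x y / x <= y}.
  move=> x y xy; apply: m_le => q [->|[a [b [Ea Eb ab bx ->]]]]; apply: m_ge; first by left.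
  by right; exists a, b; split => //; exact: le_trans xy.
have m_al x : al <= m x by apply: m_ge; left.
have m_be x : m x <= be by exact: m_le.
have mM x : `|m x| <= `|al| + `|be|.
  rewrite ler_norml; have := m_al x; have := m_be x.
  have := ler_norm be; have := ler_norm (- al); rewrite normrN.
  by have := normr_ge0 al; have := normr_ge0 be; lra.
have m1 := monotone_L1 m_homo mM.
pose D x := F x - prim m x.
(* On [x, y] the chord slope of F and the mean of [m] both lie between m(x) and m(y), which bounds
   the increment of D as [increment_contraction] requires. *)
have Dcst : forall x y, E x -> E y -> D x = D y.
  apply: (@increment_contraction E D m).
    move=> x y Ex Ey xy; have /andP[x0 x1] := E01 Ex; have /andP[y0 y1] := E01 Ey.
    (* [E] need not contain the midpoint, so [z] is taken in the open middle third; both pieces then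
       have at most 2/3 of the length. *)
    have t1 : 0 <= (2 * x + y) / 3 by lra.
    have t2 : (2 * x + y) / 3 < (x + 2 * y) / 3 by lra.
    have t3 : (x + 2 * y) / 3 <= 1 by lra.
    have [z /andP[z1 z2] Ez] := ae_dense E_ae t1 t2 t3.
    by exists z; split => //; lra.
  move=> x y Ex Ey xy; have /andP[x0 x1] := E01 Ex; have /andP[y0 y1] := E01 Ey.
  have h1 : m x <= s x y.
    apply: m_le => q [->|[a [b [Ea Eb ab bx ->]]]]; first exact: Hal.
    by apply: s_mono => //; [exact: le_trans (ltW ab) bx|exact: le_trans bx (ltW xy)].
  have h2 : s x y <= m y by apply: m_ge; right; exists x, y.
  have /andP[h3 h4] : m x * (y - x) <= prim m y - prim m x <= m y * (y - x).
    apply: prim_increment => //; try exact: ltW.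
    by move=> t /andP[xt ty]; rewrite !m_homo// ltW.
  have h5 := sE xy.
  have yx : 0 < y - x by rewrite subr_gt0.
  have h6 : m x * (y - x) <= s x y * (y - x) by rewrite ler_wpM2r// ltW.
  have h7 : s x y * (y - x) <= m y * (y - x) by rewrite ler_wpM2r// ltW.
  rewrite /D ler_norml; rewrite h5 in h6 h7; apply/andP; split; lra.
exists m, (`|al| + `|be|), (D e0); split => // x Ex.
by rewrite (Dcst e0 x Ee0 Ex) /D subrK.
Qed.

End Slopes.
End MonotoneDensity.

(** * Functions of bounded variation and Lipschitz functions on [0,1] *)

Section BoundedVariation.
Context {R : realType}.
Notation mu := (@lebesgue_measure R).
Implicit Types (f g F G m : R -> R) (x y z a b c d L M : R).

(** Any such [m] is nondecreasing on [0,1]. A majorant is easier to carry through sums and products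
    than the total variation, which is bounded only at the end. *)
Definition bv g := exists m : R -> R, forall x y, 0 <= x -> x <= y -> y <= 1 ->
  `|g y - g x| <= m y - m x.

Definition lip g := exists L : R, forall x y, 0 <= x -> x <= y -> y <= 1 ->
  `|g y - g x| <= L * (y - x).

Lemma lip_bv g : lip g -> bv g.
Proof.
by move=> [L H]; exists (fun x => L * x) => x y x0 xy y1; rewrite -mulrBr; exact: H.
Qed.

Lemma bv_bounded g : bv g -> exists2 M : R, 0 <= M & forall x, 0 <= x <= 1 -> `|g x| <= M.
Proof.
move=> [m H]; exists (`|g 0| + (m 1 - m 0)).
  by rewrite addr_ge0// (le_trans (normr_ge0 _) (H 0 1 _ _ _)).
move=> x /andP[x0 x1]; have -> : g x = g 0 + (g x - g 0) by rewrite addrC subrK.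
apply: le_trans (ler_normD _ _) _; rewrite lerD2l (le_trans (H 0 x _ _ _))//.
by rewrite lerD2r -subr_ge0 (le_trans (normr_ge0 _) (H x 1 _ _ _)).
Qed.

Lemma lip_bounded g : lip g -> exists2 M : R, 0 <= M & forall x, 0 <= x <= 1 -> `|g x| <= M.
Proof. by move/lip_bv/bv_bounded. Qed.

Lemma normr_prod_diff (f1 f2 g1 g2 M1 M2 d1 d2 : R) : `|f2| <= M1 -> `|g1| <= M2 ->
  `|g2 - g1| <= d1 -> `|f2 - f1| <= d2 -> `|f2 * g2 - f1 * g1| <= M1 * d1 + M2 * d2.
Proof.
move=> h1 h2 h3 h4.
have -> : f2 * g2 - f1 * g1 = f2 * (g2 - g1) + g1 * (f2 - f1) by ring.
by apply: le_trans (ler_normD _ _) _; rewrite !normrM lerD// ler_pM.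
Qed.

Lemma bvM f g : bv f -> bv g -> bv (fun x => f x * g x).
Proof.
move=> Bf Bg; have [M1 M10 H1] := bv_bounded Bf; have [M2 M20 H2] := bv_bounded Bg.
have [m1 K1] := Bf; have [m2 K2] := Bg.
exists (fun x => M1 * m2 x + M2 * m1 x) => x y x0 xy y1.
have -> : M1 * m2 y + M2 * m1 y - (M1 * m2 x + M2 * m1 x) =
  M1 * (m2 y - m2 x) + M2 * (m1 y - m1 x) by ring.
apply: normr_prod_diff; [apply: H1|apply: H2|exact: K2|exact: K1].
  by rewrite (le_trans x0 xy).
by rewrite x0 (le_trans xy).
Qed.

Lemma bvD f g : bv f -> bv g -> bv (fun x => f x + g x).
Proof.
move=> [m1 K1] [m2 K2]; exists (fun x => m1 x + m2 x) => x y x0 xy y1.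
have -> : f y + g y - (f x + g x) = (f y - f x) + (g y - g x) by ring.
apply: le_trans (ler_normD _ _) _.
by apply: le_trans (lerD (K1 _ _ x0 xy y1) (K2 _ _ x0 xy y1)) _; lra.
Qed.

Lemma lipM f g : lip f -> lip g -> lip (fun x => f x * g x).
Proof.
move=> Bf Bg; have [M1 M10 H1] := lip_bounded Bf; have [M2 M20 H2] := lip_bounded Bg.
have [L1 K1] := Bf; have [L2 K2] := Bg.
exists (M1 * L2 + M2 * L1) => x y x0 xy y1; rewrite mulrDl -!mulrA.
apply: normr_prod_diff; [apply: H1|apply: H2|exact: K2|exact: K1].
  by rewrite (le_trans x0 xy).
by rewrite x0 (le_trans xy).
Qed.

Lemma lipD f g : lip f -> lip g -> lip (fun x => f x + g x).
Proof.
move=> [L1 K1] [L2 K2]; exists (L1 + L2) => x y x0 xy y1; rewrite mulrDl.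
have -> : f y + g y - (f x + g x) = (f y - f x) + (g y - g x) by ring.
apply: le_trans (ler_normD _ _) _.
exact: lerD (K1 _ _ x0 xy y1) (K2 _ _ x0 xy y1).
Qed.

Lemma lip_cst c : lip (fun=> c).
Proof. by exists 0 => x y _ _ _; rewrite subrr normr0 mul0r. Qed.

Lemma lipX f n : lip f -> lip (fun x => f x ^+ n).
Proof.
move=> lf; elim: n => [|n IH].
  by under eq_fun do rewrite expr0; exact: lip_cst.
by under eq_fun do rewrite exprS; exact: lipM.
Qed.

Lemma lip_comp f F (L : R) : 0 <= L -> (forall x y, `|F y - F x| <= L * `|y - x|) -> lip f ->
  lip (fun x => F (f x)).
Proof.
move=> L0 HF [K HK]; exists (L * K) => x y x0 xy y1.
by apply: le_trans (HF _ _) _; rewrite -mulrA ler_wpM2l// HK.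
Qed.

Lemma eq_lip f g : (forall x, 0 <= x <= 1 -> f x = g x) -> lip f -> lip g.
Proof.
move=> fg [L H]; exists L => x y x0 xy y1; rewrite -!fg ?H//.
  by rewrite x0 (le_trans xy).
by rewrite (le_trans x0 xy).
Qed.

Lemma lip_prim f M : L1 f -> (forall x, 0 <= x <= 1 -> `|f x| <= M) -> lip (prim f).
Proof.
move=> f1 fM; exists M => x y x0 xy y1.
have /andP[h1 h2] : - M * (y - x) <= prim f y - prim f x <= M * (y - x).
  apply: prim_increment => // t /andP[xt ty].
  by rewrite -ler_norml fM// (le_trans x0 (ltW xt)) (le_trans ty).
by rewrite ler_norml -mulNr h1.
Qed.

(** Measurability holds because g is the difference of g + m and m, both nondecreasing on [0,1]. *)
Lemma bv_L1 g : bv g -> L1 g.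
Proof.
move=> Bg; have [M _ gM] := bv_bounded Bg; have [m H] := Bg.
apply: L1_bounded gM.
have mcc : measurable (cc01 : set R) by exact: measurable_itv.
have nd f : (forall x y, 0 <= x -> x <= y -> y <= 1 -> f x <= f y) ->
    measurable_fun (cc01 : set R) f.
  (* Composition with the clamp turns monotonicity on [0,1] into monotonicity on all of R. *)
  move=> hf; pose clamp x : R := Num.max 0 (Num.min x 1).
  have cl x : 0 <= clamp x <= 1 by rewrite /clamp le_max lexx/= ge_max ler01 ge_min lexx orbT.
  have ch x y : x <= y -> clamp x <= clamp y.
    move=> xy; rewrite /clamp ge_max le_max lexx/= le_max; apply/orP; right.
    by rewrite le_min !ge_min xy lexx orbT.
  apply: (@eq_measurable_fun _ _ _ _ _ (fun x => f (clamp x))).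
    move=> x; rewrite inE /cc01 /= in_itv/= => /andP[x0 x1].
    by rewrite /clamp min_l// max_r.
  apply: nondecreasing_measurable => // x y xy.
  have /andP[a1 _] := cl x; have /andP[_ a2] := cl y.
  by apply: hf => //; exact: ch.
have -> : g = (fun x => (g x + m x) - m x) by apply/funext => x; rewrite addrK.
apply: measurable_funB; apply: nd => x y x0 xy y1.
  have := H x y x0 xy y1; rewrite ler_norml => /andP[h _]; lra.
by rewrite -subr_ge0; apply: le_trans (H x y x0 xy y1).
Qed.

Lemma lip_continuous g : lip g -> {within `[0, 1], continuous g}.
Proof.
move=> [L H].
have L0 : 0 <= L by have := le_trans (normr_ge0 _) (H 0 1 _ _ _); rewrite subr0 mulr1; exact.
have K x y : 0 <= x <= 1 -> 0 <= y <= 1 -> `|g x - g y| <= (L + 1) * `|x - y|.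
  move=> /andP[x0 x1] /andP[y0 y1]; have [xy|/ltW yx] := leP x y.
    rewrite distrC [`|x - y|]distrC (ger0_norm (x := y - x)) ?subr_ge0//.
    by apply: le_trans (H x y x0 xy y1) _; rewrite ler_wpM2r ?subr_ge0// lerDl.
  rewrite (ger0_norm (x := x - y)) ?subr_ge0//.
  by apply: le_trans (H y x y0 yx x1) _; rewrite ler_wpM2r ?subr_ge0// lerDl.
apply/subspace_continuousP => x; rewrite /= in_itv/= => x01.
have L1p : 0 < L + 1 by rewrite ltr_wpDl.
apply/cvgrPdist_le => e e0; near=> y.
have y01 : 0 <= y <= 1.
  have : `[0, 1]%classic y by near: y; exact: withinT.
  by rewrite /= in_itv.
apply: le_trans (K x y x01 y01) _.
rewrite mulrC -ler_pdivlMr//; near: y.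
have : \forall y \near x, `|x - y| <= e / (L + 1).
  have e' : 0 < e / (L + 1) by rewrite divr_gt0.
  exists (e / (L + 1)) => // y /=; exact: ltW.
by rewrite near_withinE; apply: filterS => y h _.
Unshelve. all: by end_near. Qed.

(** For each factor f(y) - f(x) equals g(x) (y - x) up to y - x times an increment of a majorant of
    g, and likewise for the primitive of [h]. The difference of the two sides thus satisfies
    [increment_contraction], even where [g1] and [g2] jump. *)
Lemma bv_product_rule f1 g1 f2 g2 (k1 k2 : R) : bv g1 -> bv g2 ->
  (forall x, 0 <= x <= 1 -> f1 x = k1 + prim g1 x) ->
  (forall x, 0 <= x <= 1 -> f2 x = k2 + prim g2 x) ->
  forall x, 0 <= x <= 1 ->
  f1 x * f2 x = f1 0 * f2 0 + prim (fun t => g1 t * f2 t + f1 t * g2 t) x.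
Proof.
move=> B1 B2 E1 E2.
have lipf f g k : bv g -> (forall x, 0 <= x <= 1 -> f x = k + prim g x) -> lip f.
  move=> B E; have [M _ gM] := bv_bounded B.
  apply: (@eq_lip (fun x => k + prim g x)); first by move=> x /E.
  by apply: lipD; [exact: lip_cst|exact: lip_prim (bv_L1 B) gM].
have l1 := lipf _ _ _ B1 E1; have l2 := lipf _ _ _ B2 E2.
set h := fun t => g1 t * f2 t + f1 t * g2 t.
have Bh : bv h by apply: bvD; apply: bvM => //; exact: lip_bv.
have [m1 H1] := B1; have [m2 H2] := B2; have [mh Hh] := Bh.
have [C1 C10 HC1] := lip_bounded l1; have [C2 C20 HC2] := lip_bounded l2.
have [D1 D10 HD1] := bv_bounded B1; have [LL HL] := l2.
have first_order f g k m : bv g -> (forall x, 0 <= x <= 1 -> f x = k + prim g x) ->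
    (forall x y, 0 <= x -> x <= y -> y <= 1 -> `|g y - g x| <= m y - m x) ->
    forall x y, 0 <= x -> x <= y -> y <= 1 ->
    `|f y - f x - g x * (y - x)| <= (y - x) * (m y - m x).
  move=> B E H x y x0 xy y1; rewrite !E ?x0 ?y1 ?(le_trans x0 xy) ?(le_trans xy)//.
  have -> : k + prim g y - (k + prim g x) - g x * (y - x) = prim g y - prim g x - g x * (y - x) by ring.
  have /andP[h1 h2] : (g x - (m y - m x)) * (y - x) <= prim g y - prim g x <=
      (g x + (m y - m x)) * (y - x).
    apply: prim_increment => //; first exact: bv_L1.
    move=> t /andP[xt ty]; have := H x t x0 (ltW xt) (le_trans ty y1).
    have := le_trans (normr_ge0 _) (H t y (le_trans x0 (ltW xt)) ty y1).
    by rewrite ler_norml => ? /andP[? ?]; apply/andP; split; lra.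
  by rewrite ler_norml; apply/andP; split; lra.
pose D x := f1 x * f2 x - prim h x.
(* [m1] and [m2] absorb the first-order errors of the factors, the linear term the mixed product
   g1(x) (f2(y) - f2(x)), and [mh] the error of [prim h]. *)
pose m x := C2 * m1 x + C1 * m2 x + D1 * `|LL| * x + mh x.
have Dc : forall x y, 0 <= x <= 1 -> 0 <= y <= 1 -> D x = D y.
  apply: (@increment_contraction R [set x | 0 <= x <= 1] D m).
    move=> x y /= /andP[x0 x1] /andP[y0 y1] xy.
    by clear -x0 x1 y0 y1 xy; exists ((x + y) / 2); split; try (apply/andP; split); lra.
  move=> x y /= /andP[x0 x1] /andP[y0 y1] xy; have xy' := ltW xy.
  have a1 := first_order _ _ _ _ B1 E1 H1 x y x0 xy' y1.
  have a2 := first_order _ _ _ _ B2 E2 H2 x y x0 xy' y1.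
  have a3 := first_order _ _ 0 _ Bh (fun x _ => esym (add0r (prim h x))) Hh x y x0 xy' y1.
  have a4 := HL x y x0 xy' y1.
  have x01 : 0 <= x <= 1 by rewrite x0.
  have y01 : 0 <= y <= 1 by rewrite y0.
  have b1 := HC1 x x01; have b2 := HC2 y y01; have b3 := HD1 x x01.
  have -> : D y - D x = f2 y * (f1 y - f1 x - g1 x * (y - x)) +
     f1 x * (f2 y - f2 x - g2 x * (y - x)) + (y - x) * (g1 x * (f2 y - f2 x)) -
     (prim h y - prim h x - h x * (y - x)) by rewrite /D /h; ring.
  have -> : (y - x) * (m y - m x) = C2 * ((y - x) * (m1 y - m1 x)) +
     C1 * ((y - x) * (m2 y - m2 x)) + (y - x) * (D1 * (`|LL| * (y - x))) + (y - x) * (mh y - mh x).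
    by rewrite /m; ring.
  apply: le_trans (ler_normB _ _) _; apply: lerD => //.
  apply: le_trans (ler_normD _ _) _; apply: lerD.
    by apply: le_trans (ler_normD _ _) _; rewrite !normrM lerD// ler_pM.
  rewrite !normrM (ger0_norm (x := y - x)) ?subr_ge0// ler_wpM2l ?subr_ge0// ler_pM//.
  by apply: le_trans a4 _; rewrite ler_wpM2r ?subr_ge0// ler_norm.
move=> x x01; have := Dc x 0 x01 _; rewrite lexx ler01 => /(_ isT).
by rewrite /D prim0 subr0 => /eqP; rewrite subr_eq => /eqP.
Qed.

(** Along every partition of [a, b] the majorant varies by m(b) - m(a), at most m(1) - m(0) whatever
    a and b are. *)
Lemma bv_total_variation g : bv g -> exists M : R, forall a b, 0 < a -> a <= b -> b < 1 ->
  (total_variation a b g <= M%:E)%E.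
Proof.
move=> [m H]; exists (m 1 - m 0) => a b a0 ab b1.
have mono x y : 0 <= x -> x <= y -> y <= 1 -> m x <= m y.
  by move=> x0 xy y1; rewrite -subr_ge0; exact: le_trans (H x y x0 xy y1).
apply: ub_ereal_sup => _ [v [s abs <-] <-]; rewrite lee_fin.
have ndm : {in `[a, b] &, nondecreasing_fun m}.
  move=> x y; rewrite !in_itv/= => /andP[ax _] /andP[_ yb] xy.
  by apply: mono => //; [exact: le_trans (ltW a0) ax|exact: le_trans yb (ltW b1)].
apply: (@le_trans _ _ (variation a b m s)); last first.
  rewrite (nondecreasing_variation ndm abs); apply: lerB; apply: mono => //.
  - exact: le_trans (ltW a0) ab.
  - exact: ltW.
  - exact: ltW.
  - exact: le_trans ab (ltW b1).
have H' x y : a <= x <= b -> a <= y <= b -> `|g y - g x| <= `|m y - m x|.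
  move=> /andP[ax xb] /andP[ay yb].
  have [xy|/ltW xy] := leP x y.
    apply: le_trans (H x y _ xy _) (ler_norm _).
      exact: le_trans (ltW a0) ax.
    exact: le_trans yb (ltW b1).
  rewrite distrC [`|m y - m x|]distrC; apply: le_trans (H y x _ xy _) (ler_norm _).
    exact: le_trans (ltW a0) ay.
  exact: le_trans xb (ltW b1).
rewrite /variation !big_nat; apply: ler_sum => i /andP[_ is_].
apply: H'.
  by rewrite itv_partition_nth_ge ?itv_partition_nth_le// ltnS ltnW.
by rewrite itv_partition_nth_ge ?itv_partition_nth_le.
Qed.

Lemma C1_lip f g : (forall x : R, is_derive x 1 f (g x)) -> continuous g -> lip f.
Proof.
move=> df cg; have [M gM] := continuous_itv_bounded (continuous_subspaceT cg).
have cf : continuous f by move=> x; exact: is_derive_cont (df x).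
exists M => x y x0 xy y1.
have [c + ->] := MVT_segment xy (fun z _ => df z) (continuous_subspaceT cf).
rewrite in_itv/= => /andP[xc cy]; rewrite normrM (ger0_norm (x := y - x)) ?subr_ge0//.
by rewrite ler_wpM2r ?subr_ge0// gM// (le_trans x0 xc) (le_trans cy).
Qed.

(** The product rule with [phi], evaluated at 1 where [phi] vanishes, is integration by parts. *)
Lemma bv_weak_derivative f g (k : R) : bv g -> (forall x, 0 <= x <= 1 -> f x = k + prim g x) ->
  is_weak_derivative f g.
Proof.
move=> Bg E.
have g1 := bv_L1 Bg.
have lf : lip f.
  have [M _ gM] := bv_bounded Bg.
  apply: (@eq_lip (fun x => k + prim g x)); first by move=> x /E.
  by apply: lipD; [exact: lip_cst|exact: lip_prim gM].
have f1 : L1 f by exact/L1_continuous/lip_continuous.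
split; [exact: L1_locally|exact: L1_locally|] => phi t.
have [sp _] := t; have [t0 t1] := test_function_ends t.
have sd := smooth_derive1 sp.
have dphi x := smooth_is_derive x sp.
have Bd : bv (derive1 phi).
  apply/lip_bv/(@C1_lip _ (derive1 (derive1 phi))) => [x|].
    exact: smooth_is_derive.
  exact/smooth_continuous/smooth_derive1.
have Ep x : 0 <= x <= 1 -> phi x = 0 + prim (derive1 phi) x.
  move=> /andP[x0 x1].
  have := @prim_FTC2 R _ _ 0 x dphi (smooth_continuous sd) (lexx 0) x0 x1.
  by rewrite prim0 subr0 t0 subr0 add0r.
have := bv_product_rule Bg Bd E Ep (x := 1); rewrite t0 t1 !mulr0 add0r ler01 lexx => /(_ isT) e.
have [fp fdp] := test_function_L1M f1 t; have [gp _] := test_function_L1M g1 t.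
apply/eqP; rewrite -subr_eq0 opprK addrC -RintegralD; last 3 first.
- exact: measurable_oo01.
- exact: L1_oo.
- exact: L1_oo.
by rewrite Rintegral_oo01; [rewrite -e|exact: L1D].
Qed.

End BoundedVariation.

(** * Regularity of the second derivative *)

Section Regularity.
Context {R : realType}.
Notation mu := (@lebesgue_measure R).
Implicit Types (f g : R -> R) (x y z a b c d : R).

Lemma prim_FTC2_within f g : {within `[0, 1], continuous f} -> {within `[0, 1], continuous g} ->
  (forall x, 0 < x < 1 -> is_derive x 1 f (g x)) ->
  forall x, 0 <= x <= 1 -> f x = f 0 + prim g x.
Proof.
move=> cf cg df x /andP[x0 x1].
move: x0; rewrite le_eqVlt => /predU1P[<-|x0]; first by rewrite prim0 addr0.
have sub : `[0, x]%classic `<=` `[0, 1]%classic.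
  by apply: subset_itvl; rewrite bnd_simp.
have cfx := continuous_subspaceW sub cf; have cgx := continuous_subspaceW sub cg.
have e := @continuous_FTC2 R g f 0 x x0 cgx; rewrite /prim /Rintegral e /=; last 2 first.
- move: cfx; rewrite continuous_within_itvP// => -[_ h1 h2].
  split => // y; rewrite in_itv/= => /andP[y0 yx].
  by have [] : is_derive y 1 f (g y) by apply: df; rewrite y0 (lt_le_trans yx).
- move=> y; rewrite in_itv/= => /andP[y0 yx]; apply: is_derive_derive1.
  by apply: df; rewrite y0 (lt_le_trans yx).
by rewrite [RHS]addrC subrK.
Qed.

Lemma eq_is_derive_oo f g x d : (forall y, 0 < y < 1 -> f y = g y) -> 0 < x < 1 ->
  is_derive x 1 f d -> is_derive x 1 g d.
Proof.
move=> fg x01; apply: (@near_is_derive _ _ _ _ _ `]0, 1[%classic).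
- exact: interval_open.
- by rewrite /= in_itv.
- by move=> y; rewrite /= in_itv/=; exact: fg.
Qed.

Context (u p w m : R -> R) (Mm k : R).
Context (cp : {within `[0, 1], continuous p}) (w1 : L1 w) (w2 : L1 (fun x => w x ^+ 2)).
Context (uE : forall x, 0 <= x <= 1 -> u x = prim p x).
Context (pE : forall x, 0 <= x <= 1 -> p x = prim w x).
Context (m_homo : {homo m : x y / x <= y}) (m_bd : forall x, `|m x| <= Mm).
Context (kE : forall x, good_pt p w x -> kinked p w x = k + prim m x).

(* [tension] is the continuous representative of A, and [curv] that of w. *)
Definition tension x : R := k + prim m x + prim (forcing p w) x.
Definition curv x : R := tension x * (arcl (p x) ^+ 5 / 2).
(** The continuous representative of [forcing]; through it the primitive of [forcing] is
    differentiable at every interior point. *)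
Definition reg_forcing x : R := curv x ^+ 2 * ddens (p x).

(** At a good point [tension] is [momentum] itself, and division by twice the positive weight
    recovers w. *)
Lemma curv_ae : {ae mu, forall x, oo01 x -> w x = curv x}.
Proof.
apply: ae_imply (good_pt_ae cp w1) => x H /oo01E /H /kE e.
rewrite /curv /tension -e /kinked subrK /momentum /dens /iarcl exprVn.
by field; exact: arcl_neq0.
Qed.

Lemma L1_m : L1 m. Proof. exact: monotone_L1 m_homo m_bd. Qed.

Lemma curv_continuous : {within `[0, 1], continuous curv}.
Proof.
have cQ : {within `[0, 1], continuous tension}.
  apply: within_ccD; last exact: prim_continuous (L1_forcing cp w2).
  apply: within_ccD; last exact: prim_continuous L1_m.
  exact/continuous_subspaceT/cst_continuous.
have cK : {within `[0, 1], continuous (fun x => arcl (p x) ^+ 5 / 2)}.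
  apply: (@within_cc_comp R p (fun q => arcl q ^+ 5 / 2)) => // q.
  apply: cvgM; last exact: cvg_cst.
  exact: (@continuous_comp _ _ _ arcl (fun y => y ^+ 5) q (@arcl_continuous R q) (@expn_continuous R 5 _)).
by move=> x; apply: cvgM; [exact: cQ|exact: cK].
Qed.

Lemma L1_curv : L1 curv. Proof. exact/L1_continuous/curv_continuous. Qed.

Lemma slope_prim_curv x : 0 <= x <= 1 -> p x = prim curv x.
Proof. by move=> x01; rewrite pE//; exact: prim_ae w1 L1_curv x01 curv_ae. Qed.

Lemma reg_forcing_continuous : {within `[0, 1], continuous reg_forcing}.
Proof.
have c1 := within_cc_comp (@expn_continuous R 2) curv_continuous.
have c2 := within_cc_comp (@ddens_continuous R) cp.
by move=> x; apply: cvgM; [exact: c1|exact: c2].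
Qed.

Lemma prim_forcing x : 0 <= x <= 1 -> prim (forcing p w) x = prim reg_forcing x.
Proof.
move=> x01; apply: prim_ae => //; first exact: L1_forcing.
  exact/L1_continuous/reg_forcing_continuous.
by apply: ae_imply curv_ae => t h t01; rewrite /forcing h.
Qed.

Lemma is_derive_slope x : 0 < x < 1 -> is_derive x 1 p (curv x).
Proof.
move=> x01; apply: (@eq_is_derive_oo (prim curv)) => //.
  by move=> y /andP[y0 y1]; rewrite slope_prim_curv// !ltW.
exact: is_derive_prim L1_curv x01 (within_cc_oo curv_continuous x01).
Qed.

Lemma is_derive_height x : 0 < x < 1 -> is_derive x 1 u (p x).
Proof.
move=> x01; apply: (@eq_is_derive_oo (prim p)) => //.
  by move=> y /andP[y0 y1]; rewrite uE// !ltW.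
exact: is_derive_prim (L1_continuous cp) x01 (within_cc_oo cp x01).
Qed.

Lemma is_derive_prim_forcing x : 0 < x < 1 ->
  is_derive x 1 (prim (forcing p w)) (reg_forcing x).
Proof.
move=> x01; apply: (@eq_is_derive_oo (prim reg_forcing)) => //.
  by move=> y /andP[y0 y1]; rewrite prim_forcing// !ltW.
have c := reg_forcing_continuous.
exact: is_derive_prim (L1_continuous c) x01 (within_cc_oo c x01).
Qed.

Lemma is_derive_arcl_slope x : 0 < x < 1 ->
  is_derive x 1 (fun y => arcl (p y)) (p x * iarcl (p x) * curv x).
Proof.
by move=> x01; exact: is_derive_chain (is_derive_arcl _) (is_derive_slope x01).
Qed.

Lemma arcl_lipschitz x y : `|arcl y - arcl x| <= 1 * `|y - x|.
Proof. by apply: (lipschitz_MVT (@is_derive_arcl R)) => q; exact: mul_iarcl. Qed.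

Lemma iarcl_lipschitz x y : `|iarcl y - iarcl x| <= 1 * `|y - x|.
Proof.
apply: (lipschitz_MVT (@is_derive_iarcl R)) => q.
have -> : - (q * iarcl q ^+ 3) = - ((q * iarcl q) * iarcl q ^+ 2) by ring.
rewrite normrN normrM -[1]mulr1; apply: ler_pM => //; first exact: mul_iarcl.
have /andP[h0 h1] := @iarcl_exp_itv R 2 q.
by rewrite ger0_norm.
Qed.

Lemma lip_slope : lip p.
Proof.
have [M HM] := continuous_itv_bounded curv_continuous.
apply: (eq_lip _ (lip_prim L1_curv HM)) => x x01; exact/esym/slope_prim_curv.
Qed.

Lemma lip_tension : lip tension.
Proof.
have c := reg_forcing_continuous; have [M HM] := continuous_itv_bounded c.
apply: lipD; last first.
  apply: (eq_lip _ (lip_prim (L1_continuous c) HM)) => x x01; exact/esym/prim_forcing.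
by apply: lipD; [exact: lip_cst|exact: lip_prim L1_m (fun x _ => m_bd x)].
Qed.

Lemma lip_arcl_slope : lip (fun x => arcl (p x)).
Proof. exact: lip_comp ler01 arcl_lipschitz lip_slope. Qed.

Lemma lip_iarcl_slope : lip (fun x => iarcl (p x)).
Proof. exact: lip_comp ler01 iarcl_lipschitz lip_slope. Qed.

(** Continuity on [0,1] bounds [curv], which makes the slope and the primitive of the forcing
    Lipschitz; the primitive of [m] is Lipschitz because [m] is bounded. *)
Lemma lip_curv : lip curv.
Proof.
apply: lipM; first exact: lip_tension.
by apply: lipM; [exact: lipX lip_arcl_slope|exact: lip_cst].
Qed.

Lemma lip_reg_forcing : lip reg_forcing.
Proof.
apply: lipM; first exact: lipX lip_curv.
apply: lipM; last exact: lipX lip_iarcl_slope.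
by apply: lipM; [exact: lip_cst|exact: lip_slope].
Qed.

Definition stiffness x : R := arcl (p x) ^+ 5 / 2.
Definition dstiffness x : R :=
  5 / 2 * arcl (p x) ^+ 4 * (p x * iarcl (p x) * curv x).

Lemma lip_dstiffness : lip dstiffness.
Proof.
apply: lipM; first by apply: lipM; [exact: lip_cst|exact: lipX lip_arcl_slope].
by apply: lipM; [apply: lipM; [exact: lip_slope|exact: lip_iarcl_slope]|exact: lip_curv].
Qed.

(** The product rule for [tension] times [stiffness]. All ingredients but [m] are Lipschitz, so a
    jump of u''' can only come from one of [m]. *)
Definition dcurv x : R :=
  (m x + reg_forcing x) * stiffness x + tension x * dstiffness x.

Lemma lip_stiffness : lip stiffness.
Proof. by apply: lipM; [exact: lipX lip_arcl_slope|exact: lip_cst]. Qed.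

Lemma bv_m : bv m.
Proof.
exists m => x y _ xy _; rewrite ger0_norm// subr_ge0; exact: m_homo.
Qed.

Lemma bv_dcurv : bv dcurv.
Proof.
apply: bvD; apply: bvM.
- by apply: bvD; [exact: bv_m|exact/lip_bv/lip_reg_forcing].
- exact/lip_bv/lip_stiffness.
- exact/lip_bv/lip_tension.
- exact/lip_bv/lip_dstiffness.
Qed.

Lemma curv_prim x : 0 <= x <= 1 -> curv x = curv 0 + prim dcurv x.
Proof.
apply: (@bv_product_rule R tension (fun x => m x + reg_forcing x) stiffness dstiffness k (stiffness 0)).
- by apply: bvD; [exact: bv_m|exact/lip_bv/lip_reg_forcing].
- exact/lip_bv/lip_dstiffness.
- move=> y y01; rewrite primD//; [|exact: L1_m|exact/L1_continuous/reg_forcing_continuous].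
  by rewrite /tension prim_forcing// addrA.
- apply: prim_FTC2_within; [exact/lip_continuous/lip_stiffness|exact/lip_continuous/lip_dstiffness|].
  move=> y y01; rewrite /stiffness.
  under eq_fun do rewrite mulrC.
  apply: (is_derive_eq (is_derive_scal 2^-1 (is_derive_pow 5 (is_derive_arcl_slope y01)))).
  by rewrite /dstiffness /=; ring.
Qed.

Lemma derive1n2_height x : oo01 x -> derive1n 2 u x = curv x.
Proof.
move=> /oo01E x01; rewrite derive1nS derive1n1; apply: is_derive_derive1.
apply: (@eq_is_derive_oo p) => //; last exact: is_derive_slope.
by move=> y y01; rewrite (is_derive_derive1 (is_derive_height y01)).
Qed.

Lemma Ck01_height : {within cc01, continuous u} -> Ck01 2 u.
Proof.
move=> cu; split; first exact: cu.
exists p; first by move=> x /oo01E; exact: is_derive_height.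
split; first exact: cp.
exists curv; first by move=> x /oo01E; exact: is_derive_slope.
by split; first exact: curv_continuous.
Qed.

Lemma weak_derivative_curv : is_weak_derivative (derive1n 2 u) dcurv.
Proof.
have [lc ld H] := bv_weak_derivative bv_dcurv curv_prim.
have mW : measurable_fun (oo01 : set R) curv by case: lc.
apply: (@is_weak_derivative_ae R curv (derive1n 2 u) dcurv dcurv).
- apply: (eq_measurable_fun curv) mW => x; rewrite inE => x01.
  by rewrite derive1n2_height.
- by case: ld.
- by apply: aeW => x x01; rewrite derive1n2_height.
- by apply: aeW => x.
- by split.
Qed.

(** [weak_derivative] picks an arbitrary representative, so the variation is bounded for [dcurv],
    and uniqueness, which rests on continuity of u'' in (0,1), identifies the two a.e. *)
Lemma BV01_weak_derivative_curv : BV01 (weak_derivative (derive1n 2 u)).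
Proof.
exists dcurv; last exact: bv_total_variation bv_dcurv.
apply: (@weak_derivative_unique R (derive1n 2 u)).
- move=> x x01; have /oo01E x01' := x01.
  have := within_cc_oo curv_continuous x01'; rewrite /prop_for /continuous_at derive1n2_height//.
  apply: cvg_trans; apply: near_eq_cvg.
  have : open_nbhs x `]0, 1[%classic by split; [exact: interval_open|].
  by move/open_nbhs_nbhs; apply: filterS => y /derive1n2_height.
- exact: weak_derivativeP weak_derivative_curv.
- exact: weak_derivative_curv.
Qed.

(** Once the convex part is affine, [tension] has derivative al + [reg_forcing], a polynomial in the
    generators, and [curv] is a product of generators and constants. *)
Lemma smooth_affine (l r al ga : R) : 0 <= l -> r <= 1 ->
  (forall x, l < x < r -> k + prim m x = ga + al * x) ->
  smooth_on `]l, r[%classic u.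
Proof.
move=> l0 r1 aff.
pose G f := [\/ f = u, f = p, f = tension | f = (fun x => arcl (p x)) \/ f = (fun x => iarcl (p x))].
have gp : gen_ring G p by apply: gen_ring_base; constructor 2.
have gt_ : gen_ring G tension by apply: gen_ring_base; constructor 3.
have gs : gen_ring G (fun x => arcl (p x)) by apply: gen_ring_base; constructor 4; left.
have gr : gen_ring G (fun x => iarcl (p x)) by apply: gen_ring_base; constructor 4; right.
have gc c : gen_ring G (fun=> c) by exact: gen_ring_cst.
have gW : gen_ring G curv.
  exact: gen_ring_mul gt_ (gen_ring_mul (gen_ring_exp 5 gs) (gc _)).
have I01 x : `]l, r[%classic x -> 0 < x < 1 /\ l < x < r.
  by rewrite /= in_itv/= => /andP[lx xr]; split; apply/andP; split; lra.
apply: (@gen_ring_smooth R _ G); first exact: interval_open; last first.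
  by apply: gen_ring_base; constructor 1.
move=> f [->|->|->|[->|->]].
- by exists p => // x /I01[x01 _]; exact: is_derive_height.
- by exists curv => // x /I01[x01 _]; exact: is_derive_slope.
- exists (fun x => al + reg_forcing x).
    apply: gen_ring_add; first exact: gc.
    exact: gen_ring_mul (gen_ring_exp 2 gW) (gen_ring_mul (gen_ring_mul (gc _) gp) (gen_ring_exp 7 gr)).
  move=> x Ix; have [x01 xI] := I01 x Ix.
  apply: (@near_is_derive _ (fun y => (al * y + ga) + prim (forcing p w) y) _ _ _ `]l, r[%classic _ Ix).
  + exact: interval_open.
  + by move=> y /I01[_ yI]; rewrite /tension aff// [ga + _]addrC.
  + exact: is_derive_sum2 (is_derive_affine x al ga) (is_derive_prim_forcing x01).
- exists (fun x => p x * iarcl (p x) * curv x); first exact: gen_ring_mul (gen_ring_mul gp gr) gW.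
  by move=> x /I01[x01 _]; exact: is_derive_arcl_slope.
- exists (fun x => - (p x * iarcl (p x) ^+ 3) * curv x).
    exact: gen_ring_mul (gen_ring_opp (gen_ring_mul gp (gen_ring_exp 3 gr))) gW.
  by move=> x /I01[x01 _]; exact: is_derive_chain (is_derive_iarcl _) (is_derive_slope x01).
Qed.

End Regularity.

(** * From collinear triples to affine functions *)

Section Affine.
Context {R : realType}.
Notation mu := (@lebesgue_measure R).
Implicit Types (F h : R -> R) (E : set R) (x y a b c d l r : R).

(** Two fixed points of [E] determine the line; the third lies before, between or after them. *)
Lemma collinear_affine E F l r : {ae mu, forall x, 0 < x < 1 -> E x} ->
  0 <= l -> l < r -> r <= 1 ->
  (forall a b c, E a -> E b -> E c -> l < a -> a <= b -> b <= c -> c < r ->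
     (c - b) * F a + (a - c) * F b + (b - a) * F c = 0) ->
  exists al ga : R, forall x, E x -> l < x < r -> F x = ga + al * x.
Proof.
move=> Eae l0 lr r1 H.
have [e1 /andP[le1 e1r] Ee1] := ae_dense Eae l0 lr r1.
have [e0 /andP[le0 e01] Ee0] := ae_dense Eae l0 le1 (ltW (lt_le_trans e1r r1)).
have d0 : e1 - e0 != 0 by rewrite subr_eq0 gt_eqF.
pose al := (F e1 - F e0) / (e1 - e0).
exists al, (F e0 - al * e0) => x Ex /andP[lx xr].
suff K : (F x - F e0) * (e1 - e0) = (F e1 - F e0) * (x - e0).
  have -> : F x = F e0 + (F e1 - F e0) * (x - e0) / (e1 - e0) by rewrite -K mulfK// addrC subrK.
  by rewrite /al; field.
have [xe|ex] := leP x e0; first by have := H x e0 e1 Ex Ee0 Ee1 lx xe (ltW e01) e1r; lra.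
have [xe|xe] := leP x e1; first by have := H e0 x e1 Ee0 Ex Ee1 le0 (ltW ex) xe e1r; lra.
by have := H e0 e1 x Ee0 Ee1 Ex le0 (ltW e01) (ltW xe) xr; lra.
Qed.

(** If h(x) were nonzero, h would be nonzero just to the right of x, where [E] has a point. *)
Lemma dense_eq0 E h l r : {ae mu, forall x, 0 < x < 1 -> E x} ->
  0 <= l -> r <= 1 -> {within `[0, 1], continuous h} ->
  (forall x, E x -> l < x < r -> h x = 0) -> forall x, l < x < r -> h x = 0.
Proof.
move=> Eae l0 r1 ch H x /andP[lx xr].
have x01 : 0 < x < 1 by apply/andP; split; lra.
apply/eqP; apply: contraT => hx; have hpos : 0 < `|h x| by rewrite normr_gt0.
have /cvgrPdist_lt /(_ _ hpos) [e /= e0 He] := within_cc_oo ch x01.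
have le : l < Num.min r (x + e) by rewrite lt_min (lt_trans lx xr)/= (lt_trans lx)// ltrDl.
have xe : x < Num.min r (x + e) by rewrite lt_min xr/= ltrDl.
have mr : Num.min r (x + e) <= 1 by rewrite ge_min r1.
have [y /andP[xy]] := ae_dense Eae (ltW (proj1 (andP x01))) xe mr.
rewrite lt_min => /andP[yr ye] Ey.
have := He y; rewrite /ball_ /= ltr0_norm ?subr_lt0// opprB ltrBlDl => /(_ ye).
by rewrite (H y Ey) ?subr0 ?ltxx// (lt_trans lx xy).
Qed.

End Affine.

(** * Neighbourhoods on which a continuous function stays positive *)

Section Gap.
Context {R : realType}.
Implicit Types (f g : R -> R) (x y d e : R).

Lemma within_ccB f g : {within `[0, 1], continuous f} -> {within `[0, 1], continuous g} ->
  {within `[0, 1], continuous (fun x : R => f x - g x : R)}.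
Proof. by move=> cf cg x; apply: cvgB; [exact: cf|exact: cg]. Qed.

Lemma positive_near0 f : {within `[0, 1], continuous f} -> 0 < f 0 ->
  exists2 d : R, 0 < d < 1 & forall x, 0 < x < d -> 0 < f x.
Proof.
rewrite continuous_within_itvP ?ltr01// => -[_ f0 _] fp.
have /cvgrPdist_lt /(_ _ fp) [e /= e0 He] := f0.
have fpos y : `|f 0 - f y| < f 0 -> 0 < f y by rewrite ltr_norml => /andP[? ?]; lra.
exists (Num.min e 2^-1); first by rewrite lt_min e0/= invr_gt0 ltr0n/= gt_min; apply/orP; right; lra.
move=> x /andP[x0]; rewrite lt_min => /andP[xe _]; apply/fpos/He => //=.
by rewrite sub0r normrN gtr0_norm.
Qed.

Lemma positive_near f x : {within `[0, 1], continuous f} -> 0 < x < 1 -> 0 < f x ->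
  exists2 e : R, 0 < e & [/\ 0 <= x - e, x + e <= 1 & forall y, x - e < y < x + e -> 0 < f y].
Proof.
move=> cf x01 fx; have /cvgrPdist_lt /(_ _ fx) [e /= e0 He] := within_cc_oo cf x01.
have fpos y : `|f x - f y| < f x -> 0 < f y by rewrite ltr_norml => /andP[? ?]; lra.
have /andP[x0 x1] := x01.
exists (Num.min e (Num.min x (1 - x))); first by rewrite !lt_min e0 x0 subr_gt0.
set e' := Num.min _ _.
have h1 : e' <= e by rewrite ge_min lexx.
have h2 : e' <= x by rewrite !ge_min lexx orbT.
have h3 : e' <= 1 - x by rewrite !ge_min lexx !orbT.
split; [lra|lra|move=> y /andP[y1 y2]].
by apply/fpos/He; rewrite /= ltr_norml; apply/andP; split; lra.
Qed.

End Gap.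

Theorem proposition2p8 (R : realType) (psi u : R -> R)
    (psi_cont : {within cc01, continuous psi})
    (psi_sym : forall x, oo01 x -> psi x = psi (1 - x))
    (psi_bnd : psi 0 = psi 1)
    (psi_neg : psi 1 < 0)
    (psi_pos : exists2 x0, oo01 x0 & 0 < psi x0)
    (u_min : is_minimiser psi u) :
  [/\ Ck01 2 u,
      weakly_differentiable (derive1n 2 u),
      BV01 (weak_derivative (derive1n 2 u)) &
      smooth_on (noncoincidence psi u) u].
Proof.
have [p [w [[cp p0 p1 w1 w2] [uE pE psym wsym] [up pw]]]] := minimiser_data u_min.
have [[uH u_sym u_ge] _] := u_min; have [_ cu [u0 u1] _] := uH.
have E_ae := good_pt_ae cp w1.
have E01 x : good_pt p w x -> 0 < x < 1 by case.
have convex := kinked_convex u_min cp p0 p1 w1 w2 psym wsym up pw.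
have affine := kinked_affine psi_cont psi_sym u_min cp p0 p1 w1 w2 psym wsym up pw.
have cgap := within_ccB cu psi_cont.
(* The boundary value u = 0 and the negative obstacle separate u from psi near 0; reflection does
   the same near 1. *)
have gap0 : 0 < u 0 - psi 0 by rewrite u0 sub0r oppr_gt0 psi_bnd.
have [d /andP[d0 d1] gapl] := positive_near0 cgap gap0.
have gapr x : 1 - d < x < 1 -> psi x < u x.
  move=> /andP[xd x1]; have x01 : oo01 x by apply/oo01E/andP; split; lra.
  by rewrite (psi_sym x x01) (u_sym x x01) -subr_gt0; apply: gapl; apply/andP; split; lra.
have left a b c : good_pt p w a -> good_pt p w b -> good_pt p w c -> a <= b -> b <= c -> c < d ->
    (c - b) * kinked p w a + (a - c) * kinked p w b + (b - a) * kinked p w c = 0.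
  move=> ga gb gc ab bc cd.
  apply: (affine a b c 0 d) => //; first exact: ltW.
    by move=> x /gapl; rewrite subr_gt0.
  by have /andP[] := E01 a ga.
have right a b c : good_pt p w a -> good_pt p w b -> good_pt p w c -> a <= b -> b <= c -> 1 - d < a ->
    (c - b) * kinked p w a + (a - c) * kinked p w b + (b - a) * kinked p w c = 0.
  move=> ga gb gc ab bc da.
  apply: (affine a b c (1 - d) 1) => //; first by rewrite subr_ge0 ltW.
  by have /andP[] := E01 c gc.
have [m [M [k [m_homo m_bd kE]]]] := convex_primitive E_ae E01 convex d0 d1 left right.
split.
- exact: Ck01_height cp w1 w2 uE pE m_homo m_bd kE cu.
- by eexists; exact: weak_derivative_curv cp w1 w2 uE pE m_homo m_bd kE.
- exact: BV01_weak_derivative_curv cp w1 w2 uE pE m_homo m_bd kE.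
move=> n x [/oo01E x01 gapx].
have gapx' : 0 < u x - psi x by rewrite subr_gt0.
have [e e0 [l0 r1 gap]] := positive_near cgap x01 gapx'.
have lr : x - e < x + e by lra.
have xI : `]x - e, x + e[%classic x by rewrite /= in_itv/=; apply/andP; split; lra.
have [al [ga aff]] := collinear_affine E_ae l0 lr r1 (fun a b c Ea Eb Ec la ab bc cr =>
  affine a b c (x - e) (x + e) l0 r1 (fun y yI => ltac:(rewrite -subr_gt0; exact: gap)) la cr Ea Eb Ec ab bc).
(* The affine formula is known only at good points so far; continuity of the primitive of [m]
   extends it to the whole interval. *)
have ch : {within `[0, 1], continuous (fun y => k + prim m y - (ga + al * y))}.
  apply: within_ccB.
    apply: within_ccD; first exact/continuous_subspaceT/cst_continuous.
    exact/prim_continuous/(monotone_L1 m_homo m_bd).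
  apply: continuous_subspaceT => y; apply: cvgD; first exact: cvg_cst.
  by apply: cvgM; [exact: cvg_cst|exact: cvg_id].
have kaff y : x - e < y < x + e -> k + prim m y = ga + al * y.
  move=> yI; apply/eqP; rewrite -subr_eq0; apply/eqP.
  apply: (dense_eq0 E_ae l0 r1 ch _ yI) => z Ez zI.
  by rewrite -kE// aff// subrr.
have sm := smooth_affine cp w1 w2 uE pE m_homo m_bd kE l0 r1 kaff.
exact: sm n x xI.
Qed.
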